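(* Let $N\ge 1$, let $\nu_1,\dots,\nu_{N-1}\in\mathbb{R}$, let $A=\sum_{i=1}^{N-1}\nu_iE_{i,i+1}$ and $J=\sum_{i=1}^N (N-i)E_{i,i}$, and let $W(x)=e^{-x^2}e^{Ax}e^{A^{T}x}$, $x\in\mathbb{R}$. Let $(\widehat P_n)_{n\in\mathbb{N}}$ be the monic matrix orthogonal polynomials with respect to $W$ and put $P_n(x)=e^{-A^2/4}\widehat P_n(x)$. Then for every $n\in\mathbb{N}$ there exist constant $N\times N$ matrices $C_n$ and $D_n$ such that for all $x\in\mathbb{R}$ $$P_n(x)e^{Ax}=\oint_{\gamma}z^{-J}C_nz^{J}e^{-z^2+2zx}\frac{dz}{z^{n+1}}$$ and $$P_n(x)e^{Ax}=e^{x^2}\int_{\mathcal I}w^{J}D_nw^{-J}e^{w^2-2xw}w^n\,dw ,$$ where the contour $\gamma$ encloses the origin, closes at $-\infty$ and is traversed counterclockwise, and $\mathcal I=L+i\mathbb{R}$ with $L>0$ chosen so that $\gamma$ and $\mathcal I$ do not intersect.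
   Context: $E_{i,j}$ is the $N\times N$ elementary matrix with $1$ at entry $(i,j)$ and $0$ elsewhere; $T$ denotes the transpose; $\mathbb{N}=\{0,1,2,\dots\}$. For a matrix weight $W$ on $\mathbb{R}$ the matrix-valued inner product is $\langle F,G\rangle_W=\int_{\mathbb{R}}F(x)W(x)G^{T}(x)\,dx$. The monic matrix orthogonal polynomials $\widehat P_n$ are the matrix polynomials $\widehat P_n(x)=x^nI_N+(\text{lower order terms})$ with $\langle\widehat P_n,\widehat P_m\rangle_W=0$ for $n\ne m$. For a matrix $M$, $z^{M}:=e^{M\log z}$, with the branch cut of $\log$ on the negative real axis (in the products above only integer powers of $z$, $w$ occur). The contour $\gamma$ comes from $-\infty$ below the negative real axis, goes counterclockwise around the origin, and returns to $-\infty$ above the negative real axis (both ends going to infinity in the direction of the negative real axis), staying to the left of $\mathcal I$; $\mathcal I$ is oriented upwards. *)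

(* Defs.v *)
From HB Require Import structures.
From mathcomp Require Import all_boot all_order all_algebra.
From mathcomp Require Import all_classical all_reals all_analysis.
From mathcomp Require Import complex.

Set Implicit Arguments.
Unset Strict Implicit.
Unset Printing Implicit Defensive.

Import Order.TTheory GRing.Theory Num.Theory.
Import numFieldNormedType.Exports.

Local Open Scope classical_set_scope.
Local Open Scope ring_scope.
Local Open Scope complex_scope.

(* Entrywise limit of the exponential series.  The topology of the scalars is
   that of the regular algebra K^o, since [i]-extensions such as R[i] carry no
   topology of their own. *)
Definition mexp (K : numFieldType) (N : nat) (M : 'M[K]_N) : 'M[K]_N :=
  \matrix_(i, j) limn (fun m : nat =>
    ((\sum_(k < m) (k`!%:R)^-1 *: M ^+ k) i j : K^o)).

Section ComplexFunctions.
Context {R : realType}.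
Implicit Type z : R[i].

Definition cexp z : R[i] :=
  (expR (complex.Re z))%:C * (cos (complex.Im z) +i* sin (complex.Im z)).

(* Principal argument, with values in ]-pi, pi]. *)
Definition carg z : R :=
  if 0 <= complex.Im z then acos (complex.Re z / Normc.normc z) else - acos (complex.Re z / Normc.normc z).

Definition clog z : R[i] := ln (Normc.normc z) +i* carg z.

Definition mxpower (N : nat) z (M : 'M[R[i]]_N) : 'M[R[i]]_N :=
  mexp (clog z *: M).

End ComplexFunctions.

Section Contours.
Context {R : realType}.
Implicit Types (g : R -> R[i]) (f : R[i] -> R[i]).

Definition cderivable g (t : R) : Prop :=
  derivable (fun s => complex.Re (g s)) t 1 /\ derivable (fun s => complex.Im (g s)) t 1.

Definition cderive g (t : R) : R[i] :=
  derive1 (fun s => complex.Re (g s)) t +i* derive1 (fun s => complex.Im (g s)) t.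

(* Continuous, and continuously differentiable off a finite set of break
   points, at which the derivative has one-sided limits. *)
Definition piecewise_C1 g : Prop :=
  continuous (g : R -> R[i]^o) /\
  exists breaks : seq R, forall t : R,
    [/\ t \notin breaks ->
          cderivable g t /\ {for t, continuous (cderive g : R -> R[i]^o)},
        cvg ((cderive g : R -> R[i]^o) @ t^'-) &
        cvg ((cderive g : R -> R[i]^o) @ t^'+)].

(* The integral of f along the arc g restricted to [a, b]; at the finitely many
   break points of g the value of cderive is irrelevant. *)
Definition arc_int g f (a b : R) : R[i] :=
  let h t := f (g t) * cderive g t in
  Rintegral lebesgue_measure `[a, b] (fun t => complex.Re (h t)) +i*
  Rintegral lebesgue_measure `[a, b] (fun t => complex.Im (h t)).

(* Integrals along contours parametrised by the whole real line are improper: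
   the two ends a --> -oo and b --> +oo go to infinity independently. *)
Definition contour_cvg g f : Prop :=
  cvg ((fun ab : R * R => (arc_int g f ab.1 ab.2 : R[i]^o)) @
       filter_prod (ninfty_nbhs R) (pinfty_nbhs R)).

Definition contour_int g f : R[i] :=
  lim ((fun ab : R * R => (arc_int g f ab.1 ab.2 : R[i]^o)) @
       filter_prod (ninfty_nbhs R) (pinfty_nbhs R)).

Definition mx_contour_cvg (N : nat) g (F : R[i] -> 'M[R[i]]_N) : Prop :=
  forall i j, contour_cvg g (fun z => F z i j).

Definition mx_contour_int (N : nat) g (F : R[i] -> 'M[R[i]]_N) : 'M[R[i]]_N :=
  \matrix_(i, j) contour_int g (fun z => F z i j).

(* A contour that stays off the branch cut ]-oo, 0] of the logarithm, comes from
   infinity in the direction of the negative real axis below it (argument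
   tending to -pi) and returns there above it (argument tending to pi); along
   such a contour carg is continuous, so that the contour turns once,
   counterclockwise, around the origin. *)
Definition hankel_contour g : Prop :=
  [/\ piecewise_C1 g,
      forall t, ~ (complex.Im (g t) = 0 /\ complex.Re (g t) <= 0),
      Normc.normc (g t) @[t --> -oo] --> +oo,
      Normc.normc (g t) @[t --> +oo] --> +oo &
      (carg (g t) @[t --> -oo] --> - (pi : R)) /\
      (carg (g t) @[t --> +oo] --> (pi : R))].

Definition left_of_line g (L : R) : Prop := forall t, complex.Re (g t) < L.

(* L + iR, oriented upwards. *)
Definition vertical_line (L : R) : R -> R[i] := fun t => L +i* t.

End Contours.

Section MatrixOrthogonality.
Context {R : realType} {N : nat}.
Implicit Types (F G : R -> 'M[R]_N) (P : 'M[{poly R}]_N).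

Definition mxpoly_eval P (x : R) : 'M[R]_N := map_mx (fun p => p.[x]) P.

(* P(x) = x^n I_N + terms of degree < n. *)
Definition mxpoly_monic (n : nat) P : Prop :=
  forall i j, (size ((P - ('X^n)%:M)%R i j) <= n)%N.

Definition mx_inner (W : R -> 'M[R]_N) F G : 'M[R]_N :=
  \matrix_(i, j) Rintegral lebesgue_measure setT
    (fun x => (F x *m W x *m (G x)^T) i j).

Definition monic_mop (W : R -> 'M[R]_N) (P : nat -> 'M[{poly R}]_N) : Prop :=
  (forall n, mxpoly_monic n (P n)) /\
  (forall n m, n <> m -> mx_inner W (mxpoly_eval (P n)) (mxpoly_eval (P m)) = 0).

End MatrixOrthogonality.

Section HermiteWeight.
Context {R : realType} {N : nat}.

(* nu is indexed from 0: nu k multiplies the k-th superdiagonal entry. *)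
Definition superdiag (nu : 'I_N.-1 -> R) : 'M[R]_N :=
  \matrix_(i, j) \sum_(k < N.-1) nu k *+ ((i == k :> nat) && (j == k.+1 :> nat)).

(* The rows being numbered from 0, entry i is N - (i + 1). *)
Definition matJ : 'M[R[i]]_N := \sum_(i < N) (N - i.+1)%:R *: delta_mx i i.

Definition weight (A : 'M[R]_N) (x : R) : 'M[R]_N :=
  expR (- x ^+ 2) *: (mexp (x *: A) *m mexp (x *: A^T)).

Definition renormalized (A : 'M[R]_N) (P : 'M[{poly R}]_N) (x : R) : 'M[R]_N :=
  mexp (- (4%:R)^-1 *: (A ^+ 2)) *m mxpoly_eval P x.

Definition gamma_integrand (n : nat) (C : 'M[R[i]]_N) (x : R) (z : R[i]) :
    'M[R[i]]_N :=
  (cexp (- z ^+ 2 + 2%:R * z * x%:C) / z ^+ n.+1) *: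
    (mxpower z (- matJ) *m C *m mxpower z matJ).

Definition line_integrand (n : nat) (D : 'M[R[i]]_N) (x : R) (w : R[i]) :
    'M[R[i]]_N :=
  (cexp (w ^+ 2 - 2%:R * x%:C * w) * w ^+ n) *:
    (mxpower w matJ *m D *m mxpower w (- matJ)).

End HermiteWeight.

(* Main.v *)
(* The matrix e^(-A^2/4) P(x) e^(A x), for P the n-th monic orthogonal polynomial, has
   entries c_(i,j) H_(n+j-i)(x) with Hermite polynomials H_k and constants c_(i,j).
   Indeed R = P e^(A x) is orthogonal for the scalar weight e^(-x^2), and the operator
   F |-> F'' - 2 x F' - 2 F J is symmetric for this weight and, because [J, A] = A,
   maps Q e^(A x) to T(Q) e^(A x) where T does not raise degrees.  Hence R is an
   eigenfunction, with matrix eigenvalue A^2 - 2 J - 2 n, which conjugation by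
   e^(-A^2/4) turns into the diagonal matrix - 2 J - 2 n; so every entry satisfies a
   scalar Hermite equation.  The conjugations by z^J and w^J shift the powers of z and
   w by i - j and j - i, and the entries of the two integrals are the classical
   integral representations of Hermite polynomials, obtained by integration by parts
   from their first two instances.  For the contour around the origin the primitive of
   the integrand is taken in the coordinate log z, and the integral is its increment
   under log z |-> log z + 2 pi i. *)
Require Import Defs.
From HB Require Import structures.
From mathcomp Require Import all_boot all_order all_algebra.
From mathcomp Require Import all_classical all_reals all_analysis.
From mathcomp Require Import complex.
From mathcomp Require Import ring lra measurable_realfun gauss_integral normal_distribution.

Set Implicit Arguments.
Unset Strict Implicit.
Unset Printing Implicit Defensive.

Import Order.TTheory GRing.Theory Num.Theory.
Import numFieldNormedType.Exports.

Local Open Scope classical_set_scope.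
Local Open Scope ring_scope.
Local Open Scope complex_scope.

(** Since A is nilpotent, e^(A x) is a polynomial matrix; the eigenvalue argument therefore stays
    inside polynomial matrices, with an abstract linear functional in place of the integral. On the
    analytic side every contour integral is the increment of an explicit primitive between the two
    ends of the contour, so an arbitrary piecewise smooth contour can be treated without deforming
    it. The delicate point is at the ends of the contour around the origin: their arguments only
    tend to -pi and pi, so they have to be compared with the lines Im zeta = -pi and Im zeta = pi,
    zeta = log z, near which e^(-z^2) still decays. With k = n + j - i, that contour yields 2 pi i
    H_k(x) / k! and the vertical line yields i sqrt(pi) e^(-x^2) H_k(x) / 2^k. Hence C_n and D_n
    have the entries c_(i,j) k! / (2 pi i) and c_(i,j) 2^k / (i sqrt(pi)), which depend neither on x
    nor on the contours. When n + j < i no Hermite polynomial is available, but then c_(i,j) = 0,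
    because p'' - 2 X p' has no positive eigenvalue on polynomials. *)

Local Arguments Normc.normc : simpl never.

(** * Hermite polynomials *)

Section HermitePoly.
Context {R : realFieldType}.
Implicit Types p q : {poly R}.

Fixpoint hermite (k : nat) : {poly R} :=
  if k is k'.+1 then 2 *: 'X * hermite k' - (hermite k')^`() else 1.

Definition hermite_op p : {poly R} := p^`()^`() - 2 *: 'X * p^`().

Lemma hermite_opD p q : hermite_op (p + q) = hermite_op p + hermite_op q.
Proof. by rewrite /hermite_op !derivD; ring. Qed.

Lemma hermite_opZ a p : hermite_op (a *: p) = a *: hermite_op p.
Proof. by rewrite /hermite_op !derivZ -!mul_polyC; ring. Qed.

Lemma coef_hermite_op p k : (hermite_op p)`_k = p`_k.+2 *+ k.+2 *+ k.+1 - p`_k *+ (2 * k).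
Proof.
rewrite /hermite_op coefB !coef_deriv -scalerAl coefZ coefXM.
case: k => [|k] /=; first by rewrite muln0 mulr0n; ring.
by rewrite coef_deriv; congr (_ - _); rewrite mulr_natl -mulrnA mulnC.
Qed.

(** The two facts feed each other: the differential equation at k+1 follows from the derivative rule
    at the same index, and differentiating the recursion and inserting that equation gives the
    derivative rule one index higher. *)
Lemma hermite_deriv_ODE k : (hermite k.+1)^`() = (2 * k.+1%:R) *: hermite k /\
  hermite_op (hermite k) + (2 * k%:R) *: hermite k = 0.
Proof.
rewrite /hermite_op; elim: k => [|k [IH1 IH2]].
  by rewrite /= derivB derivM derivZ derivX derivC deriv0; split; rewrite -!mul_polyC; ring.
have ODE : (hermite k.+1)^`()^`() - 2 *: 'X * (hermite k.+1)^`() + (2 * k.+1%:R) *: hermite k.+1 = 0.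
  rewrite IH1 derivZ [hermite k.+1]/= -/(hermite k) -!mul_polyC; ring.
split => //.
have E : (hermite k.+1)^`()^`() = 2 *: 'X * (hermite k.+1)^`() - (2 * k.+1%:R) *: hermite k.+1.
  by rewrite -[LHS]subr0 -ODE -!mul_polyC; ring.
rewrite [hermite k.+2]/= -/(hermite k.+1) derivB derivM derivZ derivX E.
rewrite -[k.+2%:R]natr1 -!mul_polyC; ring.
Qed.

Lemma hermite1 : hermite 1 = 2 *: 'X.
Proof. by rewrite /= derivC subr0 mulr1. Qed.

Lemma hermite_rec k : hermite k.+2 = 2 *: 'X * hermite k.+1 - (2 * k.+1%:R) *: hermite k.
Proof. by rewrite [LHS]/= -/(hermite k.+1) (hermite_deriv_ODE k).1. Qed.

Lemma hermite_recE k (x : R) :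
  (hermite k.+2).[x] = 2 * x * (hermite k.+1).[x] - 2 * k.+1%:R * (hermite k).[x].
Proof. by rewrite hermite_rec !hornerE. Qed.

(** On the leading term X^m the operator acts as multiplication by -2 m, so the eigenvalue
    determines the degree. *)
Lemma hermite_op_eigen_degree (a : R) q : hermite_op q + (2 * a) *: q = 0 -> q != 0 -> a = (size q).-1%:R.
Proof.
move=> H q0; have := congr1 (fun p : {poly R} => p`_(size q).-1) H.
rewrite coefD coef_hermite_op coefZ coef0 [q`__.+2]nth_default; last first.
  by rewrite (leq_trans (leqSpred _)).
rewrite !mul0rn sub0r => E.
have /eqP : 2 * q`_(size q).-1 * (a - (size q).-1%:R) = 0.
  by rewrite -[RHS]E -[_ *+ (2 * _)]mulr_natl natrM; ring.
rewrite !mulf_eq0 pnatr_eq0 -/(lead_coef q) lead_coef_eq0 (negbTE q0) /= subr_eq0.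
by move=> /eqP.
Qed.

(** The differential equation already fixes the degree of [hermite k] as k; hence the derivative in
    the recursion does not reach the coefficient of index k+1, which is twice the preceding leading
    one. *)
Lemma coef_hermite k : (hermite k)`_k != 0.
Proof.
elim: k => [|k IH]; first by rewrite /= coefC oner_eq0.
have h0 : hermite k != 0 by apply: contraNneq IH => ->; rewrite coef0.
have /eqP := hermite_op_eigen_degree (hermite_deriv_ODE k).2 h0; rewrite eqr_nat => /eqP sz.
rewrite /= -/(hermite k) coefB -scalerAl coefZ coefXM /= coef_deriv.
rewrite [(hermite k)`_k.+2]nth_default ?mul0rn ?subr0 ?mulf_neq0 ?pnatr_eq0 //.
by rewrite (leq_trans (leqSpred _)) // -sz.
Qed.

(** Subtracting the multiple that cancels the coefficient of X^k leaves a solution for the same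
    eigenvalue; were it nonzero, its degree would be k. *)
Lemma hermite_op_eigen_nat k q : hermite_op q + (2 * k%:R) *: q = 0 -> q = (q`_k / (hermite k)`_k) *: hermite k.
Proof.
move=> Hq.
set c := _ / _; apply/eqP; rewrite -subr_eq0; apply/negPn/negP => r0.
have Hr : hermite_op (q - c *: hermite k) + (2 * k%:R) *: (q - c *: hermite k) = 0.
  have -> : q - c *: hermite k = q + (- c) *: hermite k by rewrite scaleNr.
  transitivity ((hermite_op q + (2 * k%:R) *: q) + (- c) *: (hermite_op (hermite k) + (2 * k%:R) *: hermite k)).
    by rewrite hermite_opD hermite_opZ -!mul_polyC; ring.
  by rewrite Hq (hermite_deriv_ODE k).2 scaler0 addr0.
have /eqP := hermite_op_eigen_degree Hr r0; rewrite eqr_nat => /eqP kE.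
move: r0; rewrite -lead_coef_eq0 /lead_coef -kE coefB coefZ /c divfK ?subrr ?eqxx //.
exact: coef_hermite.
Qed.

Lemma hermite_op_eigen_neg a q : hermite_op q + (2 * a) *: q = 0 -> a < 0 -> q = 0.
Proof.
move=> Hq a0; apply/eqP/negPn/negP => q0; move: a0.
by rewrite (hermite_op_eigen_degree Hq q0) ltNge ler0n.
Qed.

End HermitePoly.

(** * Exponentials of nilpotent matrices *)

Lemma mulmxMl (K : pzRingType) m n p (F : 'M[K]_(m, n)) (G : 'M[K]_(n, p)) k :
  (F *+ k) *m G = (F *m G) *+ k.
Proof. by elim: k => [|k IH]; rewrite ?mulr0n ?mul0mx // !mulrS mulmxDl IH. Qed.

Lemma mulmxMr (K : pzRingType) m n p (F : 'M[K]_(m, n)) (G : 'M[K]_(n, p)) k :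
  F *m (G *+ k) = (F *m G) *+ k.
Proof. by elim: k => [|k IH]; rewrite ?mulr0n ?mulmx0 // !mulrS mulmxDr IH. Qed.

Lemma exprZmx (K : comNzRingType) n (a : K) (F : 'M[K]_n) k :
  (a *: F) ^+ k = a ^+ k *: F ^+ k.
Proof.
elim: k => [|k IH]; first by rewrite !expr0 scale1r.
by rewrite !exprS IH -[_ * _]/(_ *m _) -scalemxAl -scalemxAr scalerA.
Qed.

Section NilpotentExp.
Context {K : comNzRingType} {N : nat}.
Variable c : nat -> K.
Hypothesis cS : forall k, c k = c k.+1 *+ k.+1.

(** The coefficients stand for 1/k!, of which only the recursion [cS] is retained; the same sum then
    serves over [R] and over [{poly R}]. *)
Definition nexp (B : 'M[K]_N) : 'M[K]_N := \sum_(k < N) c k *: B ^+ k.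

(** Weighting the k-th term by k shifts the sum by one power; the power B^N that overflows is zero.
    This sum arises both from X d/dX and from commuting with a grading matrix. *)
Lemma nexp_euler (B : 'M[K]_N) : B ^+ N = 0 ->
  \sum_(k < N) c k *: (B ^+ k *+ k) = B *m nexp B.
Proof.
move=> BN; rewrite /nexp; case: N B BN => [|n] B BN.
  by rewrite !big_ord0 mulmx0.
rewrite big_ord_recl mulr0n scaler0 add0r mulmx_sumr big_ord_recr /=.
rewrite -scalemxAr -[B *m _]/(B * _) -exprS BN scaler0 addr0.
apply: eq_bigr => k _; rewrite /bump /= add1n -scalemxAr -[B *m _]/(B * _) -exprS.
by rewrite [in RHS]cS -scalerMnl scalerMnr.
Qed.

(** The relation B J = (J - a) B gives B^k J = (J - k a) B^k, and summing the corrections produces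
    the sum of [nexp_euler]. *)
Lemma nexp_comm (B J : 'M[K]_N) (a : K) : B ^+ N = 0 -> B *m J = J *m B - a *: B ->
  nexp B *m J = J *m nexp B - a *: (B *m nexp B).
Proof.
move=> BN BJ.
have BkJ k : B ^+ k *m J = J *m B ^+ k - (a *: B ^+ k) *+ k.
  elim: k => [|k IH]; first by rewrite !expr0 mulr0n subr0 -[_ *m J]/(1 * J) -[J *m _]/(J * 1) mul1r mulr1.
  have -> : B ^+ k.+1 *m J = (B ^+ k *m J) *m B - a *: B ^+ k.+1.
    have -> : B ^+ k.+1 = B ^+ k *m B by rewrite exprSr.
    by rewrite -mulmxA BJ mulmxBr -scalemxAr mulmxA.
  rewrite IH mulmxBl -mulmxA mulmxMl -scalemxAl -[B ^+ k *m B]/(B ^+ k * B) -exprSr.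
  by rewrite -addrA -opprD mulrSr.
rewrite -nexp_euler // /nexp mulmx_suml mulmx_sumr scaler_sumr -sumrB.
apply: eq_bigr => k _; rewrite -scalemxAl BkJ scalerBr -scalemxAr; congr (_ - _).
by rewrite -!scalerMnr !scalerA mulrC.
Qed.

Lemma nexp_mulC (B : 'M[K]_N) : B *m nexp B = nexp B *m B.
Proof.
rewrite /nexp mulmx_sumr mulmx_suml; apply: eq_bigr => k _.
by rewrite -scalemxAr -scalemxAl -[B *m _]/(B * _) -[_ *m B]/(_ * B) -exprS exprSr.
Qed.

End NilpotentExp.

(** * Polynomial matrices and their matrix coefficients *)

Section PolyMatrix.
Context {R : realFieldType} {N : nat}.
Implicit Types (P F G : 'M[{poly R}]_N) (B : 'M[R]_N).

Definition const_pmx B : 'M[{poly R}]_N := map_mx polyC B.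
Definition deriv_pmx F : 'M[{poly R}]_N := map_mx (@deriv R) F.
Definition coef_mx k F : 'M[R]_N := \matrix_(i, j) (F i j)`_k.

Lemma const_pmxM B B' : const_pmx (B *m B') = const_pmx B *m const_pmx B'.
Proof. exact: map_mxM. Qed.
Lemma const_pmxB B B' : const_pmx (B - B') = const_pmx B - const_pmx B'.
Proof. exact: map_mxB. Qed.
Lemma const_pmxN B : const_pmx (- B) = - const_pmx B.
Proof. exact: map_mxN. Qed.
Lemma const_pmxX B k : const_pmx (B ^+ k) = const_pmx B ^+ k.
Proof.
elim: k => [|k IH]; last by rewrite !exprS [const_pmx _]const_pmxM IH.
by rewrite !expr0; apply/matrixP => i j; rewrite !mxE; case: (i == j).
Qed.

Lemma deriv_pmxD F G : deriv_pmx (F + G) = deriv_pmx F + deriv_pmx G.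
Proof. by apply/matrixP => i j; rewrite !mxE derivD. Qed.
Lemma deriv_pmxM F G : deriv_pmx (F *m G) = deriv_pmx F *m G + F *m deriv_pmx G.
Proof.
apply/matrixP => i j; rewrite !mxE raddf_sum -big_split /=.
by apply: eq_bigr => k _; rewrite !mxE derivM.
Qed.
Lemma deriv_const_pmx B : deriv_pmx (const_pmx B) = 0.
Proof. by apply/matrixP => i j; rewrite !mxE derivC. Qed.
Lemma deriv_pmx_const_mul B F : deriv_pmx (const_pmx B *m F) = const_pmx B *m deriv_pmx F.
Proof. by rewrite deriv_pmxM deriv_const_pmx mul0mx add0r. Qed.
Lemma coef_mxD k F G : coef_mx k (F + G) = coef_mx k F + coef_mx k G.
Proof. by apply/matrixP => i j; rewrite !mxE coefD. Qed.
Lemma coef_mxN k F : coef_mx k (- F) = - coef_mx k F.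
Proof. by apply/matrixP => i j; rewrite !mxE coefN. Qed.
Lemma coef_mxMn k F m : coef_mx k (F *+ m) = coef_mx k F *+ m.
Proof. by elim: m => [|m IH]; [apply/matrixP => i j; rewrite !mxE coef0|rewrite !mulrS coef_mxD IH]. Qed.
Lemma coef_mx_const_mul k B F : coef_mx k (const_pmx B *m F) = B *m coef_mx k F.
Proof.
apply/matrixP => i j; rewrite !mxE coef_sum; apply: eq_bigr => l _.
by rewrite !mxE coefCM.
Qed.
Lemma coef_mx_mul_const k B F : coef_mx k (F *m const_pmx B) = coef_mx k F *m B.
Proof.
apply/matrixP => i j; rewrite !mxE coef_sum; apply: eq_bigr => l _.
by rewrite !mxE coefMC.
Qed.
Lemma coef_mx_deriv k F : coef_mx k (deriv_pmx F) = coef_mx k.+1 F *+ k.+1.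
Proof. by apply/matrixP => i j; rewrite !mxE mulmxnE !mxE coef_deriv. Qed.
Lemma coef_mx_Xderiv k F : coef_mx k ('X *: deriv_pmx F) = coef_mx k F *+ k.
Proof.
apply/matrixP => i j; rewrite mulmxnE !mxE coefXM.
by case: k => [|k] //=; rewrite coef_deriv.
Qed.

Definition coef_mx_lt m F := forall k, (m <= k)%N -> coef_mx k F = 0.

Lemma coef_mx_lt0 F : coef_mx_lt 0 F -> F = 0.
Proof.
move=> H; apply/matrixP => i j; rewrite mxE; apply/polyP => k; rewrite coef0.
by have /matrixP/(_ i j) := H k (leq0n k); rewrite !mxE.
Qed.

End PolyMatrix.

(** * The Hermite operator on matrix polynomials *)

Section HermiteSystem.
Context {R : realFieldType} {N : nat}.
Implicit Types (P F G : 'M[{poly R}]_N) (B : 'M[R]_N).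
(** Stands for integration against e^(-x^2); linearity, integration by parts and definiteness on
    sums of squares are all that the algebra uses. *)
Variable l : {poly R} -> R.
Hypothesis lD : forall p q, l (p + q) = l p + l q.
Hypothesis lZ : forall a p, l (a *: p) = a * l p.
Hypothesis lparts : forall p, l (p^`() - 2 *: 'X * p) = 0.
Hypothesis ldef : forall (I : finType) (p : I -> {poly R}), l (\sum_i p i * p i) = 0 -> forall i, p i = 0.

Lemma lfun0 : l 0 = 0.
Proof. by rewrite -(scale0r (0 : {poly R})) lZ mul0r. Qed.
Lemma lfunN p : l (- p) = - l p.
Proof. by rewrite -scaleN1r lZ mulN1r. Qed.
Lemma lfun_sum (I : Type) (r : seq I) (p : I -> {poly R}) : l (\sum_(i <- r) p i) = \sum_(i <- r) l (p i).
Proof. by apply: (big_morph l lD lfun0). Qed.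

(** Both sides equal -l(p' q'), by integration by parts applied to p' q. *)
Lemma lfun_hermite_op p q : l (hermite_op p * q) = l (p * hermite_op q).
Proof.
have H a b : l (hermite_op a * b) = - l (a^`() * b^`()).
  have := lparts (a^`() * b); rewrite derivM => E.
  apply/eqP; rewrite -addr_eq0 -lD -[0]E; apply/eqP; congr l; rewrite /hermite_op; ring.
by rewrite H [p * _]mulrC H mulrC.
Qed.

Definition mx_ip F G : 'M[R]_N := map_mx l (F *m G^T).

Lemma mx_ipE F G i j : mx_ip F G i j = \sum_k l (F i k * G j k).
Proof. by rewrite !mxE lfun_sum; apply: eq_bigr => k _; rewrite !mxE. Qed.

Lemma mx_ipDl F F' G : mx_ip (F + F') G = mx_ip F G + mx_ip F' G.
Proof. by apply/matrixP => i j; rewrite /mx_ip mulmxDl !mxE lD. Qed.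
Lemma mx_ipNl F G : mx_ip (- F) G = - mx_ip F G.
Proof. by apply/matrixP => i j; rewrite /mx_ip mulNmx !mxE lfunN. Qed.
Lemma mx_ipDr F G G' : mx_ip F (G + G') = mx_ip F G + mx_ip F G'.
Proof. by apply/matrixP => i j; rewrite /mx_ip linearD mulmxDr !mxE lD. Qed.
Lemma mx_ip0r F : mx_ip F 0 = 0.
Proof. by apply/matrixP => i j; rewrite /mx_ip trmx0 mulmx0 !mxE lfun0. Qed.
Lemma mx_ipMl B F G : mx_ip (const_pmx B *m F) G = B *m mx_ip F G.
Proof.
apply/matrixP => i j; rewrite /mx_ip -mulmxA !mxE lfun_sum; apply: eq_bigr => k _.
by rewrite [const_pmx B i k]mxE mul_polyC lZ [in RHS]mxE.
Qed.
Lemma mx_ipMr B F G : mx_ip F (const_pmx B *m G) = mx_ip F G *m B^T.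
Proof.
apply/matrixP => i j; rewrite mx_ipE mxE.
under [RHS]eq_bigr do rewrite mx_ipE mulr_suml.
rewrite exchange_big /=; apply: eq_bigr => k _.
rewrite [(const_pmx B *m G) j k]mxE mulr_sumr lfun_sum; apply: eq_bigr => m _.
by rewrite [const_pmx B j m]mxE [B^T _ _]mxE mul_polyC -scalerAr lZ mulrC.
Qed.

Variables A J : 'M[R]_N.
Variable Jd : 'I_N -> R.
Hypothesis JE : forall i j, J i j = (i == j)%:R * Jd i.
Hypothesis AN : A ^+ N = 0.
Hypothesis AJ : A *m J = J *m A - A.

(* In terms of F = P e^(A X) the second order operator having the monic orthogonal
   polynomials as eigenfunctions is entrywise a shifted Hermite operator. *)
Definition mx_hermite_op F : 'M[{poly R}]_N := \matrix_(i, j) (hermite_op (F i j) - (2 * Jd j) *: F i j).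

Lemma mulmxJ F i j : (F *m const_pmx J) i j = Jd j *: F i j.
Proof.
rewrite mxE (bigD1 j) //= [const_pmx J _ _]mxE JE eqxx mul1r big1 ?addr0 => [|k kj].
  by rewrite mulrC mul_polyC.
by rewrite [const_pmx J _ _]mxE JE (negbTE kj) mul0r mulr0.
Qed.

(** Right multiplication by the diagonal J scales column j by [Jd j], so the entrywise shift is the
    term -2 F J. *)
Lemma mx_hermite_opE F : mx_hermite_op F = deriv_pmx (deriv_pmx F) - 'X *: deriv_pmx F *+ 2 - (F *m const_pmx J) *+ 2.
Proof.
apply/matrixP => i j; rewrite [LHS]mxE /hermite_op.
rewrite [RHS]mxE [(deriv_pmx (deriv_pmx F) - _) i j]mxE [deriv_pmx (deriv_pmx F) i j]mxE [deriv_pmx F i j]mxE.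
rewrite [(- ('X *: deriv_pmx F *+ 2)) i j]mxE [(- (F *m const_pmx J *+ 2)) i j]mxE !mulmxnE mulmxJ.
rewrite [('X *: deriv_pmx F) i j]mxE [deriv_pmx F i j]mxE -!mul_polyC polyCM; ring.
Qed.

Lemma mx_ip_hermite_op F G : mx_ip (mx_hermite_op F) G = mx_ip F (mx_hermite_op G).
Proof.
apply/matrixP => i j; rewrite !mx_ipE; apply: eq_bigr => k _.
rewrite !mxE mulrBl mulrBr !lD !lfunN lfun_hermite_op; congr (_ - _).
by rewrite -scalerAl -scalerAr.
Qed.

Lemma mx_hermite_op_const B F : mx_hermite_op (const_pmx B *m F) = const_pmx B *m mx_hermite_op F.
Proof.
by rewrite !mx_hermite_opE !deriv_pmx_const_mul !mulmxBr !mulmxMr -scalemxAr mulmxA.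
Qed.

Definition inv_fact (k : nat) : {poly R} := ((k`!%:R)^-1)%:P.

Lemma inv_factS k : inv_fact k = inv_fact k.+1 *+ k.+1.
Proof.
rewrite /inv_fact -polyCMn; congr (_%:P).
rewrite factS natrM invfM -[RHS]mulr_natl mulrA mulfV ?mul1r ?pnatr_eq0 //.
Qed.

Definition pexp : 'M[{poly R}]_N := nexp inv_fact ('X *: const_pmx A).

Lemma XA_nilp : ('X *: const_pmx A) ^+ N = 0.
Proof. by rewrite exprZmx -const_pmxX AN [const_pmx 0]map_mx0 scaler0. Qed.

(** After multiplication by X the derivative becomes X d/dX, to which [nexp_euler] applies; X is
    then cancelled in the domain [{poly R}]. *)
Lemma deriv_pexp : deriv_pmx pexp = const_pmx A *m pexp.
Proof.
have H : 'X *: deriv_pmx pexp = 'X *: (const_pmx A *m pexp).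
  rewrite scalemxAl -(nexp_euler inv_factS XA_nilp).
  apply/matrixP => i j; rewrite mxE [deriv_pmx pexp i j]mxE /pexp /nexp !summxE raddf_sum mulr_sumr.
  apply: eq_bigr => k _ /=.
  have E : (('X *: const_pmx A) ^+ k) i j = 'X^k * ((A ^+ k) i j)%:P.
    by rewrite exprZmx -const_pmxX mxE mxE.
  rewrite mxE E [in RHS]mxE mulmxnE E /inv_fact.
  rewrite derivM derivC mul0r add0r derivM derivC mulr0 addr0 derivXn.
  case: (nat_of_ord k) => [|m]; first by rewrite !mulr0n mul0r !mulr0.
  rewrite /= mulrnAl !mulrnAr; congr (_ *+ _); rewrite (exprS 'X); ring.
apply/matrixP => i j; have /matrixP/(_ i j) := H.
rewrite [in LHS]mxE [in RHS]mxE => /(mulfI _); apply.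
by rewrite polyX_eq0.
Qed.

Lemma pexpJ : pexp *m const_pmx J = const_pmx J *m pexp - 'X *: (const_pmx A *m pexp).
Proof.
rewrite -[in RHS](scale1r ('X *: _)) [in RHS]scalemxAl.
apply: (nexp_comm inv_factS XA_nilp).
by rewrite -scalemxAl -const_pmxM AJ const_pmxB const_pmxM scale1r scalerBr -scalemxAr.
Qed.

Definition conj_op P : 'M[{poly R}]_N :=
  deriv_pmx (deriv_pmx P) + (deriv_pmx P *m const_pmx A) *+ 2 + P *m const_pmx (A *m A) - 'X *: deriv_pmx P *+ 2 - (P *m const_pmx J) *+ 2.

(** The term -2 X F' contributes -2 X P A e^(A X), the only one that would raise the degree; it is
    cancelled by the commutator that appears when J moves to the left of e^(A X). *)
Lemma mx_hermite_op_pexp P : mx_hermite_op (P *m pexp) = conj_op P *m pexp.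
Proof.
rewrite mx_hermite_opE /conj_op !(deriv_pmxM, deriv_pmxD) deriv_pexp deriv_pmx_const_mul deriv_pexp const_pmxM.
rewrite !(mulmxDl, mulNmx) -!mulmxMl ?mulmxDl -!mulmxA pexpJ mulmxBr.
rewrite -!scalemxAl -!scalemxAr !scalerDr.
move: (deriv_pmx (deriv_pmx P) *m pexp) (deriv_pmx P *m (const_pmx A *m pexp)) (P *m (const_pmx A *m (const_pmx A *m pexp)))
  (deriv_pmx P *m pexp) (P *m (const_pmx A *m pexp)) (P *m (const_pmx J *m pexp)) => a b c d e f.
by apply/matrixP => i j; rewrite !(mxE, mulmxnE); ring.
Qed.

Lemma coef_mx_conj_op k P : coef_mx k (conj_op P) = coef_mx k.+2 P *+ k.+2 *+ k.+1 + (coef_mx k.+1 P *m A) *+ k.+1 *+ 2 +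
  coef_mx k P *m (A *m A) - coef_mx k P *+ k *+ 2 - (coef_mx k P *m J) *+ 2.
Proof.
rewrite /conj_op !(coef_mxD, coef_mxN, coef_mxMn) coef_mx_deriv coef_mx_deriv !coef_mx_mul_const coef_mx_Xderiv coef_mx_deriv.
by rewrite mulmxMl.
Qed.

Lemma coef_mx_lt_conj_op m P : coef_mx_lt m P -> coef_mx_lt m (conj_op P).
Proof.
move=> H k mk; rewrite coef_mx_conj_op (H k) // (H k.+1) ?(leqW mk) // (H k.+2) ?leqW //.
by rewrite !mul0mx !mul0rn !(addr0, subr0).
Qed.

Variable Ph : nat -> 'M[{poly R}]_N.
Hypothesis Ph_monic : forall n, coef_mx_lt n (Ph n - ('X^n)%:M).
Hypothesis Ph_orth : forall n m, n <> m -> mx_ip (Ph n *m pexp) (Ph m *m pexp) = 0.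

Lemma coef_mx_scalar k m : coef_mx k (('X^m)%:M : 'M[{poly R}]_N) = (k == m)%:R%:M.
Proof.
by apply/matrixP => i j; rewrite !mxE /= coefMn coefXn; case: (i == j); rewrite ?mulr1n ?mulr0n.
Qed.

Lemma coef_mx_Ph n k : (n <= k)%N -> coef_mx k (Ph n) = (k == n)%:R%:M.
Proof.
move=> nk; have /eqP := Ph_monic nk; rewrite coef_mxD coef_mxN subr_eq0 => /eqP ->.
exact: coef_mx_scalar.
Qed.

(** The top coefficient of P is removed by subtracting a constant left multiple of [Ph m], which is
    orthogonal to [Ph n] because m < n; the rest has lower degree. *)
Lemma Ph_orth_lower n m P : (m <= n)%N -> coef_mx_lt m P -> mx_ip (Ph n *m pexp) (P *m pexp) = 0.
Proof.
elim: m P => [|m IH] P mn HP; first by rewrite (coef_mx_lt0 HP) mul0mx mx_ip0r.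
have -> : P = (P - const_pmx (coef_mx m P) *m Ph m) + const_pmx (coef_mx m P) *m Ph m by rewrite subrK.
rewrite mulmxDl mx_ipDr -mulmxA mx_ipMr Ph_orth ?mul0mx ?addr0; last first.
  by move=> E; move: mn; rewrite E ltnn.
apply: IH; first exact: ltnW.
move=> k; rewrite leq_eqVlt => /orP[/eqP <-|mk].
  by rewrite coef_mxD coef_mxN coef_mx_const_mul coef_mx_Ph // eqxx mulmx1 subrr.
by rewrite coef_mxD coef_mxN coef_mx_const_mul coef_mx_Ph ?(ltnW mk) // HP // gtn_eqF // mulr0n // raddf0 mulmx0 subrr.
Qed.

(** The diagonal entry of index i is l of the sum of the squares of row i. *)
Lemma mx_ip_definite F : mx_ip F F = 0 -> F = 0.
Proof.
move=> H; apply/matrixP => i j; rewrite mxE.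
apply: (ldef (p := fun j => F i j)).
by have /matrixP/(_ i i) := H; rewrite mx_ipE mxE lfun_sum.
Qed.

(* The coefficient of X^n in conj_op P for P monic of degree n. *)
Definition eigen_mx n : 'M[R]_N := A *m A - J *+ 2 - (n%:R%:M) *+ 2.

Lemma coef_mx_lt_eigen n : coef_mx_lt n (conj_op (Ph n) - const_pmx (eigen_mx n) *m Ph n).
Proof.
move=> k nk; rewrite coef_mxD coef_mxN coef_mx_conj_op coef_mx_const_mul.
rewrite (coef_mx_Ph nk) (@coef_mx_Ph n k.+1) ?leqW // (@coef_mx_Ph n k.+2) ?leqW //.
rewrite (gtn_eqF (nk : (n < k.+1)%N)) (gtn_eqF (leqW nk : (n < k.+2)%N)).
rewrite !raddf0 !mul0mx !mul0rn !add0r.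
have [->|_] := eqVneq k n; last by rewrite raddf0 !mul0mx mulmx0 !mul0rn !subr0.
rewrite (_ : true%:R = 1 :> R) // !mul1mx mulmx1 /eigen_mx.
have -> : (n%:R%:M : 'M[R]_N) = 1%:M *+ n by rewrite -scalemx1 scaler_nat.
by rewrite [X in X - _]addrAC subrr.
Qed.

(** The difference of the two sides is G e^(A X) with G of degree below n. Its inner product with
    itself vanishes: move the operator onto G e^(A X) by symmetry, which does not raise the degree
    of G, and use the orthogonality of [Ph n] to lower degrees. *)
Lemma mx_hermite_op_Ph n : mx_hermite_op (Ph n *m pexp) = const_pmx (eigen_mx n) *m (Ph n *m pexp).
Proof.
apply/eqP; rewrite -subr_eq0; apply/eqP.
have E : mx_hermite_op (Ph n *m pexp) - const_pmx (eigen_mx n) *m (Ph n *m pexp) = (conj_op (Ph n) - const_pmx (eigen_mx n) *m Ph n) *m pexp.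
  by rewrite mx_hermite_op_pexp [RHS]mulmxBl mulmxA.
apply: mx_ip_definite; rewrite [X in mx_ip _ X]E mx_ipDl mx_ipNl mx_ipMl mx_ip_hermite_op mx_hermite_op_pexp.
rewrite !(Ph_orth_lower (leqnn n)) ?mulmx0 ?subrr //; first exact: coef_mx_lt_eigen.
by apply: coef_mx_lt_conj_op; exact: coef_mx_lt_eigen.
Qed.

Definition exp_quarter : 'M[R]_N := nexp (fun k => (k`!%:R)^-1) ((- 4^-1) *: (A *m A)).

(** For B = -A^2/4 one has B J = J B - 2 B, so moving J to the left of e^B in -2 e^B J costs 4 B e^B
    = -A^2 e^B. This cancels the A^2 of the eigenvalue and explains the factor 1/4. *)
Lemma exp_quarter_eigen n : exp_quarter *m eigen_mx n = - ((J *+ 2 + n%:R%:M *+ 2) *m exp_quarter).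
Proof.
have cS (k : nat) : (k`!%:R)^-1 = (k.+1`!%:R)^-1 *+ k.+1 :> R.
  by rewrite factS natrM invfM -[RHS]mulr_natl mulrA mulfV ?mul1r ?pnatr_eq0.
set B := (- 4^-1) *: (A *m A).
have BN : B ^+ N = 0.
  rewrite /B exprZmx -[A *m A]/(A * A) -expr2 -exprM mulnC exprM AN.
  by rewrite expr2 mul0r scaler0.
have BJ : B *m J = J *m B - 2 *: B.
  rewrite /B -scalemxAl -mulmxA AJ mulmxBr mulmxA AJ mulmxBl -scalemxAr mulmxA.
  by rewrite scalerA [2 * _]mulrC -scalerA -scalerBr scaler_nat mulr2n opprD addrA.
have H := nexp_comm cS BN BJ; rewrite -/exp_quarter in H.
have AA : A *m A = (-4) *: B by rewrite /B scalerA mulrNN mulfV ?scale1r // pnatr_eq0.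
have SB : exp_quarter *m B = B *m exp_quarter by rewrite -nexp_mulC.
rewrite /eigen_mx !mulmxBr !mulmxMr H AA -scalemxAr SB.
rewrite mulmxDl !mulmxMl -scalemx1 -scalemxAl -scalemxAr mulmx1 mul1mx.
move: (B *m exp_quarter) (J *m exp_quarter) (n%:R *: exp_quarter) => u v w.
by apply/matrixP => i j; rewrite !(mxE, mulmxnE); ring.
Qed.

Definition normal_form n : 'M[{poly R}]_N := const_pmx exp_quarter *m (Ph n *m pexp).

(** The diagonal eigenvalue acts on rows and contributes [Jd i], while the shift in the operator
    acts on columns and contributes [Jd j]. *)
Lemma normal_form_ODE n i j : hermite_op (normal_form n i j) + (2 * (n%:R + Jd i - Jd j)) *: normal_form n i j = 0.
Proof.
have H : mx_hermite_op (normal_form n) = - (const_pmx (J *+ 2 + n%:R%:M *+ 2) *m normal_form n).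
  by rewrite /normal_form mx_hermite_op_const mx_hermite_op_Ph [LHS]mulmxA -const_pmxM exp_quarter_eigen const_pmxN mulNmx const_pmxM -mulmxA.
have JQ : (const_pmx (J *+ 2 + n%:R%:M *+ 2) *m normal_form n) i j = (2 * (n%:R + Jd i)) *: normal_form n i j.
  rewrite mxE (bigD1 i) //= big1 ?addr0 => [|k ki].
    rewrite [const_pmx _ _ _]mxE mxE !mulmxnE JE eqxx mxE eqxx mul1r mulr1n -!mul_polyC.
    by congr (_ * _); congr (_%:P); ring.
  rewrite [const_pmx _ _ _]mxE mxE !mulmxnE JE mxE eq_sym (negbTE ki) mul0r mulr0n.
  by rewrite !mul0rn addr0 mul0r.
have /matrixP/(_ i j) := H; rewrite mxE [in RHS]mxE JQ => /eqP.
rewrite -subr_eq0 opprK => /eqP <-; rewrite -!mul_polyC !polyCM !polyCB !polyCD; ring.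
Qed.

End HermiteSystem.

(** * Complex exponential and curves *)

Section ComplexBasics.
Context {R : realType}.
Implicit Types z w : R[i].

Lemma complexP z w : complex.Re z = complex.Re w -> complex.Im z = complex.Im w -> z = w.
Proof. by case: z w => [a b] [c d] /= -> ->. Qed.

Lemma ReM z w : complex.Re (z * w) = complex.Re z * complex.Re w - complex.Im z * complex.Im w.
Proof. by case: z w => [a b] [c d]. Qed.

Lemma ImM z w : complex.Im (z * w) = complex.Re z * complex.Im w + complex.Im z * complex.Re w.
Proof. by case: z w => [a b] [c d]. Qed.

Lemma ReD z w : complex.Re (z + w) = complex.Re z + complex.Re w.
Proof. by case: z w => [a b] [c d]. Qed.

Lemma ImD z w : complex.Im (z + w) = complex.Im z + complex.Im w.
Proof. by case: z w => [a b] [c d]. Qed.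

Lemma ReN z : complex.Re (- z) = - complex.Re z.
Proof. by case: z. Qed.

Lemma ImN z : complex.Im (- z) = - complex.Im z.
Proof. by case: z. Qed.

Lemma normcE z : Normc.normc z = Num.sqrt (complex.Re z ^+ 2 + complex.Im z ^+ 2).
Proof. by case: z. Qed.

Lemma normE z : `|z| = (Normc.normc z)%:C.
Proof. by []. Qed.

Lemma normc_ge0 z : 0 <= Normc.normc z.
Proof. by rewrite normcE sqrtr_ge0. Qed.

Lemma normc_eq0 z : (Normc.normc z == 0) = (z == 0).
Proof.
by apply/eqP/eqP => [/Normc.eq0_normc|->] //; rewrite Normc.normc0.
Qed.

Lemma normRe_le z : `|complex.Re z| <= Normc.normc z.
Proof. by rewrite normcE -sqrtr_sqr ler_wsqrtr // lerDl sqr_ge0. Qed.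

Lemma normIm_le z : `|complex.Im z| <= Normc.normc z.
Proof. by rewrite normcE -sqrtr_sqr ler_wsqrtr // lerDr sqr_ge0. Qed.

Lemma normc_le z : Normc.normc z <= `|complex.Re z| + `|complex.Im z|.
Proof.
rewrite -(ger0_norm (addr_ge0 (normr_ge0 _) (normr_ge0 _))) -sqrtr_sqr normcE.
rewrite ler_wsqrtr // sqrrD !real_normK ?num_real // lerD2r lerDl.
by rewrite mulrn_wge0 // mulr_ge0.
Qed.

Lemma normc_triangle z w : Normc.normc (z + w) <= Normc.normc z + Normc.normc w.
Proof. by have := ler_normD z w; rewrite !normE -rmorphD lecR. Qed.

Lemma normcB z w : Normc.normc (z - w) = Normc.normc (w - z).
Proof. by rewrite -[LHS]normcN opprB. Qed.

Lemma normcR (a : R) : Normc.normc a%:C = `|a|.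
Proof. by rewrite normcE /= expr0n addr0 sqrtr_sqr. Qed.

Lemma cvg_complexP {T : Type} (F : set_system T) (FF : Filter F) (f : T -> R[i]) (l : R[i]) :
  ((f : T -> R[i]^o) @ F --> (l : R[i]^o)) <->
  ((complex.Re (f t) @[t --> F] --> complex.Re l) /\
   (complex.Im (f t) @[t --> F] --> complex.Im l)).
Proof.
split.
- move=> /cvgrPdist_lt fl; split; apply/cvgrPdist_lt => e e0.
    have := fl e%:C; rewrite ltcR => /(_ e0); apply: filterS => t /=.
    rewrite [`|_|]normE ltcR; apply: le_lt_trans.
    by rewrite -ReN -ReD normRe_le.
  have := fl e%:C; rewrite ltcR => /(_ e0); apply: filterS => t /=.
  rewrite [`|_|]normE ltcR; apply: le_lt_trans.
  by rewrite -ImN -ImD normIm_le.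
- case=> /cvgrPdist_lt fr /cvgrPdist_lt fi; apply/cvgrPdist_lt => e.
  (* A positive element of [R[i]] has zero imaginary part, so the tolerance is a positive real. *)
  case: e => e e'; rewrite ltcE /= => /andP[/eqP -> e0].
  have e20 : 0 < e / 2 by rewrite divr_gt0.
  near=> t.
  rewrite [`|_|]normE ltcR (le_lt_trans (normc_le _)) //.
  rewrite ReD ImD ReN ImN (splitr e) ltrD //.
    by near: t; apply: fr.
  by near: t; apply: fi.
Unshelve. all: by end_near. Qed.

Lemma cvg_normcP {T : Type} (F : set_system T) (FF : Filter F) (f : T -> R[i]) (l : R[i]) :
  ((f : T -> R[i]^o) @ F --> (l : R[i]^o)) <->
  (Normc.normc (f t - l) @[t --> F] --> (0 : R)).
Proof.
split.
- move=> /cvgrPdist_lt fl; apply/cvgrPdist_lt => e e0.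
  have := fl e%:C; rewrite ltcR => /(_ e0); apply: filterS => t /=.
  by rewrite sub0r normrN (ger0_norm (normc_ge0 _)) normcB -ltcR.
- move=> /cvgrPdist_lt fl; apply/cvgrPdist_lt => e.
  case: e => e e'; rewrite ltcE /= => /andP[/eqP -> e0].
  have := fl e e0; apply: filterS => t /=.
  by rewrite sub0r normrN (ger0_norm (normc_ge0 _)) normcB -ltcR.
Qed.

Lemma lim_complex {T : Type} (F : set_system T) (FF : ProperFilter F) (f : T -> R[i]) (l : R[i]) :
  ((f : T -> R[i]^o) @ F --> (l : R[i]^o)) -> lim ((f : T -> R[i]^o) @ F) = l.
Proof. by apply: cvg_lim; exact: norm_hausdorff. Qed.

Lemma cexpD z w : cexp (z + w) = cexp z * cexp w.
Proof.
case: z w => [a b] [c d]; rewrite /cexp /= expRD cosD sinD.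
apply: complexP; rewrite !(ReM, ImM) /=; ring.
Qed.

Lemma cexp0 : cexp (0 : R[i]) = 1.
Proof. by rewrite /cexp /= expR0 cos0 sin0 mul1r. Qed.

Lemma normc_cexp z : Normc.normc (cexp z) = expR (complex.Re z).
Proof.
by rewrite /cexp Normc.normcM normcR normcE /= cos2Dsin2 sqrtr1 mulr1 ger0_norm ?expR_ge0.
Qed.

Lemma cexp_neq0 z : cexp z != 0.
Proof. by rewrite -normc_eq0 normc_cexp gt_eqF // expR_gt0. Qed.

Lemma cexpN z : cexp (- z) = (cexp z)^-1.
Proof.
apply: (mulIf (cexp_neq0 z)).
by rewrite mulVf ?cexp_neq0 // -cexpD addNr cexp0.
Qed.

Lemma cexpB z w : cexp (z - w) = cexp z / cexp w.
Proof. by rewrite cexpD cexpN. Qed.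

Lemma cexpMn z n : cexp (z *+ n) = cexp z ^+ n.
Proof.
elim: n => [|n IH]; first by rewrite mulr0n expr0 cexp0.
by rewrite mulrS exprS cexpD IH.
Qed.

Lemma cexpR (a : R) : cexp a%:C = (expR a)%:C.
Proof. by rewrite /cexp /= cos0 sin0 mulr1. Qed.

Definition cderiv (g : R -> R[i]) (t : R) (d : R[i]) : Prop :=
  is_derive t (1 : R) (fun s => complex.Re (g s)) (complex.Re d) /\
  is_derive t (1 : R) (fun s => complex.Im (g s)) (complex.Im d).

Lemma cderiv_eq g t d d' : cderiv g t d -> d = d' -> cderiv g t d'.
Proof. by move=> ? <-. Qed.

Lemma cderiv_ext g g' t d : g =1 g' -> cderiv g t d -> cderiv g' t d.
Proof. by move=> /funext ->. Qed.

Lemma cderivE g t d : cderiv g t d -> cderive g t = d.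
Proof.
move=> [H1 H2]; rewrite /cderive !derive1E.
by apply: complexP => /=; rewrite derive_val.
Qed.

Lemma cderiv_uniq g t d d' : cderiv g t d -> cderiv g t d' -> d = d'.
Proof. by move=> /cderivE <- /cderivE <-. Qed.

Lemma cderiv_cst z t : cderiv (fun=> z) t 0.
Proof. by split => /=; apply: is_derive_cst. Qed.

Lemma cderivD f g t d e : cderiv f t d -> cderiv g t e ->
  cderiv (fun s => f s + g s) t (d + e).
Proof.
move=> [? ?] [? ?]; split.
  by under eq_fun do rewrite ReD; rewrite ReD; apply: is_deriveD.
by under eq_fun do rewrite ImD; rewrite ImD; apply: is_deriveD.
Qed.

Lemma cderivN f t d : cderiv f t d -> cderiv (fun s => - f s) t (- d).
Proof.
move=> [? ?]; split.
  by under eq_fun do rewrite ReN; rewrite ReN; apply: is_deriveN.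
by under eq_fun do rewrite ImN; rewrite ImN; apply: is_deriveN.
Qed.

Lemma cderivB f g t d e : cderiv f t d -> cderiv g t e ->
  cderiv (fun s => f s - g s) t (d - e).
Proof. by move=> ? ?; apply: cderivD => //; apply: cderivN. Qed.

Lemma cderivM f g t d e : cderiv f t d -> cderiv g t e ->
  cderiv (fun s => f s * g s) t (d * g t + f t * e).
Proof.
move=> [H1 H2] [H3 H4]; split.
  under eq_fun do rewrite ReM; rewrite ReD !ReM.
  apply: is_derive_eq; rewrite /GRing.scale /=; ring.
under eq_fun do rewrite ImM; rewrite ImD !ImM.
apply: is_derive_eq; rewrite /GRing.scale /=; ring.
Qed.

Lemma cderivZ c f t d : cderiv f t d -> cderiv (fun s => c * f s) t (c * d).
Proof.
by move=> H; apply: (cderiv_eq (cderivM (cderiv_cst c t) H)); rewrite mul0r add0r.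
Qed.

Lemma cderivX f t d n : cderiv f t d ->
  cderiv (fun s => f s ^+ n) t (n%:R * f t ^+ n.-1 * d).
Proof.
move=> H; elim: n => [|n IH].
  by apply: (cderiv_eq (cderiv_cst _ _)); rewrite !mul0r.
under eq_fun do rewrite exprS.
apply: (cderiv_eq (cderivM H IH)).
case: n {IH} => [|n]; first by rewrite /= !expr0 /=; ring.
by rewrite /= exprS [in RHS]mulrSr; ring.
Qed.

Lemma cderiv_cexp f t d : cderiv f t d ->
  cderiv (fun s => cexp (f s)) t (cexp (f t) * d).
Proof.
move=> [H1 H2].
have H3 : is_derive t (1 : R) (fun s => expR (complex.Re (f s))) (complex.Re d * expR (complex.Re (f t))).
  rewrite mulrC; have := @is_derive1_comp R expR (fun s => complex.Re (f s)) t _ _ (is_derive_expR _) H1; apply.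
have H4 : is_derive t (1 : R) (fun s => cos (complex.Im (f s))) (- sin (complex.Im (f t)) * complex.Im d).
  have := @is_derive1_comp R cos (fun s => complex.Im (f s)) t _ _ (is_derive_cos _) H2; apply.
have H5 : is_derive t (1 : R) (fun s => sin (complex.Im (f s))) (cos (complex.Im (f t)) * complex.Im d).
  have := @is_derive1_comp R sin (fun s => complex.Im (f s)) t _ _ (is_derive_sin _) H2; apply.
split.
  under eq_fun do rewrite /cexp ReM /= mul0r subr0.
  rewrite /cexp !ReM !ImM /=.
  apply: is_derive_eq; rewrite /GRing.scale /=; ring.
under eq_fun do rewrite /cexp ImM /= mul0r addr0.
rewrite /cexp !(ReM, ImM) /=.
apply: is_derive_eq; rewrite /GRing.scale /=; ring.
Qed.

Lemma cderiv_re t : cderiv (fun s : R => s%:C) t 1.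
Proof. by split; [apply: is_derive_id|apply: is_derive_cst]. Qed.

(* Differentiability along every differentiable curve: for maps of the plane this
   encodes holomorphy, and it is closed under composition by construction. *)
Definition hol (f f' : R[i] -> R[i]) : Prop :=
  forall g t d, cderiv g t d -> cderiv (fun s => f (g s)) t (f' (g t) * d).

End ComplexBasics.

(** * Mean value bounds and the exponential series *)

Section ComplexExp.
Context {R : realType}.
Implicit Types z w : R[i].

Lemma is_derive_bound (f df : R -> R) (a b K : R) : a <= b ->
  (forall t, a <= t <= b -> is_derive t (1 : R) f (df t)) ->
  (forall t, a <= t <= b -> `|df t| <= K) -> `|f b - f a| <= K * (b - a).
Proof.
rewrite le_eqVlt => /orP[/eqP -> _ _|ab H1 H2]; first by rewrite !subrr normr0 mulr0.
have [c||c] := @MVT R f df a b ab.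
- by rewrite in_itv /= => /andP[? ?]; apply: H1; rewrite !ltW.
- apply: derivable_within_continuous => t; rewrite in_itv /= => tab.
  by have [] := H1 t tab.
rewrite in_itv /= => /andP[ac cb] ->.
have ba0 : 0 <= b - a by rewrite subr_ge0 ltW.
by rewrite normrM (ger0_norm ba0) ler_wpM2r // H2 // !ltW.
Qed.

(** The mean value theorem is applied to the real and imaginary parts separately, at the price of
    the factor 2. *)
Lemma cderiv_bound (g d : R -> R[i]) (a b K : R) : a <= b ->
  (forall t, a <= t <= b -> cderiv g t (d t)) ->
  (forall t, a <= t <= b -> Normc.normc (d t) <= K) ->
  Normc.normc (g b - g a) <= 2 * K * (b - a).
Proof.
move=> ab H1 H2.
apply: le_trans (normc_le _) _; rewrite ReD ImD ReN ImN -mulrA mulr_natl mulr2n.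
apply: lerD.
- apply: (@is_derive_bound (fun t => complex.Re (g t)) (fun t => complex.Re (d t))) => // t tab.
    by have [] := H1 t tab.
  exact: le_trans (normRe_le _) (H2 t tab).
- apply: (@is_derive_bound (fun t => complex.Im (g t)) (fun t => complex.Im (d t))) => // t tab.
    by have [] := H1 t tab.
  exact: le_trans (normIm_le _) (H2 t tab).
Qed.

Lemma cderiv_const (g : R -> R[i]) : (forall t, cderiv g t 0) -> forall a b, g a = g b.
Proof.
move=> H; wlog ab : / forall a b, a <= b -> g a = g b.
  by apply => a b ab; apply/eqP; rewrite eq_sym -subr_eq0 -normc_eq0 eq_le normc_ge0 andbT;
    apply: le_trans (@cderiv_bound g (fun=> 0) a b 0 ab _ _) _ => //;
    rewrite ?mulr0 ?mul0r // => *; rewrite Normc.normc0.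
by move=> a b; have [|/ltW] := leP a b => /ab.
Qed.

Definition cexp_sum (m : nat) z : R[i] := \sum_(k < m) (k`!%:R)^-1 * z ^+ k.

Lemma cderiv_sum (I : Type) (r : seq I) (f : I -> R -> R[i]) d t :
  (forall i, cderiv (f i) t (d i)) ->
  cderiv (fun s => \sum_(i <- r) f i s) t (\sum_(i <- r) d i).
Proof.
move=> H; elim: r => [|i r IH].
  by under [X in cderiv X]eq_fun do rewrite big_nil; rewrite big_nil; apply: cderiv_cst.
by under [X in cderiv X]eq_fun do rewrite big_cons; rewrite big_cons; apply: cderivD.
Qed.

Lemma natC_neq0 (n : nat) : (n.+1%:R : R[i]) != 0.
Proof. by rewrite pnatr_eq0. Qed.

Lemma cderiv_cexp_sum f t d m : cderiv f t d ->
  cderiv (fun s => cexp_sum m.+1 (f s)) t (cexp_sum m (f t) * d).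
Proof.
move=> H.
pose e (k : 'I_m.+1) := (k`!%:R)^-1 * (k%:R * f t ^+ k.-1 * d).
apply: (@cderiv_eq _ _ _ (\sum_(k < m.+1) e k)).
  by apply: cderiv_sum => k; apply: cderivZ; apply: cderivX.
rewrite big_ord_recl /e /= mul0r mul0r mulr0 add0r /cexp_sum mulr_suml.
apply: eq_bigr => k _; rewrite /bump /= add1n !mulrA; congr (_ * _ * _).
rewrite factS natrM invfM mulrC mulrA mulfV ?mul1r ?natC_neq0 //.
Qed.

(* Along t |-> E_(m+1)(t z) e^(- t z), where E_m is the truncated exponential
   series, the derivative reduces to the single monomial - z (t z)^m e^(- t z) / m!. *)
Lemma cexp_sum_bound m z :
  Normc.normc (cexp_sum m.+1 z * cexp (- z) - 1) <=
  2 * (Normc.normc z * expR (Normc.normc z)) * (Normc.normc z ^+ m / m`!%:R).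
Proof.
pose g (t : R) := cexp_sum m.+1 (t%:C * z) * cexp (- (t%:C * z)).
pose d (t : R) := - (z * ((m`!%:R)^-1 * (t%:C * z) ^+ m) * cexp (- (t%:C * z))).
have lz t : cderiv (fun s : R => s%:C * z) t z.
  have := cderivM (cderiv_re t) (cderiv_cst z t).
  by rewrite mul1r mulr0 addr0.
have Hg t : cderiv g t (d t).
  apply: cderiv_eq (cderivM (cderiv_cexp_sum m (lz t)) (cderiv_cexp (cderivN (lz t)))) _.
  rewrite /d [cexp_sum m.+1 _]/cexp_sum big_ord_recr /= -/(cexp_sum m _); ring.
have -> : cexp_sum m.+1 z * cexp (- z) - 1 = g 1 - g 0.
  rewrite /g !mul1r !mul0r oppr0 cexp0 mulr1; congr (_ - _).
  rewrite /cexp_sum big_ord_recl /= expr0 fact0 invr1 mulr1 big1 ?addr0 // => i _.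
  by rewrite expr0n /= mulr0.
set K := Normc.normc z * expR (Normc.normc z) * (Normc.normc z ^+ m / m`!%:R).
have -> : 2 * (Normc.normc z * expR (Normc.normc z)) * (Normc.normc z ^+ m / m`!%:R) = 2 * K * (1 - 0).
  by rewrite subr0 mulr1 /K -mulrA.
apply: (cderiv_bound (d := d)) => // t /andP[t0 t1].
rewrite /d normcN Normc.normcM normc_cexp !Normc.normcM Normc.normcV.
have -> : Normc.normc (m`!%:R : R[i]) = m`!%:R.
  by rewrite -(rmorph_nat (real_complex R)) normcR normr_nat.
have -> : Normc.normc ((t%:C * z) ^+ m) = Normc.normc (t%:C * z) ^+ m.
  elim: m {g d Hg K} => [|m IH]; first by rewrite !expr0 Normc.normc1.
  by rewrite !exprS Normc.normcM IH.
have ntz : Normc.normc (t%:C * z) <= Normc.normc z.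
  by rewrite Normc.normcM normcR ger0_norm // ler_piMl ?normc_ge0.
rewrite /K mulrAC ler_pM ?mulr_ge0 ?expR_ge0 ?invr_ge0 ?exprn_ge0 ?normc_ge0 //.
  apply: ler_wpM2l; first exact: normc_ge0.
  rewrite ler_expR; apply: le_trans (ler_norm _) _; apply: le_trans (normRe_le _) _.
  by rewrite normcN.
rewrite mulrC ler_wpM2r ?invr_ge0 // lerXn2r // nnegrE normc_ge0 //.
Qed.

Lemma cvg_cexp_sum z : (fun m => cexp_sum m z : R[i]^o) @ \oo --> (cexp z : R[i]^o).
Proof.
apply/cvg_normcP; rewrite -cvg_shiftS /=.
set a := Normc.normc z.
have H : (fun m => expR (complex.Re z) * (2 * (a * expR a)) * (a ^+ m / m`!%:R)) @ \oo --> (0 : R).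
  rewrite -(mulr0 (expR (complex.Re z) * (2 * (a * expR a)))).
  apply: cvgMr; exact: cvg_series_cvg_0 (is_cvg_series_exp_coeff a).
apply: (squeeze_cvgr _ (cvg_cst 0) H).
near=> m; rewrite normc_ge0 /=.
have -> : cexp_sum m.+1 z - cexp z = cexp z * (cexp_sum m.+1 z * cexp (- z) - 1).
  by rewrite mulrBr mulr1 mulrCA -cexpD subrr cexp0 mulr1.
rewrite Normc.normcM normc_cexp -mulrA ler_wpM2l ?expR_ge0 //.
exact: cexp_sum_bound.
Unshelve. all: by end_near. Qed.

Lemma mexp_diag (N : nat) (M : 'M[R[i]]_N) (d : 'I_N -> R[i]) :
  (forall i j, M i j = (i == j)%:R * d i) ->
  forall i j, mexp M i j = (i == j)%:R * cexp (d i).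
Proof.
move=> HM i j; rewrite mxE.
have Mk k : (M ^+ k) i j = (i == j)%:R * d i ^+ k.
  elim: k i j => [|k IH] i j; first by rewrite expr0 mulr1 mxE.
  rewrite exprS mxE (bigD1 i) //= HM eqxx mul1r IH big1 => [|l li].
    by rewrite addr0 exprS; ring.
  by rewrite HM eq_sym (negbTE li) !mul0r.
have -> : (fun m => (\sum_(k < m) (k`!%:R)^-1 *: M ^+ k) i j : R[i]^o) =
    (fun m => (i == j)%:R * cexp_sum m (d i)).
  apply/funext => m; rewrite summxE /cexp_sum mulr_sumr.
  by apply: eq_bigr => k _; rewrite mxE Mk; ring.
apply: lim_complex; apply: cvgMr; exact: cvg_cexp_sum.
Qed.

Lemma mexp_nilp (K : numFieldType) (N : nat) (M : 'M[K]_N) (p : nat) : M ^+ p = 0 ->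
  mexp M = \sum_(k < p) (k`!%:R)^-1 *: M ^+ k.
Proof.
move=> Mp; apply/matrixP => i j; rewrite mxE.
apply: cvg_lim; first exact: norm_hausdorff.
apply: cvg_near_cst; exists p => // m /= pm.
congr (fun_of_matrix _ i j).
rewrite -(subnKC pm) big_split_ord /= [X in _ + X]big1 ?addr0 // => k _.
by rewrite exprD Mp mul0r scaler0.
Qed.

End ComplexExp.

(** * Real integrals and derivatives *)

Section RealHelpers.
Context {R : realType}.
Notation mu := (@lebesgue_measure R).

Lemma is_derive_cont (f : R -> R) (t d : R) : is_derive t (1 : R) f d -> {for t, continuous f}.
Proof. by move=> [H _]; apply/differentiable_continuous/derivable1_diffP. Qed.

Lemma Rintegral_FTC (f F : R -> R) (a b : R) : a <= b ->
  continuous f -> (forall t, is_derive t (1 : R) F (f t)) ->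
  Rintegral mu `[a, b] f = F b - F a.
Proof.
rewrite le_eqVlt => /orP[/eqP -> _ _|ab coef_mx HF].
  by rewrite set_itv1 Rintegral_set1 subrr.
rewrite /Rintegral (@continuous_FTC2 R f F a b ab) //.
- exact: continuous_subspaceT.
- split.
  + by move=> t _; have [] := HF t.
  + by apply: cvg_at_right_filter; exact: is_derive_cont (HF a).
  + by apply: cvg_at_left_filter; exact: is_derive_cont (HF b).
- by move=> t _; rewrite derive1E; apply: derive_val.
Qed.

Lemma is_derive_under (k dk : R -> R -> R) (t B : R) :
  (forall x s, is_derive x (1 : R) (k^~ s) (dk x s)) ->
  (forall x, continuous (k x)) ->
  (forall x s, `|x - t| < 1 -> 0 <= s <= 1 -> `|dk x s| <= B) ->
  is_derive t (1 : R) (fun x => Rintegral mu `[0, 1] (k x)) (Rintegral mu `[0, 1] (dk t)).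
Proof.
move=> Hk ck HB.
have B0 : 0 <= B.
  by apply: le_trans (HB t 0 _ _); rewrite ?subrr ?normr0 ?lexx ?ler01.
have It : `]t - 1, t + 1[%classic t by rewrite /= in_itv /= ltrBlDr ltrDl ltr01.
have I1 x : `]t - 1, t + 1[%classic x -> mu.-integrable `[0, 1] (EFin \o k x).
  move=> _; apply: continuous_compact_integrable; first exact: segment_compact.
  exact: continuous_subspaceT.
have I2 (x s : R) : `]t - 1, t + 1[%classic x -> `[0, 1]%classic s -> derivable (k^~ s) x 1.
  by move=> _ _; have [] := Hk x s.
have I3 : mu.-integrable `[0, 1] (EFin \o (fun=> B)).
  apply: continuous_compact_integrable; first exact: segment_compact.
  by apply: continuous_subspaceT => x; exact: cvg_cst.
have I4 x s : `]t - 1, t + 1[%classic x -> `[0, 1]%classic s -> `|partial1of2 k x s| <= B.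
  rewrite /= !in_itv /= => xt s01; rewrite partial1of2E derive_val; apply: HB => //.
  by rewrite ltr_distl.
have mI : measurable (`[0, 1]%classic : set (measurableTypeR R)) by exact: measurable_itv.
apply: DeriveDef.
  exact: (derivable_under_integral mI It I1 I2 (fun=> B0) I3 I4).
rewrite -derive1E (differentiation_under_integral mI It I1 I2 (fun=> B0) I3 I4).
by apply: eq_Rintegral => s _; rewrite partial1of2E derive_val.
Qed.

(** The difference quotients of r are dominated by those of q. It serves to discard second order
    remainders. *)
Lemma is_derive_squeeze (r q : R -> R) (t : R) : is_derive t (1 : R) q 0 ->
  q t = 0 -> r t = 0 -> (\forall s \near t, `|r s| <= q s) -> is_derive t (1 : R) r 0.
Proof.
move=> Hq qt rt Hrq.
have H : h^-1 *: (r (h + t) - r t) @[h --> (0 : R)^'] --> (0 : R).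
  have Hq' : `|h^-1 *: (q (h + t) - q t)| @[h --> (0 : R)^'] --> (0 : R).
    rewrite -[X in _ --> X](@normr0 _ R); apply: cvg_norm.
    have [qd qv] := Hq.
    have E : (fun h => h^-1 *: (q (h *: 1 + t) - q t)) = (fun h => h^-1 *: (q (h + t) - q t)).
      by apply/funext => h; rewrite [h *: 1]mulr1.
    have : (fun h => h^-1 *: (q (h *: 1 + t) - q t)) @ (0 : R)^' --> 'D_1 q t by exact: qd.
    by rewrite E qv.
  apply: norm_cvg0; apply: (squeeze_cvgr _ (cvg_cst 0) Hq').
  have : \forall h \near (0 : R), `|r (h + t)| <= q (h + t).
    have C : (h + t) @[h --> (0 : R)] --> t.
      by rewrite -[X in _ --> X]add0r; apply: cvgD; [exact: cvg_id|exact: cvg_cst].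
    exact: C _ Hrq.
  move=> /nbhs_dnbhs; apply: filterS => h rh.
  by rewrite normr_ge0 /= /GRing.scale /= !normrM ler_wpM2l // rt qt !subr0 (le_trans rh) // ler_norm.
have E : (fun h => h^-1 *: (r (h *: 1 + t) - r t)) = (fun h => h^-1 *: (r (h + t) - r t)).
  by apply/funext => h; rewrite [h *: 1]mulr1.
apply: DeriveDef; first by rewrite /derivable E; apply: cvgP H.
by rewrite /derive E; apply: cvg_lim.
Qed.

End RealHelpers.

(** * Primitives of entire functions *)

Section Primitive.
Context {R : realType}.
Notation mu := (@lebesgue_measure R).
Implicit Types z w : R[i].

Definition locally_bounded (f : R[i] -> R[i]) := forall M : R, exists B : R,
  forall z, Normc.normc z <= M -> Normc.normc (f z) <= B.

Variables f f' f'' : R[i] -> R[i].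
Hypotheses (Hf : hol f f') (Hf' : hol f' f'') (Bf' : locally_bounded f').

Definition ray_mean (k : R -> R[i]) : R[i] :=
  Rintegral mu `[0, 1] (fun s => complex.Re (k s)) +i*
  Rintegral mu `[0, 1] (fun s => complex.Im (k s)).

(* Star-shaped primitive z * int_0^1 f(s z) ds. *)
Definition prim z := z * ray_mean (fun s => f (s%:C * z)).

Lemma cderiv_line z e t : cderiv (fun s : R => z + s%:C * e) t e.
Proof.
have := cderivD (cderiv_cst z t) (cderivM (cderiv_re t) (cderiv_cst e t)).
by rewrite mul1r mulr0 addr0 add0r.
Qed.

Lemma cderiv_scale e t : cderiv (fun s : R => s%:C * e) t e.
Proof.
by have := cderivM (cderiv_re t) (cderiv_cst e t); rewrite mul1r mulr0 addr0.
Qed.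

Lemma cderiv_ray_mean z e t :
  cderiv (fun x : R => ray_mean (fun s => f (s%:C * (z + x%:C * e)))) t
    (ray_mean (fun s => f' (s%:C * (z + t%:C * e)) * (s%:C * e))).
Proof.
have Hd x s : cderiv (fun x : R => f (s%:C * (z + x%:C * e))) x (f' (s%:C * (z + x%:C * e)) * (s%:C * e)).
  by apply: Hf; apply: cderivZ; apply: cderiv_line.
have Hc x s : cderiv (fun s : R => f (s%:C * (z + x%:C * e))) s (f' (s%:C * (z + x%:C * e)) * (z + x%:C * e)).
  by apply: Hf; apply: cderiv_scale.
(* This disc contains every point s (z + x e) with 0 <= s <= 1 and |x - t| < 1, hence one bound
   dominates the derivatives uniformly in x. *)
have [B HB] := Bf' (Normc.normc z + (`|t| + 1) * Normc.normc e).
have Hb (x s : R) : `|x - t| < 1 -> 0 <= s <= 1 ->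
    Normc.normc (f' (s%:C * (z + x%:C * e)) * (s%:C * e)) <= B * Normc.normc e.
  move=> xt /andP[s0 s1]; rewrite Normc.normcM ler_pM ?normc_ge0 //; last first.
    by rewrite Normc.normcM normcR ger0_norm // ler_piMl ?normc_ge0.
  apply: HB; rewrite Normc.normcM normcR ger0_norm //.
  apply: le_trans (ler_piMl (normc_ge0 _) s1) _.
  apply: le_trans (normc_triangle _ _) _; rewrite lerD2l Normc.normcM normcR.
  rewrite ler_wpM2r ?normc_ge0 // -[x](subrK t) addrC (le_trans (ler_normD _ _)) // lerD2l ltW //.
split => /=.
- apply: (@is_derive_under _ (fun x s => complex.Re (f (s%:C * (z + x%:C * e))))
    (fun x s => complex.Re (f' (s%:C * (z + x%:C * e)) * (s%:C * e))) t (B * Normc.normc e)).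
  + by move=> x s; have [] := Hd x s.
  + by move=> x s; have [/is_derive_cont] := Hc x s.
  + by move=> x s xt s01; apply: le_trans (normRe_le _) (Hb _ _ xt s01).
- apply: (@is_derive_under _ (fun x s => complex.Im (f (s%:C * (z + x%:C * e))))
    (fun x s => complex.Im (f' (s%:C * (z + x%:C * e)) * (s%:C * e))) t (B * Normc.normc e)).
  + by move=> x s; have [] := Hd x s.
  + by move=> x s; have [_ /is_derive_cont] := Hc x s.
  + by move=> x s xt s01; apply: le_trans (normIm_le _) (Hb _ _ xt s01).
Qed.

Definition ccont (k : R -> R[i]) :=
  continuous (fun s => complex.Re (k s)) /\ continuous (fun s => complex.Im (k s)).

Lemma cderiv_ccont (k dk : R -> R[i]) : (forall s, cderiv k s (dk s)) -> ccont k.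
Proof. by move=> H; split => s; have [h1 h2] := H s; [exact: is_derive_cont h1|exact: is_derive_cont h2]. Qed.

Lemma ray_mean_FTC (k K : R -> R[i]) : ccont k -> (forall s, cderiv K s (k s)) ->
  ray_mean k = K 1 - K 0.
Proof.
move=> [c1 c2] H; apply: complexP; rewrite ?ReD ?ImD ?ReN ?ImN /=.
  by apply: (@Rintegral_FTC _ _ (fun s => complex.Re (K s))) => // t; have [] := H t.
by apply: (@Rintegral_FTC _ _ (fun s => complex.Im (K s))) => // t; have [] := H t.
Qed.

Lemma ray_meanD k l : ccont k -> ccont l ->
  ray_mean (fun s => k s + l s) = ray_mean k + ray_mean l.
Proof.
have I (g : R -> R) : continuous g -> mu.-integrable `[0, 1] (EFin \o g).
  move=> cg; apply: continuous_compact_integrable; first exact: segment_compact.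
  exact: continuous_subspaceT.
move=> [k1 k2] [l1 l2]; apply: complexP; rewrite ?ReD ?ImD /ray_mean /=.
  by rewrite -RintegralD; [apply: eq_Rintegral => s _; rewrite ReD|..]; try exact: I.
by rewrite -RintegralD; [apply: eq_Rintegral => s _; rewrite ImD|..]; try exact: I.
Qed.

Lemma ray_meanZ k c : ccont k -> ray_mean (fun s => c * k s) = c * ray_mean k.
Proof.
have I (g : R -> R) : continuous g -> mu.-integrable `[0, 1] (EFin \o g).
  move=> cg; apply: continuous_compact_integrable; first exact: segment_compact.
  exact: continuous_subspaceT.
have cZ (g : R -> R) (a : R) : continuous g -> continuous (fun s => a * g s).
  by move=> cg s; apply: cvgMr; exact: cg.
move=> [k1 k2]; apply: complexP; rewrite ?ReM ?ImM /ray_mean /=.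
  do 2 (rewrite -RintegralZl; try exact: I; try exact: measurable_itv).
  rewrite -RintegralB; try by apply: I; exact: cZ.
    by apply: eq_Rintegral => s _; rewrite ReM.
  exact: measurable_itv.
do 2 (rewrite -RintegralZl; try exact: I; try exact: measurable_itv).
rewrite -RintegralD; try by apply: I; exact: cZ.
  by apply: eq_Rintegral => s _; rewrite ImM.
exact: measurable_itv.
Qed.

(** With w = z + t e, differentiation under the integral gives the integral over [0, 1] of e f(s w)
    + w s e f'(s w), which is e times the derivative of s f(s w) in s. The second derivative of f
    provides the continuity of this integrand. *)
Lemma cderiv_prim_line z e t :
  cderiv (fun x : R => prim (z + x%:C * e)) t (f (z + t%:C * e) * e).
Proof.
apply: cderiv_eq (cderivM (cderiv_line z e t) (cderiv_ray_mean z e t)) _.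
set w := z + t%:C * e.
have Hs s : cderiv (fun s : R => f (s%:C * w)) s (f' (s%:C * w) * w).
  by apply: Hf; apply: cderiv_scale.
have Hs' s : cderiv (fun s : R => f' (s%:C * w)) s (f'' (s%:C * w) * w).
  by apply: Hf'; apply: cderiv_scale.
have c1 := cderiv_ccont Hs.
have c2 : ccont (fun s => f' (s%:C * w) * (s%:C * e)).
  by apply: cderiv_ccont => s; apply: cderivM (Hs' s) (cderiv_scale e s).
rewrite -!ray_meanZ // -ray_meanD; last 2 first.
- by apply: cderiv_ccont => s; apply: cderivZ (Hs s).
- by apply: cderiv_ccont => s; apply: cderivZ; apply: cderivM (Hs' s) (cderiv_scale e s).
rewrite (@ray_mean_FTC _ (fun s : R => e * (s%:C * f (s%:C * w)))).
- by rewrite !mul0r mulr0 subr0 !mul1r mulrC.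
- by apply: cderiv_ccont => s; apply: cderivD; [apply: cderivZ (Hs s)|
    apply: cderivZ; apply: cderivM (Hs' s) (cderiv_scale e s)].
- move=> s; apply: cderiv_eq (cderivZ e (cderivM (cderiv_re s) (Hs s))) _; ring.
Qed.

Lemma normc_segment z w (M t : R) : Normc.normc z <= M -> Normc.normc w <= M -> 0 <= t <= 1 ->
  Normc.normc (z + t%:C * (w - z)) <= M.
Proof.
move=> zM wM /andP[t0 t1].
have -> : z + t%:C * (w - z) = (1 - t)%:C * z + t%:C * w.
  by rewrite rmorphB rmorph1; ring.
apply: le_trans (normc_triangle _ _) _; rewrite !Normc.normcM !normcR !ger0_norm ?subr_ge0 //.
have -> : M = (1 - t) * M + t * M by ring.
by apply: lerD; apply: ler_wpM2l; rewrite ?subr_ge0.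
Qed.

(** Differentiability along straight lines is upgraded to a second order expansion uniform on discs;
    the constant collects one factor 2 from each of two mean value bounds along the segment from z
    to w. *)
Lemma prim_taylor M : exists K : R, forall z w, Normc.normc z <= M -> Normc.normc w <= M ->
  Normc.normc (prim w - prim z - f z * (w - z)) <= K * Normc.normc (w - z) ^+ 2.
Proof.
have [B HB] := Bf' M.
exists (2 * (2 * B)) => z w zM wM; set e := w - z.
have seg (t : R) : 0 <= t <= 1 -> Normc.normc (z + t%:C * e) <= M.
  exact: normc_segment.
have lip (t : R) : 0 <= t <= 1 -> Normc.normc (f (z + t%:C * e) - f z) <= 2 * (B * Normc.normc e).
  move=> /andP[t0 t1].
  have := @cderiv_bound R (fun s => f (z + s%:C * e)) (fun s => f' (z + s%:C * e) * e) 0 t (B * Normc.normc e) t0.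
  rewrite mul0r addr0 subr0 => H.
  apply: le_trans (H _ _) _.
  - by move=> s _; apply: Hf; apply: cderiv_line.
  - move=> s /andP[s0 st]; rewrite Normc.normcM ler_wpM2r ?normc_ge0 // HB // seg //.
    by rewrite s0 (le_trans st).
  - rewrite ler_piMr // mulr_ge0 // mulr_ge0 ?normc_ge0 //.
    by apply: le_trans (normc_ge0 (f' z)) (HB z zM).
pose g (s : R) := prim (z + s%:C * e) - s%:C * (f z * e).
have := @cderiv_bound R g (fun s => f (z + s%:C * e) * e - f z * e) 0 1 (2 * (B * Normc.normc e) * Normc.normc e) ler01.
have -> : g 1 - g 0 = prim w - prim z - f z * e.
  rewrite /g !mul1r !mul0r addr0 subr0 /e (addrC z) subrK; ring.
rewrite subr0 mulr1 => H; apply: le_trans (H _ _) _.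
- by move=> s _; apply: cderivB; [exact: cderiv_prim_line|exact: cderiv_scale].
- by move=> s s01; rewrite -mulrBl Normc.normcM ler_wpM2r ?normc_ge0 // lip.
- by rewrite expr2 !mulrA.
Qed.

(** Along any differentiable curve the remainder of [prim_taylor] is bounded by a multiple of |g s -
    g t|^2, whose derivative at t is zero. *)
Lemma hol_prim : hol prim f.
Proof.
move=> g t d [H1 H2].
have [K HK] := prim_taylor (Normc.normc (g t) + 2).
have near1 : \forall s \near t, Normc.normc (g s) <= Normc.normc (g t) + 2.
  have c1 := is_derive_cont H1; have c2 := is_derive_cont H2.
  near=> s.
  rewrite -[g s](subrK (g t)) addrC; apply: le_trans (normc_triangle _ _) _; rewrite lerD2l.
  apply: le_trans (normc_le _) _; rewrite ReD ReN ImD ImN.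
  have -> : 2 = 1 + 1 :> R by ring.
  apply: lerD; rewrite distrC; near: s.
    by move/cvgrPdist_le : c1; apply.
  by move/cvgrPdist_le : c2; apply.
pose r s := prim (g s) - prim (g t) - f (g t) * (g s - g t).
pose q s := K * ((complex.Re (g s) - complex.Re (g t)) ^+ 2 + (complex.Im (g s) - complex.Im (g t)) ^+ 2).
have Hq : is_derive t (1 : R) q 0.
  by rewrite /q; apply: is_derive_eq; rewrite !subrr /GRing.scale /=; ring.
have q0 : q t = 0 by rewrite /q !subrr; ring.
have r0 : r t = 0 by rewrite /r !subrr; ring.
have rq : \forall s \near t, Normc.normc (r s) <= q s.
  apply: filterS near1 => s Hs.
  apply: le_trans (HK _ _ _ Hs) _; first by rewrite lerDl.
  by rewrite normcE sqr_sqrtr ?addr_ge0 ?sqr_ge0 // !ReD !ImD !ReN !ImN.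
have Hr : cderiv r t 0.
  split => /=; (apply: (is_derive_squeeze Hq q0); first by rewrite r0);
    apply: filterS rq => s; apply: le_trans; [exact: normRe_le|exact: normIm_le].
have H : cderiv (fun s => r s + (prim (g t) - f (g t) * g t + f (g t) * g s)) t (f (g t) * d).
  apply: cderiv_eq (cderivD Hr (cderivD (cderiv_cst _ _) (cderivZ (f (g t)) (conj H1 H2)))) _.
  by rewrite !add0r.
apply: cderiv_ext H => s; rewrite /r; ring.
Unshelve. all: by end_near. Qed.

End Primitive.

(** * Integrals along piecewise smooth contours *)

Section PiecewiseFTC.
Context {R : realType}.
Notation mu := (@lebesgue_measure R).

(** Replacing the values of k at the two endpoints by its one-sided limits gives a function
    continuous on the closed interval, with the same integral. *)
Lemma FTC_limits (k psi : R -> R) (a b : R) : a < b -> continuous psi ->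
  (forall t, a < t < b -> is_derive t (1 : R) psi (k t) /\ {for t, continuous k}) ->
  cvg (k x @[x --> a^'+]) -> cvg (k x @[x --> b^'-]) ->
  mu.-integrable `[a, b] (EFin \o k) /\ Rintegral mu `[a, b] k = psi b - psi a.
Proof.
move=> ab cpsi H ca cb.
set la := lim (k x @[x --> a^'+]); set lb := lim (k x @[x --> b^'-]).
pose h t := if t == a then la else if t == b then lb else k t.
have hk : {in `]a, b[, k =1 h}.
  by move=> t; rewrite in_itv /= => /andP[ta tb]; rewrite /h (gt_eqF ta) (lt_eqF tb).
have near_oo t : a < t < b -> \forall s \near t, s \in `]a, b[.
  by move=> tab; near=> s; rewrite in_itv /=; apply/andP; split; near: s;
    [apply: lt_nbhsr|apply: lt_nbhsl]; case/andP: tab.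
have ch : {within `[a, b], continuous h}.
  apply/(continuous_within_itvP _ ab); split.
  - move=> t; rewrite in_itv /= => tab.
    have [_ kt] := H t tab.
    rewrite /continuous_at -hk ?in_itv //.
    apply: cvg_trans kt; apply: near_eq_cvg.
    by apply: filterS (near_oo t tab) => s sab; rewrite hk.
  - rewrite /h eqxx; apply: cvg_trans ca; apply: near_eq_cvg; near=> s.
    by rewrite [RHS]/= -/(h s) -hk // in_itv /=; apply/andP; split; near: s;
      [exact: nbhs_right_gt|exact: nbhs_right_lt].
  - rewrite /h (gt_eqF ab) eqxx; apply: cvg_trans cb; apply: near_eq_cvg; near=> s.
    by rewrite [RHS]/= -/(h s) -hk // in_itv /=; apply/andP; split; near: s;
      [exact: nbhs_left_gt|exact: nbhs_left_lt].
have ih : mu.-integrable `[a, b] (EFin \o h).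
  by apply: continuous_compact_integrable => //; exact: segment_compact.
have mk : measurable_fun `]a, b[ k.
  apply: open_continuous_measurable_fun; first exact: interval_open.
  by move=> t; rewrite inE /= in_itv /= => /H [].
have mh : measurable_fun `]a, b[ h.
  apply: measurable_funS (_ : `]a, b[ `<=` `[a, b]) _ => //; first exact: subset_itv_oo_cc.
  by apply/measurable_EFinP; have /integrableP[] := ih.
have E : (\int[mu]_(x in `[a, b]) (k x)%:E = \int[mu]_(x in `[a, b]) (h x)%:E)%E.
  exact: (@eq_integral_itv_bounded R a b h k true false).
split; last first.
  rewrite /Rintegral E (@continuous_FTC2 R h psi a b ab ch) //.
  - split.
    + by move=> t; rewrite in_itv /= => /H [[]].
    + by apply: cvg_at_right_filter; exact: cpsi.
    + by apply: cvg_at_left_filter; exact: cpsi.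
  - by move=> t tab; rewrite derive1E -hk //; move: tab; rewrite in_itv /= => /H [Ht _]; apply: derive_val.
apply/integrableP; split.
  apply/measurable_EFinP.
  by apply/measurable_fun_itv_bndo_bndcP/measurable_fun_itv_obnd_cbndP.
rewrite (_ : (\int[mu]_(x in `[a, b]) `|(EFin \o k) x| = \int[mu]_(x in `[a, b]) `|(EFin \o h) x|)%E).
  by have /integrableP[] := ih.
apply: (@eq_integral_itv_bounded R a b (fun x => `|h x|) (fun x => `|k x|) true false).
- by apply: measurableT_comp.
- by apply: measurableT_comp.
- by move=> t /hk ->.
Unshelve. all: by end_near. Qed.

(** Induction on the number of breaks strictly inside the interval, which is split at one of them.
    Integrability is carried along because additivity over the two pieces requires it. *)
Lemma piecewise_FTC (k psi : R -> R) (breaks : seq R) : continuous psi ->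
  (forall t, t \notin breaks -> is_derive t (1 : R) psi (k t) /\ {for t, continuous k}) ->
  (forall t, cvg (k x @[x --> t^'-]) /\ cvg (k x @[x --> t^'+])) ->
  forall a b, a <= b ->
  mu.-integrable `[a, b] (EFin \o k) /\ Rintegral mu `[a, b] k = psi b - psi a.
Proof.
move=> cpsi H Hlr a b; rewrite le_eqVlt => /orP[/eqP <-|].
  split; last by rewrite set_itv1 Rintegral_set1 subrr.
  rewrite set_itv1; apply: (@eq_integrable _ _ _ _ _ _ (EFin \o cst (k a))) => //.
    by move=> t; rewrite inE => ->.
  apply: continuous_compact_integrable; first exact: compact_set1.
  by apply: continuous_subspaceT => x; exact: cvg_cst.
have [n] := ubnP (count (fun c => (a < c) && (c < b)) breaks).
elim: n a b => // n IH a b nab ab.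
have [/hasP[c cin /andP[ac cb]]|nobreak] := boolP (has (fun c => (a < c) && (c < b)) breaks); last first.
  apply: FTC_limits => //; [|by have [] := Hlr a|by have [] := Hlr b].
  move=> t tab; apply: H; apply: contra nobreak => tin.
  by apply/hasP; exists t.
(* The break c is counted for ]a, b[ but for neither of the two halves, so both counts decrease
   strictly. *)
have sub1 : (count (fun d => (a < d)%R && (d < c)%R) breaks < n)%N.
  move: nab; rewrite ltnS; apply: leq_trans.
  rewrite -(cat_take_drop (index c breaks) breaks) !count_cat.
  have ci : (index c breaks < size breaks)%N by rewrite index_mem.
  rewrite (drop_nth 0 ci) /= nth_index // ltxx andbF ac cb /= add0n -addnS leq_add //.
    by apply: sub_count => x /andP[-> xc] /=; rewrite (lt_trans xc).
  by rewrite add1n ltnS; apply: sub_count => x /andP[-> xc] /=; rewrite (lt_trans xc).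
have sub2 : (count (fun d => (c < d)%R && (d < b)%R) breaks < n)%N.
  move: nab; rewrite ltnS; apply: leq_trans.
  rewrite -(cat_take_drop (index c breaks) breaks) !count_cat.
  have ci : (index c breaks < size breaks)%N by rewrite index_mem.
  rewrite (drop_nth 0 ci) /= nth_index // ltxx ac cb /= add0n -addnS leq_add //.
    by apply: sub_count => x /andP[cx ->]; rewrite andbT (lt_trans ac).
  by rewrite add1n ltnS; apply: sub_count => x /andP[cx ->]; rewrite andbT (lt_trans ac).
have [i1 e1] := IH a c sub1 ac.
have [i2 e2] := IH c b sub2 cb.
have U : `[a, b]%classic = `[a, c]%classic `|` `]c, b]%classic.
  by rewrite -itv_bndbnd_setU // bnd_simp ltW.
have i3 : mu.-integrable `]c, b] (EFin \o k).
  by apply: integrableS i2 => //; exact: subset_itv_oc_cc.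
have i4 : mu.-integrable (`[a, c]%classic `|` `]c, b]%classic) (EFin \o k).
  have [m1 f1] := integrableP _ _ _ i1; have [m3 f3] := integrableP _ _ _ i3.
  have mU : measurable_fun (`[a, c]%classic `|` `]c, b]%classic) (EFin \o k).
    by apply/measurable_funU => //; split.
  apply/integrableP; split => //.
  rewrite ge0_integral_setU //=; first exact: lte_add_pinfty.
  - apply/measurable_EFinP; apply: measurableT_comp => //.
    by apply/measurable_EFinP.
  - apply/disj_setPS => y [/=]; rewrite 2!in_itv/= => /andP[_ yx] /andP[].
    by rewrite ltNge yx.
split; first by rewrite U.
rewrite U Rintegral_setU //.
  by rewrite e1 Rintegral_itv_obnd_cbnd // e2; ring.
apply/disj_setPS => y [/=]; rewrite 2!in_itv/= => /andP[_ yx] /andP[].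
by rewrite ltNge yx.
Qed.

(** The primitive is a function of the parameter and not of the point, because around the origin it
    is only available through log z. *)
Lemma arc_int_FTC (g : R -> R[i]) (f : R[i] -> R[i]) (Psi : R -> R[i]) (a b : R) :
  a <= b -> piecewise_C1 g -> ccont (fun t => f (g t)) -> ccont Psi ->
  (forall t d, cderiv g t d -> cderiv Psi t (f (g t) * d)) ->
  arc_int g f a b = Psi b - Psi a.
Proof.
move=> ab [_ [breaks Hg]] [cf1 cf2] [cp1 cp2] HPsi.
pose d := cderive g.
have Hd t : t \notin breaks -> [/\ cderiv g t (d t), {for t, continuous (fun s => complex.Re (d s))} &
    {for t, continuous (fun s => complex.Im (d s))}].
  have [H _ _] := Hg t; move=> /H [[d1 d2] c].
  have [c1 c2] := (cvg_complexP (nbhs_filter t) (cderive g) (cderive g t)).1 c.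
  split; [|exact: c1|exact: c2].
  have e1 : complex.Re (d t) = 'D_1 (fun s => complex.Re (g s)) t by rewrite -derive1E.
  have e2 : complex.Im (d t) = 'D_1 (fun s => complex.Im (g s)) t by rewrite -derive1E.
  by split; [exact: (DeriveDef d1 (esym e1))|exact: (DeriveDef d2 (esym e2))].
have Hl t : [/\ cvg (complex.Re (d x) @[x --> t^'-]), cvg (complex.Im (d x) @[x --> t^'-]),
    cvg (complex.Re (d x) @[x --> t^'+]) & cvg (complex.Im (d x) @[x --> t^'+])].
  have [_ /cvg_ex[l1 cl1] /cvg_ex[l2 cl2]] := Hg t.
  have [l1r l1i] := (cvg_complexP (at_left_proper_filter t) (cderive g) l1).1 cl1.
  have [l2r l2i] := (cvg_complexP (at_right_proper_filter t) (cderive g) l2).1 cl2.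
  by split; [exact: cvgP l1r|exact: cvgP l1i|exact: cvgP l2r|exact: cvgP l2i].
apply: complexP; rewrite /arc_int ?ReD ?ImD ?ReN ?ImN /=.
- have [] := @piecewise_FTC (fun t => complex.Re (f (g t) * cderive g t)) (fun t => complex.Re (Psi t)) breaks
    cp1 _ _ a b ab => //.
  + move=> t /Hd [Ht c1 c2]; split; first by have [] := HPsi _ _ Ht.
    rewrite (funext (fun s => ReM (f (g s)) (cderive g s))).
    by apply: cvgB; apply: cvgM => //; [exact: cf1|exact: cf2].
  + move=> t; have [l1 l2 l3 l4] := Hl t.
    have e1 := cvg_at_left_filter (cf1 t); have e2 := cvg_at_left_filter (cf2 t).
    have e3 := cvg_at_right_filter (cf1 t); have e4 := cvg_at_right_filter (cf2 t).
    rewrite (funext (fun s => ReM (f (g s)) (cderive g s))).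
    by split; [have := cvgP _ (cvgB (cvgM e1 l1) (cvgM e2 l2))|have := cvgP _ (cvgB (cvgM e3 l3) (cvgM e4 l4))]; apply.
- have [] := @piecewise_FTC (fun t => complex.Im (f (g t) * cderive g t)) (fun t => complex.Im (Psi t)) breaks
    cp2 _ _ a b ab => //.
  + move=> t /Hd [Ht c1 c2]; split; first by have [] := HPsi _ _ Ht.
    rewrite (funext (fun s => ImM (f (g s)) (cderive g s))).
    by apply: cvgD; apply: cvgM => //; [exact: cf1|exact: cf2].
  + move=> t; have [l1 l2 l3 l4] := Hl t.
    have e1 := cvg_at_left_filter (cf1 t); have e2 := cvg_at_left_filter (cf2 t).
    have e3 := cvg_at_right_filter (cf1 t); have e4 := cvg_at_right_filter (cf2 t).
    rewrite (funext (fun s => ImM (f (g s)) (cderive g s))).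
    by split; [have := cvgP _ (cvgD (cvgM e1 l2) (cvgM e2 l1))|have := cvgP _ (cvgD (cvgM e3 l4) (cvgM e4 l3))]; apply.
Qed.

End PiecewiseFTC.

(** * Logarithm on the slit plane *)

Section Slog.
Context {R : realType}.
Implicit Types z w : R[i].

(** The plane cut along ]-oo, 0], described by positivity of the denominator of the half-angle
    formula. *)
Definition slit z := 0 < Normc.normc z + complex.Re z.

Lemma sqr_normc z : Normc.normc z ^+ 2 = complex.Re z ^+ 2 + complex.Im z ^+ 2.
Proof. by rewrite normcE sqr_sqrtr // addr_ge0 ?sqr_ge0. Qed.

Lemma slitP z : ~ (complex.Im z = 0 /\ complex.Re z <= 0) -> slit z.
Proof.
move=> H; rewrite /slit lt_neqAle; apply/andP; split; last first.
  by rewrite -lerBlDr sub0r (le_trans _ (normRe_le z)) // -normrN ler_norm.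
apply/eqP => E; apply: H.
have rx : Normc.normc z = - complex.Re z by apply/eqP; rewrite -addr_eq0 -E.
split; last by rewrite -oppr_ge0 -rx normc_ge0.
have := sqr_normc z; rewrite rx sqrrN => /eqP; rewrite -subr_eq0 opprD addNKr oppr_eq0.
by rewrite sqrf_eq0 => /eqP.
Qed.

Lemma slit_gt0 z : slit z -> 0 < Normc.normc z.
Proof.
rewrite /slit => H; rewrite lt_neqAle normc_ge0 andbT eq_sym normc_eq0.
by apply: contraTneq H => ->; rewrite Normc.normc0 /= addr0 ltxx.
Qed.

Lemma slit_neq0 z : slit z -> z != 0.
Proof. by move=> /slit_gt0; rewrite lt_neqAle eq_sym normc_eq0 => /andP[]. Qed.

Lemma slit_Re z : 0 < complex.Re z -> slit z.
Proof. by move=> H; rewrite /slit ltr_wpDl ?normc_ge0. Qed.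

Definition half_arg z : R := atan (complex.Im z / (Normc.normc z + complex.Re z)).

(* By the half-angle formula arg z = 2 atan (Im z / (|z| + Re z)); unlike the
   case split on acos defining carg, this is visibly smooth off the cut. *)
Definition slog z : R[i] := ln (Normc.normc z) +i* (half_arg z *+ 2).

(** With r = |z|, x = Re z and u the tangent of the half angle, u^2 = (r - x) / (r + x), so the
    squared cosine is (r + x) / (2 r); the double-angle formulas finish. *)
Lemma cos_sin_half_arg z : slit z ->
  Normc.normc z * cos (half_arg z *+ 2) = complex.Re z /\
  Normc.normc z * sin (half_arg z *+ 2) = complex.Im z.
Proof.
move=> Hs; have r0 := slit_gt0 Hs.
have E := sqr_normc z.
move: Hs r0 E; rewrite /half_arg /slit; move: (Normc.normc z) (complex.Re z) (complex.Im z) => r x y s0 r0 E.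
set u := y / (r + x).
have s0' : r + x != 0 by rewrite gt_eqF.
have r0' : r != 0 by rewrite gt_eqF.
have yE : y ^+ 2 = (r - x) * (r + x) by rewrite -[y ^+ 2](addKr (x ^+ 2)) -E; ring.
have uE : 1 + u ^+ 2 = 2 * r / (r + x).
  by rewrite /u expr_div_n yE; field.
have cE : cos (atan u) ^+ 2 = (r + x) / (2 * r).
  rewrite cos_atan exprVn sqr_sqrtr ?addr_ge0 ?sqr_ge0 // uE invf_div //.
have c0 : cos (atan u) != 0.
  by rewrite -sqrf_eq0 cE gt_eqF // divr_gt0 // mulr_gt0.
have sE : sin (atan u) = u * cos (atan u) by rewrite -{2}(atanK u) /tan divfK.
rewrite cos_mulr2n sin_mulr2n sE.
have -> : cos (atan u) * (u * cos (atan u)) = u * cos (atan u) ^+ 2 by ring.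
by rewrite cE /u; split; rewrite mulr2n; field; rewrite ?s0' ?r0'.
Qed.

Lemma cexp_slog z : slit z -> cexp (slog z) = z.
Proof.
move=> Hs; have [H1 H2] := cos_sin_half_arg Hs.
rewrite /cexp /slog /= lnK ?posrE ?slit_gt0 //.
by apply: complexP; rewrite ?ReM ?ImM /= mul0r ?subr0 ?addr0.
Qed.

(** The doubled arctangent lies in ]-pi, pi[ and has the sign of Im z, so [acos] recovers it up to
    exactly the sign chosen in [carg]. *)
Lemma clog_slog z : slit z -> clog z = slog z.
Proof.
move=> Hs; have [H1 _] := cos_sin_half_arg Hs; have r0 := slit_gt0 Hs.
apply: complexP => //=; rewrite /carg.
have -> : complex.Re z / Normc.normc z = cos (half_arg z *+ 2).
  by rewrite -{1}H1 mulrAC mulfV ?mul1r // gt_eqF.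
have := atan_gtNpi2 (complex.Im z / (Normc.normc z + complex.Re z)).
have := atan_ltpi2 (complex.Im z / (Normc.normc z + complex.Re z)).
rewrite -/(half_arg z) => h1 h2.
case: ifPn => Im0.
  have h3 : 0 <= half_arg z.
    by rewrite -(atan0 R) le_atan // divr_ge0 // ltW.
  rewrite cosK // in_itv /= mulrn_wge0 //= mulr2n; lra.
have h3 : half_arg z <= 0.
  rewrite -(atan0 R) le_atan //; apply: mulr_le0_ge0.
    by rewrite ltW // ltNge.
  by rewrite invr_ge0 ltW.
rewrite cosKN ?opprK // mulr2n; apply/andP; split; lra.
Qed.

(** Only the existence of a derivative is checked on the formula; its value follows from
    differentiating [cexp (slog (g s)) = g s]. *)
Lemma cderiv_slog (g : R -> R[i]) t d : (forall s, slit (g s)) -> cderiv g t d ->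
  cderiv (fun s => slog (g s)) t (d / g t).
Proof.
move=> Hs [H1 H2].
pose q s := complex.Re (g s) ^+ 2 + complex.Im (g s) ^+ 2.
have q0 s : 0 < q s by rewrite /q -sqr_normc exprn_gt0 // slit_gt0.
(* Half the logarithm of the squared modulus is differentiable without differentiating a square
   root; the modulus is then recovered as an exponential. *)
have lnE s : ln (Normc.normc (g s)) = 2^-1 * ln (q s).
  by have ns := slit_gt0 (Hs s); rewrite /q -sqr_normc lnXn // [ln _ *+ 2]mulr2n; lra.
have rE s : Normc.normc (g s) = expR (2^-1 * ln (q s)).
  by rewrite -lnE lnK // posrE slit_gt0.
suff [d' Hd'] : exists d', cderiv (fun s => slog (g s)) t d'.
  have := cderiv_cexp Hd'; rewrite (_ : (fun s => cexp _) = g); last first.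
    by apply/funext => s; rewrite cexp_slog.
  rewrite cexp_slog // => /cderiv_uniq /(_ (conj H1 H2)) E.
  by apply: (cderiv_eq Hd'); rewrite -E mulrAC mulfV ?mul1r // slit_neq0.
have Hq : is_derive t (1 : R) q (2 * (complex.Re (g t) * complex.Re d + complex.Im (g t) * complex.Im d)).
  by rewrite /q; apply: is_derive_eq; rewrite /GRing.scale /=; ring.
have Hl : derivable (fun s => 2^-1 * ln (q s)) t 1.
  have H := @is_derive1_comp R (@ln R) q t _ _ (is_derive1_ln (q0 t)) Hq.
  by have [] := is_deriveZ (2^-1 : R) H.
have Hr : derivable (fun s => Normc.normc (g s)) t 1.
  rewrite (funext rE).
  by have := @is_derive1_comp R expR (fun s => 2^-1 * ln (q s)) t _ _ (is_derive_expR _) (derivableP Hl); case.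
have Hu : derivable (fun s => complex.Im (g s) / (Normc.normc (g s) + complex.Re (g s))) t 1.
  apply: derivableM; first by case: H2.
  apply: derivableV; first by rewrite gt_eqF //; exact: Hs.
  by apply: derivableD; [exact: Hr|case: H1].
have Ha : derivable (fun s => half_arg (g s) *+ 2) t 1.
  have H := @is_derive1_comp R (@atan R) _ t _ _ (is_derive1_atan _) (derivableP Hu).
  rewrite (funext (fun s => esym (mulr_natl (half_arg (g s)) 2))).
  by have [] := is_deriveZ (2 : R) H.
exists ('D_1 (fun s => ln (Normc.normc (g s))) t +i* 'D_1 (fun s => half_arg (g s) *+ 2) t).
split; apply/derivableP; last exact: Ha.
rewrite [X in derivable X](_ : _ = (fun s => 2^-1 * ln (q s))); first exact: Hl.
exact: (funext lnE).
Qed.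

End Slog.

(** * Entire functions with bounds on discs *)

Section Smooth.
Context {R : realType}.
Implicit Types f g : R[i] -> R[i].

(** Two derivatives and bounds on discs are what the primitive and continuity along curves require,
    in a form stable under sums, products and the exponential. *)
Definition smooth f := exists f' f'' : R[i] -> R[i], [/\ hol f f', hol f' f'', locally_bounded f & locally_bounded f'].

Lemma locally_boundedD f g : locally_bounded f -> locally_bounded g -> locally_bounded (fun z => f z + g z).
Proof.
move=> Hf Hg M; have [B HB] := Hf M; have [C HC] := Hg M; exists (B + C) => z zM.
by apply: le_trans (normc_triangle _ _) _; rewrite lerD ?HB ?HC.
Qed.

Lemma locally_boundedM f g : locally_bounded f -> locally_bounded g -> locally_bounded (fun z => f z * g z).
Proof.
move=> Hf Hg M; have [B HB] := Hf M; have [C HC] := Hg M; exists (B * C) => z zM.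
by rewrite Normc.normcM ler_pM ?normc_ge0 ?HB ?HC.
Qed.

Lemma locally_bounded_cst (c : R[i]) : locally_bounded (fun=> c).
Proof. by move=> M; exists (Normc.normc c). Qed.

Lemma locally_bounded_cexp f : locally_bounded f -> locally_bounded (fun z => cexp (f z)).
Proof.
move=> Hf M; have [B HB] := Hf M; exists (expR B) => z zM.
rewrite normc_cexp ler_expR; apply: le_trans (ler_norm _) _.
exact: le_trans (normRe_le _) (HB z zM).
Qed.

Lemma smooth_cst (c : R[i]) : smooth (fun=> c).
Proof.
exists (fun=> 0), (fun=> 0); split; try exact: locally_bounded_cst.
  by move=> g t d _; apply: (cderiv_eq (cderiv_cst _ _)); rewrite mul0r.
by move=> g t d _; apply: (cderiv_eq (cderiv_cst _ _)); rewrite mul0r.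
Qed.

Lemma smooth_id : smooth (fun z => z).
Proof.
exists (fun=> 1), (fun=> 0); split; try exact: locally_bounded_cst.
- by move=> g t d H; apply: (cderiv_eq H); rewrite mul1r.
- by move=> g t d _; apply: (cderiv_eq (cderiv_cst _ _)); rewrite mul0r.
- by move=> M; exists M.
Qed.

Lemma smoothD f g : smooth f -> smooth g -> smooth (fun z => f z + g z).
Proof.
move=> [f1 [f2 [Hf1 Hf2 bf bf1]]] [g1 [g2 [Hg1 Hg2 bg bg1]]].
exists (fun z => f1 z + g1 z), (fun z => f2 z + g2 z); split; try exact: locally_boundedD.
  by move=> h t d H; apply: (cderiv_eq (cderivD (Hf1 _ _ _ H) (Hg1 _ _ _ H))); rewrite mulrDl.
by move=> h t d H; apply: (cderiv_eq (cderivD (Hf2 _ _ _ H) (Hg2 _ _ _ H))); rewrite mulrDl.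
Qed.

Lemma smoothM f g : smooth f -> smooth g -> smooth (fun z => f z * g z).
Proof.
move=> [f1 [f2 [Hf1 Hf2 bf bf1]]] [g1 [g2 [Hg1 Hg2 bg bg1]]].
exists (fun z => f1 z * g z + f z * g1 z),
  (fun z => (f2 z * g z + f1 z * g1 z) + (f1 z * g1 z + f z * g2 z)); split.
- move=> h t d H; apply: (cderiv_eq (cderivM (Hf1 _ _ _ H) (Hg1 _ _ _ H))); ring.
- move=> h t d H; apply: (cderiv_eq (cderivD (cderivM (Hf2 _ _ _ H) (Hg1 _ _ _ H))
    (cderivM (Hf1 _ _ _ H) (Hg2 _ _ _ H)))); ring.
- exact: locally_boundedM.
- by apply: locally_boundedD; apply: locally_boundedM.
Qed.

Lemma smooth_cexp f : smooth f -> smooth (fun z => cexp (f z)).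
Proof.
move=> [f1 [f2 [Hf1 Hf2 bf bf1]]].
exists (fun z => cexp (f z) * f1 z), (fun z => cexp (f z) * f1 z * f1 z + cexp (f z) * f2 z); split.
- move=> h t d H; apply: (cderiv_eq (cderiv_cexp (Hf1 _ _ _ H))); ring.
- move=> h t d H; apply: (cderiv_eq (cderivM (cderiv_cexp (Hf1 _ _ _ H)) (Hf2 _ _ _ H))); ring.
- exact: locally_bounded_cexp.
- by apply: locally_boundedM => //; apply: locally_bounded_cexp.
Qed.

Lemma smoothX f n : smooth f -> smooth (fun z => f z ^+ n).
Proof.
move=> Hf; elim: n => [|n IH]; first exact: smooth_cst.
by rewrite (funext (fun z => exprS (f z) n)); apply: smoothM.
Qed.

Lemma smooth_prim f : smooth f -> hol (prim f) f.
Proof. by move=> [f1 [f2 [H1 H2 _ b1]]]; apply: hol_prim H1 H2 b1. Qed.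

Lemma hol_lipschitz f f' : hol f f' -> locally_bounded f' -> forall M, exists B : R, forall z w,
  Normc.normc z <= M -> Normc.normc w <= M -> Normc.normc (f w - f z) <= B * Normc.normc (w - z).
Proof.
move=> Hf bf M; have [B HB] := bf M; exists (2 * B) => z w zM wM; set e := w - z.
have seg (t : R) : 0 <= t <= 1 -> Normc.normc (z + t%:C * e) <= M.
  exact: normc_segment.
have := @cderiv_bound R (fun s => f (z + s%:C * e)) (fun s => f' (z + s%:C * e) * e) 0 1 (B * Normc.normc e) ler01.
have -> : z + 1%:C * e = w by rewrite mul1r /e addrC subrK.
rewrite mul0r addr0 subr0 mulr1 mulrA; apply.
  by move=> t _; apply: Hf; apply: cderiv_line.
by move=> t t01; rewrite Normc.normcM ler_wpM2r ?normc_ge0 // HB // seg.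
Qed.

Lemma ccontP (g : R -> R[i]) : ccont g <-> continuous (g : R -> R[i]^o).
Proof.
split; first by move=> [h1 h2] t; apply/(cvg_complexP (nbhs_filter t)); split; [exact: h1|exact: h2].
by move=> h; split => t; have [h1 h2] := (cvg_complexP (nbhs_filter t) g (g t)).1 (h t).
Qed.

(** [hol] speaks of differentiable curves only; for a merely continuous curve the Lipschitz bound on
    discs takes over. *)
Lemma hol_ccont f f' (g : R -> R[i]) : hol f f' -> locally_bounded f' -> ccont g -> ccont (fun t => f (g t)).
Proof.
move=> Hf bf /ccontP cg; apply/ccontP => t; apply/(cvg_normcP (nbhs_filter t)).
have /(cvg_normcP (nbhs_filter t)) ct := cg t.
have [B HB] := hol_lipschitz Hf bf (Normc.normc (g t) + 1).
have cB : B * Normc.normc (g s - g t) @[s --> t] --> (0 : R).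
  by rewrite -[X in _ --> X](mulr0 B); apply: cvgMr.
have near1 : \forall s \near t, Normc.normc (g s) <= Normc.normc (g t) + 1.
  have : \forall s \near t, Normc.normc (g s - g t) < 1.
    by apply: (cvgr_lt _ ct); exact: ltr01.
  apply: filterS => s gs; rewrite -[g s](subrK (g t)) addrC.
  by apply: le_trans (normc_triangle _ _) _; rewrite lerD2l ltW.
apply: (squeeze_cvgr _ (cvg_cst 0) cB).
apply: filterS near1 => s gs; rewrite normc_ge0 /=; apply: HB => //.
by rewrite lerDl.
Qed.

End Smooth.

(** * The contour around the origin *)

Section Hankel.
Context {R : realType}.
Implicit Types z w : R[i].
Variable x : R.

Definition gexp z : R[i] := - z ^+ 2 + 2%:R * z * x%:C.

(* The integrand of the first contour integral pulled back by z = e^zeta: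
   e^(- z^2 + 2 x z) z^(- k) dz becomes phi k zeta dzeta, with phi k entire. *)
Definition phi (k : nat) z : R[i] := cexp (gexp (cexp z) + (1 - k%:R) * z).

Lemma smooth_gexp : smooth gexp.
Proof.
have H : smooth (fun z : R[i] => -1 * z ^+ 2 + 2%:R * z * x%:C).
  by apply: smoothD; apply: smoothM; [exact: smooth_cst|apply: smoothX; exact: smooth_id|
    apply: smoothM; [exact: smooth_cst|exact: smooth_id]|exact: smooth_cst].
by rewrite (_ : gexp = fun z : R[i] => -1 * z ^+ 2 + 2%:R * z * x%:C) //;
  apply/funext => z; rewrite /gexp mulN1r.
Qed.

Lemma smooth_comp_cexp f : @smooth R f -> smooth (fun z => f (cexp z)).
Proof.
move=> [f1 [f2 [H1 H2 b b1]]].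
have bc (h : R[i] -> R[i]) : locally_bounded h -> locally_bounded (fun z => h (cexp z)).
  move=> bh M; have [C HC] := locally_bounded_cexp (fun M => ex_intro _ M (fun z (h : Normc.normc z <= M) => h)) M.
  have [B HB] := bh C; exists B => z /HC; exact: HB.
have be : locally_bounded (@cexp R) by apply: (@locally_bounded_cexp R id) => M; exists M.
exists (fun z => f1 (cexp z) * cexp z), (fun z => f2 (cexp z) * cexp z * cexp z + f1 (cexp z) * cexp z); split.
- move=> g t d H; apply: (cderiv_eq (H1 _ _ _ (cderiv_cexp H))); ring.
- move=> g t d H; apply: (cderiv_eq (cderivM (H2 _ _ _ (cderiv_cexp H)) (cderiv_cexp H))); ring.
- exact: bc.
- by apply: locally_boundedM => //; exact: bc.
Qed.

Lemma smooth_phi k : smooth (phi k).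
Proof.
apply: smooth_cexp; apply: smoothD; first exact: smooth_comp_cexp smooth_gexp.
by apply: smoothM; [exact: smooth_cst|exact: smooth_id].
Qed.

Definition phi_prim k := prim (phi k).

Lemma hol_phi_prim k : hol (phi_prim k) (phi k).
Proof. exact: smooth_prim (smooth_phi k). Qed.

Lemma cderiv_horizontal (a t : R) : cderiv (fun s : R => s +i* a) t 1.
Proof. by split => /=; [exact: is_derive_id|exact: is_derive_cst]. Qed.

Lemma cderiv_vertical (a t : R) : cderiv (fun s : R => a +i* s) t 'i.
Proof. by split => /=; [exact: is_derive_cst|exact: is_derive_id]. Qed.

(** The exponent 2 (|x| + 1)^2 is the maximum over r of 2 (|x| + 1) r - r^2 / 2. *)
Definition phi_cst : R := expR (2 * (`|x| + 1) ^+ 2).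

Lemma normc_phi k (a t : R) : Normc.normc (phi k (a +i* t)) =
  expR (- expR a ^+ 2 * (1 - 2 * sin t ^+ 2) + 2 * x * (expR a * cos t) + (1 - k%:R) * a).
Proof.
rewrite /phi normc_cexp /gexp; congr expR.
have -> : (1 - k%:R : R[i]) = (1 - k%:R)%:C by rewrite rmorphB rmorph_nat.
have -> : (2%:R : R[i]) = (2%:R : R)%:C by rewrite rmorph_nat.
have -> : cexp (a +i* t) = (expR a * cos t) +i* (expR a * sin t) :> R[i].
  by apply: complexP; rewrite /cexp !(ReM, ImM) /= mul0r ?subr0 ?addr0.
transitivity (- expR a ^+ 2 * (cos t ^+ 2 - sin t ^+ 2) + 2 * x * (expR a * cos t) + (1 - k%:R) * a).
  rewrite expr2 !(ReD, ReN, ReM) /=; ring.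
rewrite cos2sin2; ring.
Qed.

(** For |sin t| <= 1/2 the real part of z^2 is at least r^2 / 2, where r = |z| = e^a. Of the linear
    term 2 (|x| + 1) r, the part 2 r absorbs (1 - k) a and the requested decay e^(-a), since a <=
    r. *)
Lemma phi_bound k (a t : R) : 0 <= a -> `|sin t| <= 2^-1 ->
  Normc.normc (phi k (a +i* t)) <= phi_cst * expR (- a).
Proof.
move=> a0 st; rewrite normc_phi /phi_cst -expRD ler_expR.
set r := expR a.
have ar : a <= r by apply: le_trans (expR_ge1Dx a); rewrite lerDr.
have r0 : 0 <= r by apply: le_trans ar.
have s4 : sin t ^+ 2 <= 4^-1.
  have -> : 4^-1 = (2^-1) ^+ 2 :> R by field.
  by rewrite -[sin t ^+ 2]real_normK ?num_real // lerXn2r ?nnegrE.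
have h1 : r ^+ 2 * 2^-1 <= r ^+ 2 * (1 - 2 * sin t ^+ 2).
  by rewrite ler_wpM2l ?sqr_ge0 //; lra.
have h2 : 2 * x * (r * cos t) <= 2 * `|x| * r.
  apply: le_trans (ler_norm _) _; rewrite !normrM (ger0_norm r0) (@ger0_norm _ 2) //.
  by rewrite mulrA ler_piMr ?cos_max // !mulr_ge0.
have h3 : (1 - k%:R) * a <= a.
  by rewrite mulrBl mul1r gerBl mulr_ge0.
have h4 : 0 <= (r - 2 * (`|x| + 1)) ^+ 2 by exact: sqr_ge0.
rewrite mulNr.
have h5 : r ^+ 2 * 2^-1 = (r - 2 * (`|x| + 1)) ^+ 2 * 2^-1 + 2 * (`|x| + 1) * r - 2 * (`|x| + 1) ^+ 2.
  by field.
have h6 : 2 * (`|x| + 1) * r = 2 * `|x| * r + 2 * r by ring.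
lra.
Qed.

(** Both q + f and q - f are nondecreasing. *)
Lemma is_derive_dominated (f df q dq : R -> R) (a b : R) : a <= b ->
  (forall t, a <= t <= b -> is_derive t (1 : R) f (df t)) ->
  (forall t, a <= t <= b -> is_derive t (1 : R) q (dq t)) ->
  (forall t, a <= t <= b -> `|df t| <= dq t) -> `|f b - f a| <= q b - q a.
Proof.
move=> ab Hf Hq H.
have mono (h dh : R -> R) : (forall t, a <= t <= b -> is_derive t (1 : R) h (dh t)) ->
    (forall t, a <= t <= b -> 0 <= dh t) -> h a <= h b.
  move=> Hh dh0; move: ab; rewrite le_eqVlt => /orP[/eqP <- //|ltab].
  have [c||c] := @MVT R h dh a b ltab.
  - by rewrite in_itv /= => /andP[? ?]; apply: Hh; rewrite !ltW.
  - apply: derivable_within_continuous => t; rewrite in_itv /= => tab.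
    by have [] := Hh t tab.
  have ba0 : 0 <= b - a by rewrite subr_ge0 ltW.
  by rewrite in_itv /= => /andP[ac cb] E; rewrite -subr_ge0 E mulr_ge0 // dh0 // !ltW.
have h1 : f a + q a <= f b + q b.
  apply: (mono (fun t => f t + q t) (fun t => df t + dq t)) => t tab.
    by apply: is_deriveD; [exact: Hf|exact: Hq].
  by have := H t tab; rewrite ler_norml => /andP[]; lra.
have h2 : q a - f a <= q b - f b.
  apply: (mono (fun t => q t - f t) (fun t => dq t - df t)) => t tab.
    by apply: is_deriveB; [exact: Hq|exact: Hf].
  by have := H t tab; rewrite ler_norml => /andP[]; lra.
by rewrite ler_norml; apply/andP; split; lra.
Qed.

Lemma phi_prim_horizontal k (a b t : R) : 0 <= a -> a <= b -> `|sin t| <= 2^-1 ->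
  Normc.normc (phi_prim k (b +i* t) - phi_prim k (a +i* t)) <= 2 * phi_cst * expR (- a).
Proof.
move=> a0 ab st.
pose q (s : R) := - (phi_cst * expR (- s)).
have Hq s : is_derive s (1 : R) q (phi_cst * expR (- s)).
  rewrite /q; apply: is_derive_eq; rewrite /GRing.scale /=; ring.
have HP s : cderiv (fun s : R => phi_prim k (s +i* t)) s (phi k (s +i* t) * 1).
  by apply: hol_phi_prim; exact: cderiv_horizontal.
have B s : a <= s <= b -> Normc.normc (phi k (s +i* t) * 1) <= phi_cst * expR (- s).
  by move=> /andP[as_ _]; rewrite mulr1 phi_bound // (le_trans a0).
have qE : q b - q a <= phi_cst * expR (- a).
  by rewrite /q opprK gerDr oppr_le0 mulr_ge0 ?expR_ge0.
apply: le_trans (normc_le _) _; rewrite ReD ImD ReN ImN -mulrA mulr_natl mulr2n.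
apply: lerD; apply: le_trans qE.
- apply: (@is_derive_dominated (fun s => complex.Re (phi_prim k (s +i* t))) (fun s => complex.Re (phi k (s +i* t) * 1)) q
    (fun s => phi_cst * expR (- s))) => // s sab; first by have [] := HP s.
  exact: le_trans (normRe_le _) (B s sab).
- apply: (@is_derive_dominated (fun s => complex.Im (phi_prim k (s +i* t))) (fun s => complex.Im (phi k (s +i* t) * 1)) q
    (fun s => phi_cst * expR (- s))) => // s sab; first by have [] := HP s.
  exact: le_trans (normIm_le _) (B s sab).
Qed.

Lemma sin_dist (s t : R) : `|sin s - sin t| <= `|s - t|.
Proof.
wlog ts : s t / t <= s.
  by move=> H; have [/H//|/ltW/H] := leP t s; rewrite distrC [`|t - s|]distrC.
have := @is_derive_bound R sin cos t s 1 ts (fun u _ => is_derive_sin u) (fun u _ => cos_max u).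
by rewrite mul1r (ger0_norm (_ : 0 <= s - t)) ?subr_ge0.
Qed.

(** Within 1/2 of a zero of sin one has |sin| <= 1/2, so [phi_bound] holds on the whole segment; its
    length at most 1/2 absorbs the factor 2 of the mean value bound. *)
Lemma phi_prim_vertical k (a s t : R) : 0 <= a -> sin s = 0 -> `|t - s| <= 2^-1 ->
  Normc.normc (phi_prim k (a +i* t) - phi_prim k (a +i* s)) <= phi_cst * expR (- a).
Proof.
move=> a0 s0 ts.
have HP u : cderiv (fun u : R => phi_prim k (a +i* u)) u (phi k (a +i* u) * 'i).
  by apply: hol_phi_prim; exact: cderiv_vertical.
have B u : `|u - s| <= 2^-1 -> Normc.normc (phi k (a +i* u) * 'i) <= phi_cst * expR (- a).
  move=> us; rewrite Normc.normcM.
  have -> : Normc.normc ('i : R[i]) = 1 by rewrite normcE /= expr0n add0r expr1n sqrtr1.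
  rewrite mulr1 phi_bound // -[sin u]subr0 -s0.
  exact: le_trans (sin_dist _ _) us.
have K0 : 0 <= phi_cst * expR (- a) by rewrite mulr_ge0 ?expR_ge0.
have [st|/ltW st] := leP s t.
  have := @cderiv_bound R _ _ s t (phi_cst * expR (- a)) st (fun u _ => HP u).
  move=> H; apply: le_trans (H _) _.
    move=> u /andP[su ut]; apply: B; rewrite ger0_norm ?subr_ge0 //.
    by move: ts; rewrite ger0_norm ?subr_ge0 //; lra.
  by move: ts; rewrite ger0_norm ?subr_ge0 // => ts; nra.
rewrite normcB.
have := @cderiv_bound R _ _ t s (phi_cst * expR (- a)) st (fun u _ => HP u).
move=> H; apply: le_trans (H _) _.
  move=> u /andP[su ut]; apply: B; rewrite distrC ger0_norm ?subr_ge0 //.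
  by move: ts; rewrite distrC ger0_norm ?subr_ge0 //; lra.
by move: ts; rewrite distrC ger0_norm ?subr_ge0 // => ts; nra.
Qed.

Lemma phi_periodic k (a : R) : phi k (a +i* pi) = phi k (a +i* (- pi)).
Proof.
have E : cexp (a +i* pi) = cexp (a +i* (- pi)) :> R[i].
  by rewrite /cexp /= cosN sinN sinpi oppr0.
rewrite /phi !cexpD E; congr (_ * _).
rewrite !mulrBl !mul1r !cexpB E; congr (_ / _).
by rewrite !mulr_natl !cexpMn E.
Qed.

(* The integral of phi k over a vertical segment of length 2 pi; by periodicity of
   phi k it does not depend on the abscissa, and it is the value of the integral
   along every Hankel contour. *)
Definition period k : R[i] := phi_prim k (0 +i* pi) - phi_prim k (0 +i* (- pi)).

Lemma periodE k (a : R) : phi_prim k (a +i* pi) - phi_prim k (a +i* (- pi)) = period k.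
Proof.
apply: (@cderiv_const R (fun a => phi_prim k (a +i* pi) - phi_prim k (a +i* (- pi)))) => t.
have := cderivB (hol_phi_prim k (cderiv_horizontal pi t)) (hol_phi_prim k (cderiv_horizontal (- pi) t)).
by rewrite phi_periodic subrr.
Qed.

(** The increment from a +i* s to b +i* t is split along a broken line through a -i pi, a + i pi and
    b + i pi. The second piece is exactly the period; the other three are short vertical moves or a
    horizontal one, all in the region of decay. *)
Lemma period_dist k (a b s t : R) : 0 <= a -> 0 <= b -> `|s + pi| <= 2^-1 -> `|t - pi| <= 2^-1 ->
  Normc.normc (phi_prim k (b +i* t) - phi_prim k (a +i* s) - period k) <= 3 * phi_cst * (expR (- a) + expR (- b)).
Proof.
move=> a0 b0 sp tp.
have sp0 : `|sin (pi : R)| <= 2^-1 by rewrite sinpi normr0.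
rewrite -(periodE k a).
have -> : phi_prim k (b +i* t) - phi_prim k (a +i* s) - (phi_prim k (a +i* pi) - phi_prim k (a +i* (- pi))) =
  (phi_prim k (b +i* t) - phi_prim k (b +i* pi)) + ((phi_prim k (b +i* pi) - phi_prim k (a +i* pi)) -
   (phi_prim k (a +i* s) - phi_prim k (a +i* (- pi)))).
  move: (phi_prim k (b +i* t)) (phi_prim k (a +i* s)) (phi_prim k (b +i* pi)) (phi_prim k (a +i* pi)).
  by move: (phi_prim k (a +i* (- pi))) => u1 u2 u3 u4 u5; ring.
have h1 := @phi_prim_vertical k b pi t b0 (sinpi R) tp.
have h2 : Normc.normc (phi_prim k (a +i* s) - phi_prim k (a +i* (- pi))) <= phi_cst * expR (- a).
  by apply: phi_prim_vertical; rewrite ?sinN ?sinpi ?oppr0 ?opprK.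
have h3 : Normc.normc (phi_prim k (b +i* pi) - phi_prim k (a +i* pi)) <= 2 * phi_cst * (expR (- a) + expR (- b)).
  have K0 : 0 <= 2 * phi_cst by rewrite mulr_ge0 ?expR_ge0.
  have [ab|/ltW ba] := leP a b.
    apply: le_trans (phi_prim_horizontal k a0 ab sp0) _.
    by rewrite ler_wpM2l // lerDl expR_ge0.
  rewrite normcB; apply: le_trans (phi_prim_horizontal k b0 ba sp0) _.
  by rewrite ler_wpM2l // lerDr expR_ge0.
apply: le_trans (normc_triangle _ _) _.
apply: le_trans (lerD h1 (normc_triangle _ _)) _; rewrite normcN.
apply: le_trans (lerD (lexx _) (lerD h3 h2)) _; move: h1 h2 h3 => _ _ _.
by move: phi_cst (expR (- a)) (expR (- b)) => K u v; lra.
Qed.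

Lemma ccontZ (c : R[i]) (g : R -> R[i]) : ccont g -> ccont (fun s => c * g s).
Proof. by move=> /ccontP cg; apply/ccontP => t; apply: cvgMr; exact: cg. Qed.

Lemma slog_ccont (g : R -> R[i]) : (forall s, slit (g s)) -> ccont g -> ccont (fun s => slog (g s)).
Proof.
move=> sl [c1 c2].
have cn : continuous (fun s => Normc.normc (g s)).
  move=> s; rewrite (funext (fun s => normcE (g s))).
  apply: continuous_cvg; first exact: sqrt_continuous.
  by apply: cvgD; rewrite /= !expr2; apply: cvgM; [exact: c1|exact: c1|exact: c2|exact: c2].
split => s /=.
  by apply: continuous_cvg; [apply: continuous_ln; exact: slit_gt0|exact: cn].
have ch : half_arg (g s') @[s' --> s] --> half_arg (g s).
  apply: continuous_cvg; first exact: continuous_atan.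
  apply: cvgM; first exact: c2.
  by apply: cvgV; [rewrite gt_eqF //; exact: sl|apply: cvgD; [exact: cn|exact: c1]].
by rewrite (funext (fun s => mulr2n (half_arg (g s)))); apply: cvgD.
Qed.

Lemma hankel_limit (gamma : R -> R[i]) k c : hankel_contour gamma ->
  (fun ab : R * R => arc_int gamma (fun z => c * (phi k (clog z) / z)) ab.1 ab.2 : R[i]^o) @
    filter_prod (ninfty_nbhs R) (pinfty_nbhs R) --> (c * period k : R[i]^o).
Proof.
move=> [pc1 off nL nR [aL aR]].
have sl t : slit (gamma t) by apply: slitP; exact: off.
have cg : ccont gamma by have [/ccontP] := pc1.
have bphi : locally_bounded (phi k) by have [? [? []]] := smooth_phi k.
have cs := slog_ccont sl cg.
have arcE (a b : R) : a <= b -> arc_int gamma (fun z => c * (phi k (clog z) / z)) a b =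
    c * (phi_prim k (slog (gamma b)) - phi_prim k (slog (gamma a))).
  move=> ab; rewrite mulrBr.
  apply: (@arc_int_FTC R gamma _ (fun t => c * phi_prim k (slog (gamma t)))) => //.
  (* Writing 1/z as e^(-log z) makes the integrand an entire function of [slog (gamma t)], hence
     continuous in t. *)
  - have E : (fun t => c * (phi k (clog (gamma t)) / gamma t)) =
        (fun t => (fun z => c * (phi k z * cexp (-1 * z))) (slog (gamma t))).
      by apply/funext => t; rewrite clog_slog // mulN1r cexpN cexp_slog.
    rewrite E.
    have [h1 [h2 [H1 _ _ b1]]] : smooth (fun z : R[i] => c * (phi k z * cexp (-1 * z))).
      apply: smoothM; first exact: smooth_cst.
      apply: smoothM; first exact: smooth_phi.
      by apply: smooth_cexp; apply: smoothM; [exact: smooth_cst|exact: smooth_id].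
    exact: hol_ccont H1 b1 cs.
  - by apply: ccontZ; exact: hol_ccont (hol_phi_prim k) bphi cs.
  - move=> t d /(cderiv_slog sl) H.
    apply: (cderiv_eq (cderivZ c (hol_phi_prim k H))); rewrite clog_slog //.
    by move: (phi k _) (gamma t)^-1 => u v; ring.
have FF : ProperFilter (filter_prod (ninfty_nbhs R) (pinfty_nbhs R)) by exact: _.
have cinv (F : set_system R) (PF : ProperFilter F) : Normc.normc (gamma t) @[t --> F] --> +oo ->
    expR (- ln (Normc.normc (gamma t))) @[t --> F] --> (0 : R).
  move=> Hn; rewrite (_ : (fun t => expR _) = (fun t => (Normc.normc (gamma t))^-1)).
    by apply/gtr0_cvgV0 => //; apply: nearW => t; exact: slit_gt0.
  by apply/funext => t; rewrite expRN lnK // posrE slit_gt0.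
pose Psi (ab : R * R) : R[i]^o := phi_prim k (slog (gamma ab.2)) - phi_prim k (slog (gamma ab.1)).
suff HPsi : Psi @ filter_prod (ninfty_nbhs R) (pinfty_nbhs R) --> (period k : R[i]^o).
  apply: cvg_trans (@cvgMr _ _ _ _ _ c _ HPsi); apply: near_eq_cvg.
  have nL0 : \forall a \near -oo, a <= (0 : R) by exact: nbhs_ninfty_le.
  have nR0 : \forall a \near +oo, (0 : R) <= a by exact: nbhs_pinfty_ge.
  near=> ab; rewrite arcE //; apply: (@le_trans _ _ 0).
    by near: ab; exact: cvg_fst nL0.
  by near: ab; exact: cvg_snd nR0.
apply/cvg_normcP.
have H : (3 * phi_cst * (expR (- ln (Normc.normc (gamma ab.1))) + expR (- ln (Normc.normc (gamma ab.2)))))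
    @[ab --> filter_prod (ninfty_nbhs R) (pinfty_nbhs R)] --> (0 : R).
  rewrite -[X in _ --> X](mulr0 (3 * phi_cst)); apply: cvgMr.
  rewrite -[X in _ --> X](addr0 0); apply: cvgD.
    exact: cvg_comp cvg_fst (cinv _ _ nL).
  exact: cvg_comp cvg_snd (cinv _ _ nR).
apply: (squeeze_cvgr _ (cvg_cst 0) H).
(* Eventually |gamma| >= 1, which makes the abscissa ln |gamma| nonnegative, and the argument is
   within 1/2 of -pi, as [period_dist] requires; symmetrically at the other end. *)
have nearL : \forall a \near -oo, [/\ a <= 0, 1 <= Normc.normc (gamma a) & `|carg (gamma a) + pi| <= 2^-1].
  near=> a; split; near: a.
  - exact: nbhs_ninfty_le.
  - by move/cvgryPge : nL; apply.
  - move/cvgrPdist_le : aL => /(_ (2^-1)); rewrite invr_gt0 ltr0n => /(_ isT).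
    by apply: filterS => a; rewrite distrC opprK.
have nearR : \forall a \near +oo, [/\ 0 <= a, 1 <= Normc.normc (gamma a) & `|carg (gamma a) - pi| <= 2^-1].
  near=> a; split; near: a.
  - exact: nbhs_pinfty_ge.
  - by move/cvgryPge : nR; apply.
  - move/cvgrPdist_le : aR => /(_ (2^-1)); rewrite invr_gt0 ltr0n => /(_ isT).
    by apply: filterS => a; rewrite distrC.
have slE t : slog (gamma t) = ln (Normc.normc (gamma t)) +i* carg (gamma t).
  by rewrite -clog_slog.
near=> ab.
have [a0 a1 a2] : [/\ ab.1 <= 0, 1 <= Normc.normc (gamma ab.1) & `|carg (gamma ab.1) + pi| <= 2^-1].
  by near: ab; exact: cvg_fst nearL.
have [b0 b1 b2] : [/\ 0 <= ab.2, 1 <= Normc.normc (gamma ab.2) & `|carg (gamma ab.2) - pi| <= 2^-1].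
  by near: ab; exact: cvg_snd nearR.
rewrite normc_ge0 /= /Psi !slE period_dist // ln_ge0 //.
Unshelve. all: by end_near. Qed.

End Hankel.

(** * Values of the periods *)

Section PeriodValue.
Context {R : realType}.
Implicit Types z w : R[i].
Variable x : R.
Notation P k := (phi_prim x k).

Lemma hol_gexp : hol (gexp x) (fun z => -2 * z + 2 * x%:C).
Proof.
move=> g t d H; rewrite /gexp.
apply: (cderiv_eq (cderivD (cderivN (cderivX 2 H)) (cderivM (cderivZ 2 H) (cderiv_cst x%:C t)))).
by rewrite /= expr1; ring.
Qed.

Lemma phi_shift k z : phi x k.+1 z * cexp z = phi x k z.
Proof.
by rewrite /phi -cexpD -addrA; congr (cexp (_ + _)); rewrite -[in LHS]natr1; ring.
Qed.

(** The derivative of [phi x k.+2] is -2 phi_k + 2 x phi_(k+1) - (k+1) phi_(k+2), and its integral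
    over a period vanishes by periodicity. *)
Lemma period_rec k : k.+1%:R * period x k.+2 = 2 * x%:C * period x k.+1 - 2 * period x k.
Proof.
pose D (t : R) := - 2 * P k (0 +i* t) + 2 * x%:C * P k.+1 (0 +i* t)
  - k.+1%:R * P k.+2 (0 +i* t) - phi x k.+2 (0 +i* t).
have HD t : cderiv D t 0.
  have Hv := cderiv_vertical (0 : R) t.
  have H := cderivB (cderivB (cderivD (cderivZ (- 2) (hol_phi_prim x k Hv))
    (cderivZ (2 * x%:C) (hol_phi_prim x k.+1 Hv))) (cderivZ k.+1%:R (hol_phi_prim x k.+2 Hv)))
    (cderiv_cexp (cderivD (hol_gexp (cderiv_cexp Hv)) (cderivZ (1 - k.+2%:R) Hv))).
  apply: (cderiv_eq H).
  rewrite -/(phi x k.+2 (0 +i* t)) -[phi x k _]phi_shift -[phi x k.+1 _]phi_shift.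
  rewrite -[k.+2%:R]natr1; ring.
have := cderiv_const HD pi (- pi); rewrite /D phi_periodic => /(congr1 (fun u => u + phi x k.+2 (0 +i* (- pi)))).
rewrite 2!subrK /period.
move: (P k (0 +i* pi)) (P k (0 +i* (- pi))) (P k.+1 (0 +i* pi)) (P k.+1 (0 +i* (- pi)))
  (P k.+2 (0 +i* pi)) (P k.+2 (0 +i* (- pi))) x%:C k.+1%:R => a a' b b' c c' y m E.
have -> : m * (c - c') = 2 * y * (b - b') - 2 * (a - a') +
    ((- 2 * a' + 2 * y * b' - m * c') - (- 2 * a + 2 * y * b - m * c)) by ring.
by rewrite E subrr addr0.
Qed.

(** The abscissa a is free: if phi is within e of c on that vertical line, the period is close to 2
    pi i c. *)
Lemma normc_period_le k (a e : R) (c : R[i]) :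
  (forall t, Normc.normc (phi x k (a +i* t) - c) <= e) ->
  Normc.normc (period x k - c * ((0 : R) +i* (pi *+ 2))) <= 2 * e * (pi *+ 2).
Proof.
move=> H.
have HP t : cderiv (fun t : R => P k (a +i* t) - c * (0 +i* t)) t ((phi x k (a +i* t) - c) * 'i%C).
  rewrite mulrBl; apply: cderivB; first by apply: hol_phi_prim; exact: cderiv_vertical.
  by apply: cderivZ; exact: cderiv_vertical.
have pp : - pi <= (pi : R) by have := pi_ge0 R; lra.
have := @cderiv_bound R _ _ (- pi) pi e pp (fun t _ => HP t).
rewrite opprK -mulr2n => Hb.
have -> : period x k - c * (0 +i* (pi *+ 2)) =
   P k (a +i* pi) - c * (0 +i* pi) - (P k (a +i* (- pi)) - c * (0 +i* (- pi))).
  rewrite -(periodE x k a).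
  have -> : (0 +i* (pi *+ 2) : R[i]) = (0 +i* pi) - (0 +i* (- pi)).
    by apply: complexP => /=; rewrite ?subr0 ?opprK ?oppr0 ?addr0 ?mulr2n.
  by move: (P k _) (P k _) (0 +i* pi) (0 +i* (- pi)) => u v w y; ring.
apply: Hb => t _; rewrite Normc.normcM.
have -> : Normc.normc ('i%C : R[i]) = 1 by rewrite normcE /= expr0n add0r expr1n sqrtr1.
by rewrite mulr1.
Qed.

Lemma normc_small (z : R[i]) (C : R) : (forall r, 0 < r <= 1 -> Normc.normc z <= C * r) -> z = 0.
Proof.
move=> H; apply/eqP; rewrite -normc_eq0; apply/negPn/negP => n0.
have np : 0 < Normc.normc z by rewrite lt_neqAle eq_sym n0 normc_ge0.
have C0 : 0 < C by have := H 1; rewrite ltr01 lexx mulr1 => /(_ isT); apply: lt_le_trans.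
(* For this r one has C r < |z|, which contradicts the assumed bound. *)
pose r := Normc.normc z / (C + Normc.normc z).
have d0 : 0 < C + Normc.normc z by rewrite addr_gt0.
have := H r; rewrite divr_gt0 // ler_pdivrMr // mul1r lerDr ltW // => /(_ isT).
rewrite /r mulrA ler_pdivlMr // mulrDr mulrC gerDl leNgt.
by rewrite mulr_gt0.
Qed.

Lemma normc_gexp_le (z : R[i]) : Normc.normc z <= 1 -> Normc.normc (gexp x z) <= (1 + 2 * `|x|) * Normc.normc z.
Proof.
move=> z1; rewrite /gexp; apply: le_trans (normc_triangle _ _) _.
rewrite normcN expr2 !Normc.normcM normcR.
have -> : Normc.normc (2%:R : R[i]) = 2.
  by rewrite -(rmorph_nat (real_complex R)) normcR normr_nat.
have n0 := normc_ge0 z; have x0 := normr_ge0 x.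
move: (Normc.normc z) n0 z1 => n n0 n1; move: `|x| x0 => a a0.
by have : n * n <= n by [rewrite ler_piMr]; nra.
Qed.

Lemma cexp_near1 (w : R[i]) : Normc.normc (cexp w - 1) <= 2 * (expR (Normc.normc w) * Normc.normc w).
Proof.
have H t := cderiv_cexp (cderiv_scale w t).
have := @cderiv_bound R _ _ 0 1 (expR (Normc.normc w) * Normc.normc w) ler01 (fun t _ => H t).
rewrite mul1r mul0r cexp0 subr0 mulr1; apply => t /andP[t0 t1].
rewrite Normc.normcM normc_cexp ler_wpM2r ?normc_ge0 // ler_expR.
apply: le_trans (ler_norm _) _; apply: le_trans (normRe_le _) _.
by rewrite Normc.normcM normcR ger0_norm // ler_piMl ?normc_ge0.
Qed.

Lemma normc_cexp_ln (r t : R) : 0 < r -> Normc.normc (cexp (ln r +i* t)) = r.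
Proof. by move=> r0; rewrite normc_cexp /= lnK. Qed.

(* The period is computed by letting the abscissa go to -oo, where e^zeta vanishes. *)
Lemma period0 : period x 0 = 0.
Proof.
apply: (@normc_small _ (2 * expR (1 + 2 * `|x|) * (pi *+ 2))) => r /andP[r0 r1].
have := @normc_period_le 0 (ln r) (expR (1 + 2 * `|x|) * r) 0.
rewrite mul0r subr0 => H; apply: le_trans (H _) _; last by rewrite !mulrA [_ * r * _]mulrAC.
move=> t; rewrite subr0 /phi subr0 mul1r cexpD Normc.normcM normc_cexp_ln // ler_wpM2r ?(ltW r0) //.
rewrite normc_cexp ler_expR; apply: le_trans (ler_norm _) _; apply: le_trans (normRe_le _) _.
have nz := @normc_cexp_ln r t r0.
apply: le_trans (normc_gexp_le _) _; rewrite nz //.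
by rewrite ler_piMr // addr_ge0 // mulr_ge0.
Qed.

(** For k = 1 the factor e^((1 - k) zeta) is 1, and phi tends to 1 as the abscissa goes to -oo. *)
Lemma period1 : period x 1 = (0 : R) +i* (pi *+ 2).
Proof.
set K := 1 + 2 * `|x|.
have K0 : 0 <= K by rewrite addr_ge0 // mulr_ge0.
apply/eqP; rewrite -subr_eq0; apply/eqP.
apply: (@normc_small _ (2 * (2 * (expR K * K)) * (pi *+ 2))) => r /andP[r0 r1].
have := @normc_period_le 1 (ln r) (2 * (expR K * K) * r) 1.
rewrite mul1r => H; apply: le_trans (H _) _; last by rewrite !mulrA [_ * r * _]mulrAC.
move=> t; rewrite /phi subrr mul0r addr0; apply: le_trans (cexp_near1 _) _.
rewrite -!mulrA ler_wpM2l //.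
have nz := @normc_cexp_ln r t r0.
have gb : Normc.normc (gexp x (cexp (ln r +i* t))) <= K * r.
  by apply: le_trans (normc_gexp_le _) _; rewrite nz.
apply: ler_pM; rewrite ?expR_ge0 ?normc_ge0 // ler_expR (le_trans gb) //.
by rewrite ler_piMr.
Qed.

(** Divided by factorials, the three-term recurrence of the Hermite polynomials is [period_rec]. The
    values H_k(x) / k! are the Taylor coefficients of e^(2 x z - z^2). *)
Lemma period_hermite k : period x k.+1 = (0 : R) +i* (pi *+ 2) * ((@hermite R k).[x] / k`!%:R)%:C.
Proof.
elim/ltn_ind: k => -[|[|k]] IH.
- by rewrite period1 hornerC fact0 divr1 mulr1.
- have := period_rec 0; rewrite mul1r period1 period0 mulr0 subr0 => ->.
  rewrite hermite1 !hornerE (_ : 1`! = 1%N) // divr1 rmorphM /= rmorph_nat; ring.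
- have k0 : (k.+2%:R : R[i]) != 0 by rewrite pnatr_eq0.
  apply: (mulfI k0); rewrite period_rec (IH k.+1) // (IH k) //.
  rewrite hermite_recE -[(k.+2%:R : R[i])](rmorph_nat (real_complex R)).
  rewrite -[2 : R[i]](rmorph_nat (real_complex R)).
  have E : k.+2%:R * ((2 * x * (@hermite R k.+1).[x] - 2 * k.+1%:R * (@hermite R k).[x]) / (k.+2)`!%:R) =
     2 * x * ((@hermite R k.+1).[x] / (k.+1)`!%:R) - 2 * ((@hermite R k).[x] / k`!%:R) :> R.
    rewrite !factS !natrM.
    have f0 : k`!%:R != 0 :> R by rewrite pnatr_eq0 -lt0n fact_gt0.
    have f1 : k.+1%:R != 0 :> R by rewrite pnatr_eq0.
    have f2 : k.+2%:R != 0 :> R by rewrite pnatr_eq0.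
    move: (k`!%:R) (k.+1%:R) (k.+2%:R) f0 f1 f2 => a b c a0 b0 c0.
    by field; rewrite a0 b0 c0.
  rewrite [RHS]mulrCA -[in RHS]rmorphM E rmorphB !rmorphM.
  by move: (0 +i* (pi *+ 2)) => u; ring.
Qed.

End PeriodValue.

(** * The vertical line *)

Section Line.
Context {R : realType}.
Implicit Types z w : R[i].
Variable x : R.

Definition gauss_pow (k : nat) w : R[i] := cexp (w ^+ 2 - 2%:R * x%:C * w) * w ^+ k.

Lemma smooth_gauss_pow k : smooth (gauss_pow k).
Proof.
apply: smoothM; last by apply: smoothX; exact: smooth_id.
apply: smooth_cexp.
have H : smooth (fun z : R[i] => z ^+ 2 + (- (2%:R * x%:C)) * z).
  apply: smoothD; first by apply: smoothX; exact: smooth_id.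
  by apply: smoothM; [exact: smooth_cst|exact: smooth_id].
rewrite (_ : (fun z => _) = fun z : R[i] => z ^+ 2 + (- (2%:R * x%:C)) * z) //.
by apply/funext => z; rewrite mulNr.
Qed.

Definition gauss_pow_prim k := prim (gauss_pow k).

Lemma hol_gauss_pow_prim k : hol (gauss_pow_prim k) (gauss_pow k).
Proof. exact: smooth_prim (smooth_gauss_pow k). Qed.

(** A primitive form of the derivative of e^(w^2 - 2 x w) w^k. For k = 0 the lower term is a filler
    c, multiplied by zero. *)
Lemma line_rec k c (d : R) : exists e, forall t, 2 * gauss_pow_prim k.+1 (d +i* t) - 2 * x%:C * gauss_pow_prim k (d +i* t)
  + k%:R * (if k is k'.+1 then gauss_pow_prim k' (d +i* t) else c) - gauss_pow k (d +i* t) = e.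
Proof.
exists (2 * gauss_pow_prim k.+1 (d +i* 0) - 2 * x%:C * gauss_pow_prim k (d +i* 0)
  + k%:R * (if k is k'.+1 then gauss_pow_prim k' (d +i* 0) else c) - gauss_pow k (d +i* 0)) => t.
apply: (@cderiv_const R (fun t => 2 * gauss_pow_prim k.+1 (d +i* t) - 2 * x%:C * gauss_pow_prim k (d +i* t)
  + k%:R * (if k is k'.+1 then gauss_pow_prim k' (d +i* t) else c) - gauss_pow k (d +i* t))) => {}t.
have Hv := cderiv_vertical d t.
have H1 : cderiv (fun t => k%:R * (if k is k'.+1 then gauss_pow_prim k' (d +i* t) else c)) t
   (k%:R * (if k is k'.+1 then gauss_pow k' (d +i* t) * 'i%C else 0)).
  by apply: cderivZ; case: k => [|k']; [exact: cderiv_cst|exact: hol_gauss_pow_prim].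
have Hf : cderiv (fun t => gauss_pow k (d +i* t)) t
   (gauss_pow k (d +i* t) * (2 * (d +i* t) - 2 * x%:C) * 'i%C +
     cexp ((d +i* t) ^+ 2 - 2 * x%:C * (d +i* t)) * (k%:R * (d +i* t) ^+ k.-1 * 'i%C)).
  apply: (cderiv_eq (cderivM (cderiv_cexp (cderivB (cderivX 2 Hv) (cderivZ (2 * x%:C) Hv))) (cderivX k Hv))).
  by rewrite /gauss_pow -[2.-1]/1%N expr1; move: (cexp _) 'i%C => E u; ring.
apply: (cderiv_eq (cderivB (cderivD (cderivB (cderivZ 2 (hol_gauss_pow_prim k.+1 Hv)) (cderivZ (2 * x%:C) (hol_gauss_pow_prim k Hv))) H1) Hf)).
rewrite /gauss_pow; case: k {H1 Hf} => [|k] /=; first by rewrite expr1 expr0; ring.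
rewrite !exprS; ring.
Qed.

Lemma piecewise_line (L : R) : piecewise_C1 (vertical_line L).
Proof.
have cE : cderive (vertical_line L) = fun=> 'i%C.
  by apply/funext => t; exact: cderivE (cderiv_vertical L t).
split.
  by apply/ccontP; apply: cderiv_ccont => t; exact: cderiv_vertical.
exists [::] => t; rewrite cE; split.
- move=> _; split; last exact: cvg_cst.
  have [[h1 _] [h2 _]] := cderiv_vertical L t; exact: (conj h1 h2).
- exact: is_cvg_cst.
- exact: is_cvg_cst.
Qed.

Lemma arc_int_line (L a b : R) k c : a <= b ->
  arc_int (vertical_line L) (fun z => c * gauss_pow k z) a b = c * (gauss_pow_prim k (L +i* b) - gauss_pow_prim k (L +i* a)).
Proof.
have cv : ccont (vertical_line L) by apply: cderiv_ccont => t; exact: cderiv_vertical.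
have [f1 [f2 [H1 _ b0 b1]]] := smooth_gauss_pow k.
move=> ab; rewrite mulrBr; apply: (@arc_int_FTC R _ _ (fun t => c * gauss_pow_prim k (vertical_line L t))) => //.
- exact: piecewise_line.
- by apply: ccontZ; exact: hol_ccont H1 b1 cv.
- by apply: ccontZ; exact: hol_ccont (hol_gauss_pow_prim k) b0 cv.
- by move=> t d Hd; apply: (cderiv_eq (cderivZ c (hol_gauss_pow_prim k Hd))); rewrite mulrA.
Qed.

Lemma normc_gauss_pow k (d t : R) : Normc.normc (gauss_pow k (d +i* t)) =
  expR (d ^+ 2 - t ^+ 2 - 2 * x * d) * Normc.normc (d +i* t) ^+ k.
Proof.
rewrite /gauss_pow Normc.normcM normc_cexp; congr (expR _ * _); last first.
  by elim: k => [|k IH]; rewrite ?expr0 ?Normc.normc1 // !exprS Normc.normcM IH.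
have -> : (2%:R : R[i]) = (2%:R : R)%:C by rewrite rmorph_nat.
rewrite expr2 !(ReD, ReN, ReM) /=; ring.
Qed.

Lemma gauss_pow_bound k (d : R) : exists K, forall t, Normc.normc (gauss_pow k (d +i* t)) <= K * expR (- `|t|).
Proof.
(* The constant comes from |w|^k <= e^(k |w|), |w| <= |d| + |t| and (k + 1) |t| - t^2 <= (k +
   1)^2. *)
exists (expR (d ^+ 2 + 2 * `|x * d| + k%:R * `|d| + (k%:R + 1) ^+ 2)) => t.
rewrite normc_gauss_pow.
set n := Normc.normc _.
have n1 : n <= `|d| + `|t| by exact: normc_le.
have n2 : n ^+ k <= expR (k%:R * n).
  rewrite expRM_natl lerXn2r ?nnegrE ?normc_ge0 ?expR_ge0 //.
  by apply: le_trans (expR_ge1Dx n); rewrite lerDr.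
apply: le_trans (ler_wpM2l (expR_ge0 _) n2) _.
rewrite -!expRD ler_expR.
have h1 : k%:R * n <= k%:R * `|d| + k%:R * `|t| by rewrite -mulrDr ler_wpM2l.
have h2 : - (x * d) <= `|x * d| by rewrite -normrN ler_norm.
have h3 : t ^+ 2 = `|t| ^+ 2 by rewrite real_normK ?num_real.
have h4 : 0 <= (`|t| - (k%:R + 1)) ^+ 2 by exact: sqr_ge0.
have h5 : 0 <= `|t| ^+ 2 by exact: sqr_ge0.
have h6 : 0 <= (k%:R + 1) ^+ 2 :> R by exact: sqr_ge0.
have h7 : (`|t| - (k%:R + 1)) ^+ 2 = `|t| ^+ 2 - 2 * (k%:R * `|t|) - 2 * `|t| + (k%:R + 1) ^+ 2 by ring.
have h8 : 2 * x * d = 2 * (x * d) by rewrite mulrA.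
rewrite h3 h8; lra.
Qed.

Lemma cvg_exp_normr_pinfty : expR (- `|t|) @[t --> +oo] --> (0 : R).
Proof.
apply: cvg_trans (@cvgr_expR R); apply: near_eq_cvg; near=> t.
by rewrite ger0_norm.
Unshelve. all: by end_near. Qed.

Lemma cvg_exp_normr_ninfty : expR (- `|t|) @[t --> -oo] --> (0 : R).
Proof.
apply/cvgNy_compNP; under eq_fun do rewrite /= normrN.
exact: cvg_exp_normr_pinfty.
Qed.

Lemma cvg_normc_dom {T : Type} (F : set_system T) (FF : Filter F) (f : T -> R[i]) (g : T -> R) :
  (\forall t \near F, Normc.normc (f t) <= g t) -> g t @[t --> F] --> (0 : R) ->
  (f : T -> R[i]^o) @ F --> (0 : R[i]^o).
Proof.
move=> H G; apply/cvg_normcP; apply: (squeeze_cvgr _ (cvg_cst 0) G).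
by apply: filterS H => t Ht; rewrite subr0 normc_ge0.
Qed.

Lemma cvgCD {T : Type} (F : set_system T) (FF : Filter F) (f g : T -> R[i]) (a b : R[i]) :
  (f : T -> R[i]^o) @ F --> (a : R[i]^o) -> (g : T -> R[i]^o) @ F --> (b : R[i]^o) ->
  ((fun t => f t + g t) : T -> R[i]^o) @ F --> (a + b : R[i]^o).
Proof.
move=> /(cvg_complexP FF)[fr fi] /(cvg_complexP FF)[gr gi].
apply/(cvg_complexP FF); rewrite ReD ImD.
rewrite (funext (fun t => ReD (f t) (g t))) (funext (fun t => ImD (f t) (g t))).
by split; [exact: cvgD fr gr|exact: cvgD fi gi].
Qed.

Lemma cvgCB {T : Type} (F : set_system T) (FF : Filter F) (f g : T -> R[i]) (a b : R[i]) :
  (f : T -> R[i]^o) @ F --> (a : R[i]^o) -> (g : T -> R[i]^o) @ F --> (b : R[i]^o) ->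
  ((fun t => f t - g t) : T -> R[i]^o) @ F --> (a - b : R[i]^o).
Proof.
move=> /(cvg_complexP FF)[fr fi] /(cvg_complexP FF)[gr gi].
apply/(cvg_complexP FF); rewrite ReD ImD ReN ImN.
rewrite (funext (fun t => etrans (ReD (f t) (- g t)) (congr1 _ (ReN (g t)))))
  (funext (fun t => etrans (ImD (f t) (- g t)) (congr1 _ (ImN (g t))))).
by split; [exact: cvgB fr gr|exact: cvgB fi gi].
Qed.

Lemma cvg_gauss_pow0 (F : set_system R) (FF : Filter F) k d : expR (- `|t|) @[t --> F] --> (0 : R) ->
  (fun t => gauss_pow k (d +i* t) : R[i]^o) @ F --> (0 : R[i]^o).
Proof.
move=> H; have [K HK] := gauss_pow_bound k d.
apply: (@cvg_normc_dom _ _ _ _ (fun t => K * expR (- `|t|))); first by apply: nearW => t; exact: HK.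
by rewrite -[X in _ --> X](mulr0 K); apply: cvgMr.
Qed.

(** Horizontal segments between the abscissas L and x contribute nothing at large height, since the
    integrand decays there like e^(-t^2). It lets the line be moved to Re w = x, the critical point
    of w^2 - 2 x w. *)
Lemma cvg_gauss_pow_prim_shift (F : set_system R) (FF : Filter F) (L : R) : expR (- `|t|) @[t --> F] --> (0 : R) ->
  (fun t => gauss_pow_prim 0 (L +i* t) - gauss_pow_prim 0 (x +i* t) : R[i]^o) @ F --> (0 : R[i]^o).
Proof.
move=> H.
pose M := (`|L| + `|x|) ^+ 2 + 2 * `|x| * (`|L| + `|x|) + 1.
apply: (@cvg_normc_dom _ _ _ _ (fun t => 2 * (`|L - x| * expR M) * expR (- `|t|))); last first.
  by rewrite -[X in _ --> X](mulr0 (2 * (`|L - x| * expR M))); apply: cvgMr.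
apply: nearW => t.
have B s : `|s| <= `|L| + `|x| -> Normc.normc (gauss_pow 0 (s +i* t) * 1) <= expR M * expR (- `|t|).
  move=> sb; rewrite mulr1 normc_gauss_pow expr0 mulr1 -expRD ler_expR.
  have h3 : t ^+ 2 = `|t| ^+ 2 by rewrite real_normK ?num_real.
  have h4 : 0 <= (`|t| - 1) ^+ 2 by exact: sqr_ge0.
  have h4' : 0 <= `|t| ^+ 2 by exact: sqr_ge0.
  have h4'' : (`|t| - 1) ^+ 2 = `|t| ^+ 2 - 2 * `|t| + 1 by ring.
  have h5 : s ^+ 2 <= (`|L| + `|x|) ^+ 2.
    by rewrite -[s ^+ 2]real_normK ?num_real // lerXn2r ?nnegrE // addr_ge0.
  have h6 : - (2 * x * s) <= 2 * `|x| * (`|L| + `|x|).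
    apply: le_trans (ler_norm _) _; rewrite normrN !normrM (@ger0_norm _ 2) //.
    by rewrite ler_wpM2l // mulr_ge0.
  rewrite /M h3; lra.
have HP s : cderiv (fun s : R => gauss_pow_prim 0 (s +i* t)) s (gauss_pow 0 (s +i* t) * 1).
  by apply: hol_gauss_pow_prim; exact: cderiv_horizontal.
have Lb (s : R) : x <= s <= L -> `|s| <= `|L| + `|x|.
  move=> /andP[s1 s2]; have h1 := ler_norm L; have h2 := ler_norm (- x); rewrite normrN in h2.
  by rewrite ler_norml; apply/andP; split; have := normr_ge0 L; have := normr_ge0 x; lra.
have Lb' (s : R) : L <= s <= x -> `|s| <= `|L| + `|x|.
  move=> /andP[s1 s2]; have h1 := ler_norm x; have h2 := ler_norm (- L); rewrite normrN in h2.
  by rewrite ler_norml; apply/andP; split; have := normr_ge0 L; have := normr_ge0 x; lra.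
have [xL|/ltW Lx] := leP x L.
  have := @cderiv_bound R _ _ x L _ xL (fun s _ => HP s) (fun s sb => B s (Lb s sb)).
  rewrite (ger0_norm (_ : 0 <= L - x)) ?subr_ge0 // => Hb; apply: le_trans Hb _.
  by rewrite le_eqVlt; apply/orP; left; apply/eqP; ring.
rewrite normcB distrC.
have := @cderiv_bound R _ _ L x _ Lx (fun s _ => HP s) (fun s sb => B s (Lb' s sb)).
rewrite (ger0_norm (_ : 0 <= x - L)) ?subr_ge0 // => Hb; apply: le_trans Hb _.
by rewrite le_eqVlt; apply/orP; left; apply/eqP; ring.
Qed.

Lemma gauss_primitive_lim (psi : R -> R) : (forall t, is_derive t (1 : R) psi (gauss_fun t)) ->
  psi t @[t --> +oo] --> psi 0 + Num.sqrt pi / 2.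
Proof.
move=> H.
(* The limit is known for the square of the integral; the square root gives it back because the
   integral is nonnegative. *)
have S : Num.sqrt ((gauss_integral_proof.integral0_gauss t : R) ^+ 2) @[t --> +oo] --> Num.sqrt (pi / 4 : R).
  by apply: continuous_cvg; [exact: sqrt_continuous|exact: gauss_integral_proof.cvg_integral0_gauss_sqr].
have E : Num.sqrt (pi / 4) = Num.sqrt pi / 2 :> R.
  rewrite sqrtrM ?pi_ge0 // sqrtrV // (_ : 4 = 2 ^+ 2); last by rewrite expr2 -natrM.
  by rewrite sqrtr_sqr ger0_norm.
rewrite -E.
have C : psi 0 + Num.sqrt ((gauss_integral_proof.integral0_gauss t : R) ^+ 2) @[t --> +oo] --> psi 0 + Num.sqrt (pi / 4 : R).
  by apply: cvgD; [exact: cvg_cst|exact: S].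
apply: cvg_trans C; apply: near_eq_cvg; near=> t.
rewrite sqrtr_sqr ger0_norm ?gauss_integral_proof.integral0_gauss_ge0 //.
rewrite /gauss_integral_proof.integral0_gauss (Rintegral_FTC (F := psi)) ?subrKC ?addrC ?subrK //.
exact: continuous_gauss_fun.
Unshelve. all: by end_near. Qed.

Lemma gauss_primitive_lim_ninfty (psi : R -> R) : (forall t, is_derive t (1 : R) psi (gauss_fun t)) ->
  psi t @[t --> -oo] --> psi 0 - Num.sqrt pi / 2.
Proof.
move=> H; apply/cvgNy_compNP.
have -> : psi 0 - Num.sqrt pi / 2 = - (- psi (- 0) + Num.sqrt pi / 2) by rewrite oppr0 opprD opprK.
have G := @gauss_primitive_lim (fun t => - psi (- t)).
rewrite (_ : psi \o -%R = fun t => - - psi (- t)); last by apply/funext => t; rewrite opprK.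
apply: cvgN; apply: G => t.
have h : is_derive t (1 : R) (fun t : R => - t) (-1) by apply: is_deriveN.
have h2 := @is_derive1_comp R psi (fun t : R => - t) t _ _ (H (- t)) h.
have -> : gauss_fun t = - (gauss_fun (- t) * -1) by rewrite /gauss_fun sqrrN mulrN1 opprK.
exact: is_deriveN.
Qed.

Definition line_diff (L : R) k (ab : R * R) : R[i]^o := gauss_pow_prim k (L +i* ab.2) - gauss_pow_prim k (L +i* ab.1).
Notation FP := (filter_prod (ninfty_nbhs R) (pinfty_nbhs R)).

(** On Re w = x the exponent w^2 - 2 x w is the real number -x^2 - t^2, so the primitive has
    constant real part and its imaginary part is e^(-x^2) times a primitive of the Gaussian. The
    general line differs by two vanishing horizontal terms. *)
Lemma line_lim0 (L : R) : line_diff L 0 @ FP --> ((expR (- x ^+ 2))%:C * (0 +i* Num.sqrt pi) : R[i]^o).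
Proof.
pose psi (t : R) := expR (x ^+ 2) * complex.Im (gauss_pow_prim 0 (x +i* t)).
have HP t : cderiv (fun t : R => gauss_pow_prim 0 (x +i* t)) t ((0 : R) +i* (expR (- x ^+ 2) * gauss_fun t)).
  apply: (cderiv_eq (hol_gauss_pow_prim 0 (cderiv_vertical x t))).
  have -> : gauss_pow 0 (x +i* t) = (expR (- x ^+ 2) * gauss_fun t)%:C.
    rewrite /gauss_pow expr0 mulr1 /gauss_fun -expRD -cexpR; congr cexp.
    have -> : (2%:R : R[i]) = (2%:R : R)%:C by rewrite rmorph_nat.
    rewrite expr2; apply: complexP; rewrite !(ReD, ReN, ReM, ImD, ImN, ImM) /=; ring.
  by apply: complexP; rewrite ?(ReM, ImM) /=; ring.
have Hpsi t : is_derive t (1 : R) psi (gauss_fun t).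
  have [_ h] := HP t; have h2 := is_deriveZ (expR (x ^+ 2)) h.
  by move: h2; rewrite /= /GRing.scale /= mulrA -expRD subrr expR0 mul1r.
have RePL (s t : R) : complex.Re (gauss_pow_prim 0 (x +i* t)) = complex.Re (gauss_pow_prim 0 (x +i* s)).
  have Hc u : cderiv (fun t : R => (complex.Re (gauss_pow_prim 0 (x +i* t)))%:C) u 0.
    by have [h _] := HP u; split => //=; exact: is_derive_cst.
  by have := cderiv_const Hc t s => -[].
have ImPL (t : R) : complex.Im (gauss_pow_prim 0 (x +i* t)) = expR (- x ^+ 2) * psi t.
  by rewrite /psi mulrA -expRD addNr expR0 mul1r.
have lx : line_diff x 0 @ FP --> ((expR (- x ^+ 2))%:C * (0 +i* Num.sqrt pi) : R[i]^o).
  apply/cvg_complexP; rewrite /line_diff; split.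
    have -> : (fun ab : R * R => complex.Re (gauss_pow_prim 0 (x +i* ab.2) - gauss_pow_prim 0 (x +i* ab.1))) = cst 0.
      by apply/funext => ab; rewrite ReD ReN (RePL ab.1 ab.2) subrr.
    by rewrite ReM mulr0 mul0r subr0; exact: cvg_cst.
  have -> : (fun ab : R * R => complex.Im (gauss_pow_prim 0 (x +i* ab.2) - gauss_pow_prim 0 (x +i* ab.1))) =
      fun ab => expR (- x ^+ 2) * (psi ab.2 - psi ab.1).
    by apply/funext => ab; rewrite ImD ImN !ImPL mulrBr.
  rewrite ImM mul0r addr0; apply: cvgMr.
  have E : complex.Im ((0 : R) +i* Num.sqrt pi) = (psi 0 + Num.sqrt pi / 2) - (psi 0 - Num.sqrt pi / 2).
    by rewrite /complex.Im; lra.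
  rewrite E; apply: cvgB.
    exact: cvg_comp cvg_snd (gauss_primitive_lim Hpsi).
  exact: cvg_comp cvg_fst (gauss_primitive_lim_ninfty Hpsi).
have h1 : (fun ab : R * R => gauss_pow_prim 0 (L +i* ab.2) - gauss_pow_prim 0 (x +i* ab.2) : R[i]^o) @ FP --> (0 : R[i]^o).
  exact: cvg_comp cvg_snd (@cvg_gauss_pow_prim_shift _ _ L cvg_exp_normr_pinfty).
have h2 : (fun ab : R * R => gauss_pow_prim 0 (L +i* ab.1) - gauss_pow_prim 0 (x +i* ab.1) : R[i]^o) @ FP --> (0 : R[i]^o).
  exact: cvg_comp cvg_fst (@cvg_gauss_pow_prim_shift _ _ L cvg_exp_normr_ninfty).
have FPF : Filter FP by exact: _.
have S : (fun ab : R * R => line_diff x 0 ab + ((gauss_pow_prim 0 (L +i* ab.2) - gauss_pow_prim 0 (x +i* ab.2)) -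
    (gauss_pow_prim 0 (L +i* ab.1) - gauss_pow_prim 0 (x +i* ab.1))) : R[i]^o) @ FP -->
    ((expR (- x ^+ 2))%:C * (0 +i* Num.sqrt pi) + (0 - 0) : R[i]^o).
  exact: (cvgCD FPF lx (cvgCB FPF h1 h2)).
move: S; rewrite subr0 addr0; apply: cvg_trans; apply: near_eq_cvg; apply: nearW => ab.
rewrite /line_diff.
have ringE (a b c d : R[i]) : (b - a) + ((d - b) - (c - a)) = d - c by ring.
exact: ringE.
Qed.

(** In the limit the boundary terms drop out of [line_rec], and what remains is the recurrence
    satisfied by H_k(x) / 2^k. *)
Lemma line_lim (L : R) k : line_diff L k @ FP -->
  ((expR (- x ^+ 2))%:C * (0 +i* Num.sqrt pi) * ((@hermite R k).[x] / 2 ^+ k)%:C : R[i]^o).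
Proof.
have FPF : Filter FP by exact: _.
have bdry m : (fun ab : R * R => gauss_pow m (L +i* ab.2) - gauss_pow m (L +i* ab.1) : R[i]^o) @ FP --> (0 : R[i]^o).
  have h1 : (fun ab : R * R => gauss_pow m (L +i* ab.2) : R[i]^o) @ FP --> (0 : R[i]^o).
    exact: cvg_comp cvg_snd (@cvg_gauss_pow0 _ _ m L cvg_exp_normr_pinfty).
  have h2 : (fun ab : R * R => gauss_pow m (L +i* ab.1) : R[i]^o) @ FP --> (0 : R[i]^o).
    exact: cvg_comp cvg_fst (@cvg_gauss_pow0 _ _ m L cvg_exp_normr_ninfty).
  by have := cvgB h1 h2; rewrite subr0; apply.
have recE m ab : line_diff L m.+1 ab = x%:C * line_diff L m ab
    - (m%:R / 2) * (if m is m'.+1 then line_diff L m' ab else 0)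
    + 2^-1 * (gauss_pow m (L +i* ab.2) - gauss_pow m (L +i* ab.1)).
  have lin (a a' b b' c c' f f' y d : R[i]) :
      2 * a - 2 * y * b + d * c - f = 2 * a' - 2 * y * b' + d * c' - f' ->
      a - a' = y * (b - b') - d / 2 * (c - c') + 2^-1 * (f - f').
    move=> E; have n2 : (2 : R[i]) != 0 by rewrite pnatr_eq0.
    apply: (mulfI n2).
    have -> : 2 * (a - a') = 2 * y * (b - b') - d * (c - c') + (f - f') +
      ((2 * a - 2 * y * b + d * c - f) - (2 * a' - 2 * y * b' + d * c' - f')) by ring.
    by rewrite E subrr addr0; field.
  have [e He] := line_rec m 0 L.
  have := lin _ _ _ _ _ _ _ _ _ _ (etrans (He ab.2) (esym (He ab.1))).
  rewrite /line_diff; case: m {He} => [|m] H; last exact: H.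
  by rewrite (subrr (0 : R[i])) in H; exact: H.
set c := _ * (0 +i* _).
have limS m (u v : R[i]) : line_diff L m @ FP --> (u : R[i]^o) ->
    (fun ab => if m is m'.+1 then line_diff L m' ab else 0) @ FP --> (v : R[i]^o) ->
    line_diff L m.+1 @ FP --> (x%:C * u - m%:R / 2 * v : R[i]^o).
  move=> Hu Hv.
  have := cvgCD FPF (cvgCB FPF (@cvgMr _ _ _ FPF _ x%:C _ Hu) (@cvgMr _ _ _ FPF _ (m%:R / 2 : R[i]) _ Hv))
    (@cvgMr _ _ _ FPF _ (2^-1 : R[i]) _ (bdry m)).
  rewrite mulr0 addr0; apply: cvg_trans; apply: near_eq_cvg; apply: nearW => ab.
  exact: esym (recE m ab).
elim/ltn_ind: k => -[|[|k]] IH.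
- by rewrite hornerC expr0 divr1 mulr1; exact: line_lim0.
- have := limS 0%N _ _ (IH 0%N isT) (cvg_cst _).
  have e0 : (hermite 0).[x] / 2 ^+ 0 = 1 by rewrite hornerC expr0 divr1.
  have e1 : (hermite 1).[x] / 2 ^+ 1 = x by rewrite hermite1 !hornerE expr1; field.
  by move=> /(_ FPF); rewrite e0 e1 mulr0 subr0 rmorph1 mulr1 [x%:C * c]mulrC; apply.
- have := limS k.+1 _ _ (IH k.+1 (ltnSn _)) (IH k (leqnSn _)).
  set l1 := (X in _ --> X -> _); set l2 := (X in _ -> _ --> X).
  suff -> : l1 = l2 by [].
  rewrite /l1 /l2 hermite_recE.
  have -> : (k.+1%:R / 2 : R[i]) = (k.+1%:R / 2)%:C by rewrite rmorphM fmorphV !rmorph_nat.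
  rewrite mulrCA [X in _ - X]mulrCA -mulrBr; congr (_ * _).
  rewrite -!rmorphM -rmorphB; congr (_%:C).
  rewrite !exprS; field.
  by rewrite expf_neq0.
Qed.

Lemma line_limit (L : R) k c : (fun ab : R * R => arc_int (vertical_line L) (fun z => c * gauss_pow k z) ab.1 ab.2 : R[i]^o) @ FP -->
  (c * ((expR (- x ^+ 2))%:C * (0 +i* Num.sqrt pi) * ((@hermite R k).[x] / 2 ^+ k)%:C) : R[i]^o).
Proof.
have nL : \forall a \near -oo, a <= (0 : R) by exact: nbhs_ninfty_le.
have nR : \forall a \near +oo, (0 : R) <= a by exact: nbhs_pinfty_ge.
have FPF : Filter FP by exact: _.
have H := @cvgMr _ _ _ FPF _ c _ (@line_lim L k).
apply: cvg_trans H; apply: near_eq_cvg.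
near=> ab; rewrite arc_int_line //.
apply: (@le_trans _ _ 0).
  by near: ab; exact: cvg_fst nL.
by near: ab; exact: cvg_snd nR.
Unshelve. all: by end_near. Qed.

End Line.

(** * The Gaussian functional and orthogonality *)

Section GaussFunctional.
Context {R : realType}.
Notation mu := (@lebesgue_measure R).
Implicit Types p q : {poly R}.

Definition gpoly p (x : R) : R := p.[x] * gauss_fun x.

Definition gauss_int p : R := Rintegral mu setT (gpoly p).

Lemma horner_exp_bound p : exists K : R, 0 <= K /\ forall x, `|p.[x]| <= K * expR `|x|.
Proof.
exists (\sum_(i < size p) `|p`_i| * i`!%:R); split.
  by apply: sumr_ge0 => i _; rewrite mulr_ge0.
move=> x; rewrite horner_coef mulr_suml; apply: le_trans (ler_norm_sum _ _ _) _.
apply: ler_sum => i _; rewrite normrM normrX -mulrA ler_wpM2l //.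
case: (nat_of_ord i) => [|n]; first by rewrite expr0 fact0 mul1r -expR0 ler_expR.
have := expR_ge1Dxn n (normr_ge0 x).
rewrite -ler_pdivrMl ?ltr0n ?fact_gt0 // mulrC.
by apply: le_trans; rewrite lerDr.
Qed.

(** Half of the Gaussian absorbs the polynomial; the remaining e^(-x^2/2) is the standard normal
    density up to a constant, hence integrable. *)
Lemma gpoly_bound p : exists K : R, 0 <= K /\ forall x, `|gpoly p x| <= K * expR (- (x ^+ 2 / 2)).
Proof.
have [K [K0 HK]] := horner_exp_bound p.
exists (K * expR 1); split; first by rewrite mulr_ge0 ?expR_ge0.
move=> x; rewrite /gpoly normrM (ger0_norm (gauss_fun_ge0 x)).
apply: le_trans (ler_wpM2r (gauss_fun_ge0 x) (HK x)) _.
rewrite /gauss_fun -!mulrA -!expRD ler_wpM2l // ler_expR.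
have h3 : x ^+ 2 = `|x| ^+ 2 by rewrite real_normK ?num_real.
have h4 : 0 <= (`|x| - 1) ^+ 2 by exact: sqr_ge0.
have h5 : (`|x| - 1) ^+ 2 = `|x| ^+ 2 - 2 * `|x| + 1 by ring.
rewrite h3; lra.
Qed.

Lemma continuous_gpoly p : continuous (gpoly p).
Proof.
move=> x; apply: cvgM; first exact: continuous_horner.
exact: continuous_gauss_fun.
Qed.

Lemma measurable_gpoly p : measurable_fun setT (gpoly p).
Proof. by apply: continuous_measurable_fun; exact: continuous_gpoly. Qed.

Lemma integrable_half_gauss : mu.-integrable setT (EFin \o (fun x : R => expR (- (x ^+ 2 / 2)))).
Proof.
have I : mu.-integrable setT (EFin \o normal_pdf (0 : R) 1).
  exact: integrable_normal_pdf.
have := @integrableZl _ _ R mu setT measurableT (normal_peak (1 : R))^-1 _ I.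
apply: eq_integrable => // x _ /=.
have E : normal_pdf 0 1 x = normal_peak 1 * normal_fun 0 1 x :> R.
  by rewrite normal_pdfE ?oner_neq0.
rewrite -EFinM E /normal_fun.
rewrite mulrA mulVf ?mul1r; last by rewrite gt_eqF // normal_peak_gt0 ?oner_neq0.
by rewrite subr0 expr1n mulNr.
Qed.

Lemma integrable_gpoly p : mu.-integrable setT (EFin \o gpoly p).
Proof.
have [K [K0 HK]] := gpoly_bound p.
apply: (@le_integrable _ _ R mu setT measurableT _ (fun x => (K%:E * (expR (- (x ^+ 2 / 2)))%:E)%E)).
- by apply/measurable_EFinP; exact: measurable_gpoly.
- move=> x _ /=; rewrite lee_fin; apply: le_trans (HK x) _; exact: ler_norm.
- by apply: integrableZl => //; exact: integrable_half_gauss.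
Qed.

Lemma gauss_intD p q : gauss_int (p + q) = gauss_int p + gauss_int q.
Proof.
rewrite /gauss_int -RintegralD //; try exact: integrable_gpoly.
by apply: eq_Rintegral => x _; rewrite /gpoly hornerD mulrDl.
Qed.

Lemma gauss_intZ a p : gauss_int (a *: p) = a * gauss_int p.
Proof.
rewrite /gauss_int -RintegralZl //; try exact: integrable_gpoly.
by apply: eq_Rintegral => x _; rewrite /gpoly hornerZ mulrA.
Qed.

Lemma is_derive_gpoly p (x : R) : is_derive x (1 : R) (gpoly p) (gpoly (p^`() - 2 *: 'X * p) x).
Proof.
have h := is_derive_poly p x.
have h2 : is_derive x (1 : R) gauss_fun (- 2 * x * gauss_fun x).
  have h3 : is_derive x (1 : R) (fun x : R => - x ^+ 2) (- (2 * x)).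
    by apply: is_derive_eq; rewrite /GRing.scale /=; ring.
  have := @is_derive1_comp R expR (fun x : R => - x ^+ 2) x _ _ (is_derive_expR _) h3.
  by rewrite mulrC !mulNr.
rewrite /gpoly; apply: is_derive_eq; rewrite !hornerE /GRing.scale /=. ring.
Qed.

Lemma gpoly_lim p : (fun n : nat => gpoly p n%:R - gpoly p (- n%:R)) @ \oo --> (0 : R).
Proof.
have [K [K0 HK]] := gpoly_bound p.
have B x : `|gpoly p x| <= K * expR 1 * expR (- `|x|).
  apply: le_trans (HK x) _; rewrite -mulrA -expRD ler_wpM2l // ler_expR.
  have h3 : x ^+ 2 = `|x| ^+ 2 by rewrite real_normK ?num_real.
  have h4 : 0 <= (`|x| - 1) ^+ 2 by exact: sqr_ge0.
  have h5 : (`|x| - 1) ^+ 2 = `|x| ^+ 2 - 2 * `|x| + 1 by ring.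
  rewrite h3; lra.
have H : (fun n : nat => 2 * (K * expR 1) * expR (- n%:R)) @ \oo --> (0 : R).
  by rewrite -[X in _ --> X](mulr0 (2 * (K * expR 1))); apply: cvgMr; exact: cvgn_expR.
apply: norm_cvg0; apply: (squeeze_cvgr _ (cvg_cst 0) H); apply: nearW => n.
rewrite normr_ge0 /=; apply: le_trans (ler_normB _ _) _.
have := B n%:R; have := B (- n%:R); rewrite normrN normr_nat; lra.
Qed.

(** The integrand is the derivative of p e^(-x^2). The integrals over [-n, n] are boundary
    differences tending to 0, and by domination they tend to the integral over the line. *)
Lemma gauss_int_parts p : gauss_int (p^`() - 2 *: 'X * p) = 0.
Proof.
set q := p^`() - 2 *: 'X * p.
pose f_ (n : nat) : R -> \bar R := (EFin \o gpoly q) \_ `[- n%:R, n%:R].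
have H : (\int[mu]_x f_ n x)%E @[n --> \oo] --> (\int[mu]_x (gpoly q x)%:E)%E.
  apply: (@dominated_cvg _ _ R mu setT measurableT f_ (EFin \o gpoly q) (fun x => `|gpoly q x|%:E)).
  - move=> n; apply/measurable_restrict => //; rewrite setTI.
    by apply/measurable_EFinP; apply: measurable_funTS; exact: measurable_gpoly.
  - move=> x _; apply: cvg_near_cst; near=> n.
    rewrite /f_ patchE mem_set //= in_itv /= -ler_norml.
    by near: n; exact: nbhs_infty_ger.
  - by [].
  - by have := integrable_gpoly q => /integrable_abse.
  - by move=> n x _; rewrite /f_ patchE; case: ifP => _ //; rewrite abse0 lee_fin.
have E n : (\int[mu]_x f_ n x)%E = (gpoly p n%:R - gpoly p (- n%:R))%:E.
  rewrite /f_ -integral_mkcond.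
  have nn : - n%:R <= n%:R :> R by rewrite (@le_trans _ _ 0) // oppr_le0.
  rewrite -(Rintegral_FTC nn (@continuous_gpoly q) (fun t => is_derive_gpoly p t)).
  rewrite /Rintegral fineK //; apply: integrable_fin_num => //.
  by apply: integrableS (integrable_gpoly q).
rewrite /gauss_int /Rintegral.
have -> : (\int[mu]_x (gpoly q x)%:E)%E = 0%E.
  apply: (cvg_unique _ H); first exact: ereal_hausdorff.
  rewrite (funext E); apply: cvg_EFin; first exact: nearW.
  exact: gpoly_lim.
by [].
Unshelve. all: by end_near. Qed.

(** A nonnegative integrand with zero integral vanishes off a null set, where x is then a root of
    [p i]. If [p i] were nonzero its roots would be finite in number, and [0, 1] would be covered by
    two null sets. *)
Lemma gauss_int_definite (I : finType) (p : I -> {poly R}) :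
  gauss_int (\sum_i p i * p i) = 0 -> forall i, p i = 0.
Proof.
move=> H i; apply/eqP/negPn/negP => pi0.
set q := \sum_i p i * p i in H.
have qE (x : R) : q.[x] = \sum_i (p i).[x] ^+ 2.
  by rewrite /q horner_sum; apply: eq_bigr => j _; rewrite hornerM expr2.
have q0 (x : R) : 0 <= q.[x] by rewrite qE sumr_ge0 // => j _; rewrite sqr_ge0.
have A : ae_eq mu setT (EFin \o gpoly q) (cst 0%E).
  apply/(ae_eq_integral_abs mu measurableT).
    by apply/measurable_EFinP; exact: measurable_gpoly.
  rewrite (_ : (\int[mu]_x `|(EFin \o gpoly q) x|)%E = (\int[mu]_x (gpoly q x)%:E)%E); last first.
    apply: eq_integral => x _ /=; rewrite ger0_norm // /gpoly mulr_ge0 ?gauss_fun_ge0 //.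
  rewrite -[LHS]fineK; first by rewrite -[fine _]/(gauss_int q) H.
  by apply: integrable_fin_num => //; exact: integrable_gpoly.
have [M [mM M0 sM]] := A.
pose Z : set R := [set x | (p i).[x] = 0].
have Z0 : mu Z = 0%E.
  apply/countable_lebesgue_measure0/finite_set_countable; apply: contrapT => Zi.
  have [B BZ] := infinite_set_fset (size (p i)) Zi.
  apply/negP; rewrite -ltnNge; apply: max_poly_roots => //; last exact: finmap.fset_uniq.
  by apply/allP => x xB; apply/rootP; exact: BZ.
have mZ : measurable Z.
  rewrite (_ : Z = horner (p i) @^-1` [set 0]); last by [].
  rewrite -[_ @^-1` _]setTI; have mh : measurable_fun setT (horner (p i)).
    by apply: continuous_measurable_fun; exact: continuous_horner.
  exact: mh.
have cover : `[0, 1] `<=` M `|` Z.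
  move=> x _; have [Mx|Mx] := pselect (M x); first by left.
  right; have gq : gpoly q x = 0.
    apply: contrapT => gq; apply: Mx; apply: sM => /= /(_ Logic.I) [].
    exact: gq.
  have : q.[x] = 0.
    by move/eqP: gq; rewrite /gpoly mulf_eq0 [gauss_fun x == 0]gt_eqF ?expR_gt0 // orbF => /eqP.
  rewrite qE => /eqP; rewrite psumr_eq0 => [/allP/(_ i)|j _]; last exact: sqr_ge0.
  by rewrite mem_index_enum sqrf_eq0 => /(_ isT)/eqP.
have : (mu `[0%R, 1%R]%classic <= mu M + mu Z)%E.
  apply: le_trans (measureU2 mu mM mZ); apply: le_measure; rewrite ?inE //.
  exact: measurableU.
by rewrite M0 Z0 adde0 lebesgue_measure_itv /= lte_fin ltr01 oppr0 adde0 lee_fin ler10.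
Qed.

End GaussFunctional.

(** * The weight and the entries of the normal form *)

Section WeightAlgebra.
Context {R : realType} {N : nat}.
Variable nu : 'I_N.-1 -> R.
Notation A := (superdiag nu).

Lemma superdiag_eq0 (i j : 'I_N) : j != i.+1 :> nat -> A i j = 0.
Proof.
move=> ji; rewrite mxE big1 // => k _; case: eqP => //= ik; case: eqP => //= jk.
by move: ji; rewrite jk ik eqxx.
Qed.

Lemma superdiagX_eq0 k (i j : 'I_N) : j != (i + k)%N :> nat -> (A ^+ k) i j = 0.
Proof.
elim: k i j => [|k IH] i j ij.
  by rewrite expr0 mxE; case: eqP => // E; move: ij; rewrite E addn0 eqxx.
rewrite exprS mxE big1 // => m _; have [mi|mi] := eqVneq (m : nat) i.+1; last first.
  by rewrite superdiag_eq0 // mul0r.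
by rewrite IH ?mulr0 // mi addSnnS.
Qed.

Lemma superdiag_nilp : A ^+ N = 0.
Proof.
apply/matrixP => i j; rewrite superdiagX_eq0 ?mxE // neq_ltn.
by rewrite (leq_trans (ltn_ord j)) // leq_addl.
Qed.

Definition wJ (i : 'I_N) : R := (N - i.+1)%:R.
Definition realJ : 'M[R]_N := \matrix_(i, j) ((i == j)%:R * wJ i).

Lemma realJE i j : realJ i j = (i == j)%:R * wJ i.
Proof. by rewrite mxE. Qed.

Lemma wJ_diff (i j : 'I_N) : wJ i - wJ j = j%:R - i%:R.
Proof.
have E (k : 'I_N) : wJ k = N%:R - k.+1%:R by rewrite /wJ natrB.
by rewrite !E -!natr1; ring.
Qed.

(** A maps between neighbouring indices only, and the diagonal weights of neighbours differ by 1. *)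
Lemma superdiagJ : A *m realJ = realJ *m A - A.
Proof.
apply/matrixP => i j.
have -> : (A *m realJ) i j = A i j * wJ j.
  rewrite mxE (bigD1 j) //= realJE eqxx mul1r big1 ?addr0 // => k kj.
  by rewrite realJE (negbTE kj) mul0r mulr0.
have -> : (realJ *m A - A) i j = wJ i * A i j - A i j.
  rewrite mxE [(- A) i j]mxE; congr (_ - _).
  rewrite mxE (bigD1 i) //= realJE eqxx mul1r big1 ?addr0 // => k ki.
  by rewrite realJE eq_sym (negbTE ki) !mul0r.
have [ji|ji] := eqVneq (j : nat) i.+1; last by rewrite superdiag_eq0 // mul0r mulr0 subr0.
have := wJ_diff i j; rewrite ji -natr1 addrAC subrr add0r => E.
have -> : wJ i = wJ j + 1 by rewrite -E addrC subrK.
ring.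
Qed.

Lemma map_horner_mul (F G : 'M[{poly R}]_N) x :
  mxpoly_eval (F *m G) x = mxpoly_eval F x *m mxpoly_eval G x.
Proof. exact: (map_mxM (horner_eval x)). Qed.

Lemma map_horner_mC (B : 'M[R]_N) x : mxpoly_eval (const_pmx B) x = B.
Proof. by apply/matrixP => i j; rewrite !mxE hornerC. Qed.

Lemma mexp_pexp x : mexp (x *: A) = mxpoly_eval (pexp A) x.
Proof.
rewrite (@mexp_nilp R N _ N); last by rewrite exprZmx superdiag_nilp scaler0.
apply/matrixP => i j; rewrite summxE [RHS]mxE /pexp /nexp summxE horner_sum.
apply: eq_bigr => k _.
have E : (('X *: const_pmx A) ^+ k) i j = 'X^k * ((A ^+ k) i j)%:P by rewrite exprZmx -const_pmxX mxE mxE.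
by rewrite mxE [in RHS]mxE E exprZmx mxE /inv_fact !hornerE.
Qed.

Lemma trmxX (B : 'M[R]_N) k : (B ^+ k)^T = B^T ^+ k.
Proof.
elim: k => [|k IH]; first by rewrite !expr0 [LHS]trmx1.
by rewrite exprS exprSr [LHS]trmx_mul IH.
Qed.

Lemma mexp_trpexp x : mexp (x *: A^T) = (mxpoly_eval (pexp A) x)^T.
Proof.
have n1 : (x *: A) ^+ N = 0 by rewrite exprZmx superdiag_nilp scaler0.
have n2 : (x *: A^T) ^+ N = 0 by rewrite exprZmx -trmxX superdiag_nilp linear0 scaler0.
rewrite -mexp_pexp (@mexp_nilp R N _ N n1) (@mexp_nilp R N _ N n2) linear_sum /=.
by apply: eq_bigr => k _; rewrite linearZ /= trmxX [(x *: A)^T]linearZ.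
Qed.

Lemma mexp_exp_quarter : mexp (- (4%:R)^-1 *: (A ^+ 2)) = exp_quarter A.
Proof.
rewrite (@mexp_nilp R N _ N); first by rewrite /exp_quarter /nexp expr2.
by rewrite exprZmx -exprM mulnC exprM superdiag_nilp expr2 mul0r scaler0.
Qed.

(** The weight is e^(-x^2) times e^(A x) and its transpose; each factor is absorbed into one
    argument. *)
Lemma mx_innerE (P Q : 'M[{poly R}]_N) :
  mx_inner (weight A) (mxpoly_eval P) (mxpoly_eval Q) = mx_ip gauss_int (P *m pexp A) (Q *m pexp A).
Proof.
apply/matrixP => i j; rewrite mxE [RHS]mxE /gauss_int; apply: eq_Rintegral => x _.
rewrite /weight mexp_pexp mexp_trpexp -scalemxAr -scalemxAl mxE /gpoly /gauss_fun mulrC; congr (_ * _).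
have -> : mxpoly_eval P x *m (mxpoly_eval (pexp A) x *m (mxpoly_eval (pexp A) x)^T) *m (mxpoly_eval Q x)^T =
   mxpoly_eval (P *m pexp A) x *m (mxpoly_eval (Q *m pexp A) x)^T.
  by rewrite !map_horner_mul trmx_mul !mulmxA.
rewrite (_ : (mxpoly_eval (Q *m pexp A) x)^T = mxpoly_eval ((Q *m pexp A)^T) x).
  by rewrite -map_horner_mul mxE.
by rewrite /mxpoly_eval map_trmx.
Qed.

Variable Ph : nat -> 'M[{poly R}]_N.
Hypothesis Ph_mop : monic_mop (weight A) Ph.

Lemma renormalized_normal_form n x :
  renormalized A (Ph n) x *m mexp (x *: A) = mxpoly_eval (normal_form A Ph n) x.
Proof. by rewrite /renormalized mexp_exp_quarter mexp_pexp /normal_form !map_horner_mul map_horner_mC mulmxA. Qed.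

Lemma normal_form_entry_ODE n i j :
  hermite_op (normal_form A Ph n i j) + (2 * (n%:R + wJ i - wJ j)) *: normal_form A Ph n i j = 0.
Proof.
apply: (@normal_form_ODE R N gauss_int gauss_intD gauss_intZ gauss_int_parts gauss_int_definite
  A realJ wJ realJE superdiag_nilp superdiagJ).
- move=> m k mk; apply/matrixP => i' j'; rewrite mxE [RHS]mxE nth_default //.
  by apply: leq_trans mk; have [H _] := Ph_mop; exact: H.
- by move=> m k mk; have [_ H] := Ph_mop; rewrite -mx_innerE H.
Qed.

(* Truncation in n + j - i is harmless: the entry vanishes when n + j < i. *)
Definition hcoef n (i j : 'I_N) : R :=
  if (i <= n + j)%N then (normal_form A Ph n i j)`_(n + j - i) / (hermite (n + j - i) : {poly R})`_(n + j - i) else 0.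

(** The eigenvalue index is n + j - i: if it is a natural number the entry is a multiple of that
    Hermite polynomial, and if it is negative the entry is zero. *)
Lemma normal_form_entry n i j : normal_form A Ph n i j = hcoef n i j *: hermite (n + j - i).
Proof.
have := normal_form_entry_ODE n i j; rewrite -[n%:R + wJ i - wJ j]addrA wJ_diff /hcoef; case: leqP => ij H.
  apply: hermite_op_eigen_nat; rewrite -[RHS]H; congr (_ + (2 * _) *: _).
  by rewrite natrB // natrD addrA.
rewrite scale0r; apply: hermite_op_eigen_neg H _.
by rewrite addrA -natrD subr_lt0 ltr_nat.
Qed.

End WeightAlgebra.

(** * Conjugation by powers and the entries of the integrands *)

Section Powers.
Context {R : realType} {N : nat}.
Implicit Types z : R[i].

Lemma matJE (i j : 'I_N) : (matJ : 'M[R[i]]_N) i j = (i == j)%:R * (N - i.+1)%:R.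
Proof.
rewrite /matJ summxE (bigD1 i) //= !mxE eqxx /= big1 ?addr0 => [|k ki].
  by rewrite mulrC eq_sym.
by rewrite !mxE eq_sym (negbTE ki) mulr0.
Qed.

Lemma conj_mxpower z (C : 'M[R[i]]_N) (i j : 'I_N) :
  (mxpower z (- matJ) *m C *m mxpower z matJ) i j =
  cexp (clog z * (i%:R - j%:R)) * C i j /\
  (mxpower z matJ *m C *m mxpower z (- matJ)) i j =
  cexp (clog z * (j%:R - i%:R)) * C i j.
Proof.
pose w (k : 'I_N) : R[i] := (N - k.+1)%:R.
have D1 a b : mxpower z (matJ : 'M[R[i]]_N) a b = (a == b)%:R * cexp (clog z * w a).
  by apply: (@mexp_diag R N _ (fun a => clog z * w a)) => a' b'; rewrite mxE matJE mulrCA.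
have D2 a b : mxpower z (- (matJ : 'M[R[i]]_N)) a b = (a == b)%:R * cexp (clog z * (- w a)).
  by apply: (@mexp_diag R N _ (fun a => clog z * (- w a))) => a' b'; rewrite mxE mxE matJE !mulrN mulrCA.
have diag2 (M M' : 'M[R[i]]_N) (d d' : 'I_N -> R[i]) :
    (forall a b, M a b = (a == b)%:R * d a) -> (forall a b, M' a b = (a == b)%:R * d' a) ->
    (M *m C *m M') i j = d i * C i j * d' j.
  move=> HM HM'; rewrite mxE (bigD1 j) //= HM' eqxx mul1r big1 ?addr0 => [|k kj].
    congr (_ * _); rewrite mxE (bigD1 i) //= HM eqxx mul1r big1 ?addr0 // => k ki.
    by rewrite HM eq_sym (negbTE ki) !mul0r.
  by rewrite HM' (negbTE kj) mul0r mulr0.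
have wE (k : 'I_N) : w k = N%:R - k.+1%:R by rewrite /w natrB.
split.
- rewrite (diag2 _ _ _ _ D2 D1) mulrAC -cexpD -mulrDr; congr (cexp (_ * _) * _).
  by rewrite !wE -!natr1; ring.
- rewrite (diag2 _ _ _ _ D1 D2) mulrAC -cexpD -mulrDr; congr (cexp (_ * _) * _).
  by rewrite !wE -!natr1; ring.
Qed.

Lemma gamma_integrandE n (C : 'M[R[i]]_N) x z (i j : 'I_N) : slit z -> (i <= n + j)%N ->
  gamma_integrand n C x z i j = C i j * (phi x (n + j - i).+1 (clog z) / z).
Proof.
move=> sz ij; have z0 := slit_neq0 sz.
have M m : clog z *+ m = m%:R * clog z by rewrite mulr_natl.
have [E _] := conj_mxpower z C i j.
rewrite /gamma_integrand mxE E /phi [in X in cexp (gexp x X + _)]clog_slog // cexp_slog //.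
rewrite cexpD /gexp.
have -> : z ^+ n.+1 = z * cexp (clog z *+ n).
  by rewrite cexpMn [in RHS]clog_slog // cexp_slog // exprS.
have F : cexp (clog z * (i%:R - j%:R)) = cexp ((1 - (n + j - i).+1%:R) * clog z) * cexp (clog z *+ n).
  by rewrite -cexpD; congr cexp; rewrite !M -[(n + j - i).+1%:R]natr1 natrB // natrD; ring.
rewrite F; have c0 := cexp_neq0 (clog z *+ n).
by move: (cexp (clog z *+ n)) c0 (cexp (_ * clog z)) (cexp _) => u u0 v w; field; rewrite z0 u0.
Qed.

Lemma line_integrandE n (C : 'M[R[i]]_N) x z (i j : 'I_N) : slit z -> (i <= n + j)%N ->
  line_integrand n C x z i j = C i j * gauss_pow x (n + j - i) z.
Proof.
move=> sz ij; have z0 := slit_neq0 sz.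
have M m : clog z *+ m = m%:R * clog z by rewrite mulr_natl.
have [_ E] := conj_mxpower z C i j.
rewrite /line_integrand mxE E /gauss_pow.
have zX m : z ^+ m = cexp (clog z *+ m).
  by rewrite cexpMn clog_slog // cexp_slog.
rewrite !zX.
have F : cexp (clog z *+ (n + j - i)) = cexp (clog z *+ n) * cexp (clog z * (j%:R - i%:R)).
  by rewrite -cexpD; congr cexp; rewrite !M natrB // natrD; ring.
by rewrite F; move: (cexp _) (cexp _) (cexp _) => u v w; ring.
Qed.

Lemma gamma_integrand0 n (C : 'M[R[i]]_N) x z (i j : 'I_N) : C i j = 0 ->
  gamma_integrand n C x z i j = 0 /\ line_integrand n C x z i j = 0.
Proof.
move=> C0; have [E1 E2] := conj_mxpower z C i j.
by split; [rewrite /gamma_integrand mxE E1|rewrite /line_integrand mxE E2]; rewrite C0 !mulr0.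
Qed.

(** When n + j < i the truncated subtraction gives the wrong power of z, but the coefficient is zero
    and both sides vanish. *)
Lemma gamma_entry n (C : 'M[R[i]]_N) x z (i j : 'I_N) :
  slit z -> ((n + j < i)%N -> C i j = 0) ->
  gamma_integrand n C x z i j = C i j * (phi x (n + j - i).+1 (clog z) / z).
Proof.
move=> sz C0; have [ij|/C0 Cij] := leqP i (n + j)%N; first exact: gamma_integrandE.
by have [g0 _] := gamma_integrand0 n x z Cij; rewrite g0 Cij mul0r.
Qed.

Lemma line_entry n (C : 'M[R[i]]_N) x z (i j : 'I_N) :
  slit z -> ((n + j < i)%N -> C i j = 0) ->
  line_integrand n C x z i j = C i j * gauss_pow x (n + j - i) z.
Proof.
move=> sz C0; have [ij|/C0 Cij] := leqP i (n + j)%N; first exact: line_integrandE.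
by have [_ g0] := gamma_integrand0 n x z Cij; rewrite g0 Cij mul0r.
Qed.

Lemma eq_arc_int (g : R -> R[i]) (f f' : R[i] -> R[i]) a b :
  (forall t, f (g t) = f' (g t)) -> arc_int g f a b = arc_int g f' a b.
Proof. by move=> E; rewrite /arc_int; apply: complexP => /=; apply: eq_Rintegral => t _; rewrite E. Qed.

Lemma contour_limit (g : R -> R[i]) (f f' : R[i] -> R[i]) (l : R[i]) :
  (forall t, f (g t) = f' (g t)) ->
  (fun ab : R * R => arc_int g f' ab.1 ab.2 : R[i]^o) @
    filter_prod (ninfty_nbhs R) (pinfty_nbhs R) --> (l : R[i]^o) ->
  contour_cvg g f /\ contour_int g f = l.
Proof.
move=> E H.
have FF : ProperFilter (filter_prod (ninfty_nbhs R) (pinfty_nbhs R)) by exact: _.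
have H' : (fun ab : R * R => arc_int g f ab.1 ab.2 : R[i]^o) @
    filter_prod (ninfty_nbhs R) (pinfty_nbhs R) --> (l : R[i]^o).
  rewrite (_ : (fun ab : R * R => _) = fun ab : R * R => arc_int g f' ab.1 ab.2 : R[i]^o) //.
  by apply/funext => ab; exact: eq_arc_int.
by split; [exact: cvgP H'|exact: (@lim_complex R _ _ FF)].
Qed.

End Powers.

(** * The two integral representations *)

Theorem theorem2p1 (R : realType) (N : nat) (N_gt0 : (0 < N)%N)
    (nu : 'I_N.-1 -> R) (Phat : nat -> 'M[{poly R}]_N)
    (Phat_mop : monic_mop (weight (superdiag nu)) Phat) (n : nat) :
  exists C D : 'M[R[i]]_N,
    forall (gamma : R -> R[i]) (L : R),
      hankel_contour gamma -> 0 < L -> left_of_line gamma L ->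
    forall x : R,
      let A := superdiag nu in
      let Q := map_mx (real_complex R)
                 (renormalized A (Phat n) x *m mexp (x *: A)) in
      (mx_contour_cvg gamma (gamma_integrand n C x) /\
       Q = mx_contour_int gamma (gamma_integrand n C x)) /\
      (mx_contour_cvg (vertical_line L) (line_integrand n D x) /\
       Q = (expR (x ^+ 2))%:C *:
             mx_contour_int (vertical_line L) (line_integrand n D x)).

Proof.
set q := normal_form (superdiag nu) Phat n.
pose k (i j : 'I_N) : nat := (n + j - i)%N.
pose c (i j : 'I_N) : R := hcoef nu Phat n i j.
have c0 (i j : 'I_N) : (n + j < i)%N -> c i j = 0 by rewrite /c /hcoef ltnNge => /negbTE ->.
pose u : R[i] := 0 +i* (pi *+ 2); pose v : R[i] := 0 +i* Num.sqrt pi.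
have u0 : u != 0.
  by apply/eqP => /(congr1 (@complex.Im R)) /= /eqP; rewrite mulrn_eq0 /= gt_eqF // pi_gt0.
have v0 : v != 0.
  by apply/eqP => /(congr1 (@complex.Im R)) /= /eqP; rewrite gt_eqF // sqrtr_gt0 pi_gt0.
(* The factors k!/u and 2^k/v, with u = 2 pi i and v = i sqrt(pi), invert the values found for the
   contour and for the line. *)
exists (\matrix_(i, j) ((c i j * (k i j)`!%:R)%:C / u)), (\matrix_(i, j) ((c i j * 2 ^+ k i j)%:C / v)).
move=> gamma L Hg L0 _ x A Q.
have QE i j : Q i j = (c i j * (hermite (k i j)).[x])%:C.
  by rewrite /Q mxE (renormalized_normal_form nu Phat) mxE (normal_form_entry Phat_mop) hornerZ.
have sg t : slit (gamma t) by have [_ off _ _ _] := Hg; apply: slitP; exact: off.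
(* Since 0 < L the line stays off the cut, so the exponential of [clog] gives back its points. *)
have sl t : slit (vertical_line L t) by apply: slit_Re.
have G i j : contour_cvg gamma (fun z => gamma_integrand n
    (\matrix_(i, j) ((c i j * (k i j)`!%:R)%:C / u)) x z i j) /\
  contour_int gamma (fun z => gamma_integrand n
    (\matrix_(i, j) ((c i j * (k i j)`!%:R)%:C / u)) x z i j) = Q i j.
  set C := (\matrix_(i, j) ((c i j * (k i j)`!%:R)%:C / u)).
  have -> : Q i j = C i j * period x (k i j).+1.
    rewrite QE mxE period_hermite -/u mulrA mulfVK // -rmorphM; congr (_%:C).
    by field; rewrite pnatr_eq0 -lt0n fact_gt0.
  apply: (@contour_limit R gamma _ _ _ _ (@hankel_limit R x gamma (k i j).+1 (C i j) Hg)) => t.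
  by apply: gamma_entry => // ij; rewrite mxE c0 // mul0r mul0r.
have H i j : contour_cvg (vertical_line L) (fun z => line_integrand n
    (\matrix_(i, j) ((c i j * 2 ^+ k i j)%:C / v)) x z i j) /\
  (expR (x ^+ 2))%:C * contour_int (vertical_line L) (fun z => line_integrand n
    (\matrix_(i, j) ((c i j * 2 ^+ k i j)%:C / v)) x z i j) = Q i j.
  set C := (\matrix_(i, j) ((c i j * 2 ^+ k i j)%:C / v)).
  have [|cv ->] := @contour_limit R (vertical_line L) (fun z => line_integrand n C x z i j) _ _ _
     (@line_limit R x L (k i j) (C i j)).
    by move=> t; apply: line_entry => // ij; rewrite mxE c0 // mul0r mul0r.
  split => //; rewrite QE mxE -/v.
  have e1 : (expR (x ^+ 2))%:C * (expR (- x ^+ 2))%:C = 1 :> R[i].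
    by rewrite -rmorphM -expRD subrr expR0.
  transitivity (((expR (x ^+ 2))%:C * (expR (- x ^+ 2))%:C) * ((c i j * 2 ^+ k i j)%:C * ((hermite (k i j)).[x] / 2 ^+ k i j)%:C) * (v / v)).
    move: (expR _)%:C (expR _)%:C (_ * _)%:C (_ / _)%:C => a b d e; ring.
  rewrite e1 mulfV // mul1r mulr1 -rmorphM; congr (_%:C).
  by field; rewrite expf_neq0.
split; split.
- by move=> i j; have [] := G i j.
- by apply/matrixP => i j; rewrite [RHS]mxE; have [_ ->] := G i j.
- by move=> i j; have [] := H i j.
- by apply/matrixP => i j; rewrite [RHS]mxE [mx_contour_int _ _ _ _]mxE; have [_ ->] := H i j.
Qed.
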